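(* For each $n\in\mathbb N$ let $$K=\frac{B_2^n}{\operatorname{vol}_n(B_2^n)^{1/n}},\qquad L=\frac12 B_\infty^n,\qquad a=1,\qquad b=\frac{1}{e-1},$$ and let $M_n$ be the convex body in $\mathbb R^{n+1}$ $$M_n=\operatorname{co}[(K,-a),(L,b)]=\{t(x,-a)+(1-t)(y,b): x\in K,\ y\in L,\ 0\le t\le 1\}.$$ Then: (i) $\lim_{n\to\infty} g(M_n)=0$. (ii) Let $$s_0=-\frac{\sqrt e-1}{\sqrt e+\frac1{e-1}},\qquad s_1=\frac{2-\sqrt{e\pi}}{\sqrt{e\pi}+\frac{2}{e-1}}.$$ For every $\varepsilon>0$ there is $n_0$ such that for all $n\ge n_0$ the $(n+1)$-st coordinate of the centroid $g(M_n^\circ)$ of $M_n^\circ$ satisfies $$s_0-\varepsilon\le g(M_n^\circ)(n+1)\le s_1+\varepsilon .$$ Moreover, the Santaló point $s_n^*=s(M_n^{g(M_n)})$ of $M_n^{g(M_n)}$ equals $0$, and therefore the centroid $g_n^*=g(M_n^{g(M_n)})$ and the Santaló point $s_n^*$ of $M_n^{g(M_n)}$ satisfy $$\frac{\sqrt e-1}{\sqrt e+\frac{1}{e-1}}\ \ge\ \limsup_{n\to\infty}\|g_n^*-s_n^*\|_2\ \ge\ \liminf_{n\to\infty}\|g_n^*-s_n^*\|_2=\liminf_{n\to\infty}\|g_n^*\|_2\ \ge\ \frac{\sqrt{e\pi}-2}{\sqrt{e\pi}+\frac{2}{e-1}} .$$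
   Context: $B_2^n$ is the Euclidean unit ball and $B_\infty^n=[-1,1]^n$ the unit ball of $\ell_\infty^n$. A convex body is a compact convex set with nonempty interior. The centroid of a convex body $C\subset\mathbb R^m$ is $g(C)=\frac{1}{\operatorname{vol}_m(C)}\int_C x\,dx$, and $g(C)(i)$ denotes its $i$-th coordinate. For $x\in C$, $C^x=(C-x)^\circ=\{y\in\mathbb R^m:\langle y,z-x\rangle\le1\text{ for all }z\in C\}$, and $C^\circ=C^0$. The Santaló point $s(C)$ is the unique point $x$ at which $\operatorname{vol}_m(C)\operatorname{vol}_m(C^x)$ attains its minimum. Since $g(M_n)$ lies in spaces of varying dimension, $\lim_{n\to\infty} g(M_n)=0$ means $\|g(M_n)\|_2\to0$. *)

(* Defs.v *)
(* R^n is rendered as the row vectors ['rV[R]_n], for [R : realType]. *)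
From HB Require Import structures.
From mathcomp Require Import all_boot all_order all_algebra.
From mathcomp Require Import all_classical all_reals all_analysis.

Set Implicit Arguments.
Unset Strict Implicit.
Unset Printing Implicit Defensive.

Import Order.TTheory GRing.Theory Num.Theory.
Import numFieldNormedType.Exports.

Local Open Scope classical_set_scope.
Local Open Scope ring_scope.

(* The library equips [n.-tuple T] with the product sigma-algebra, but not
   row vectors; the same coordinate-generated sigma-algebra is used here (over
   the Borel sets of R, so these are the Borel sets of R^n). *)
Section measurable_rV.
Context {R : realType}.
Variable n : nat.

Let coors : 'I_n -> 'rV[R]_n -> measurableTypeR R := fun i x => x ord0 i.

Let rV_set0 : g_sigma_preimage coors set0.
Proof. exact: sigma_algebra0. Qed.

Let rV_setC A : g_sigma_preimage coors A -> g_sigma_preimage coors (~` A).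
Proof. exact: sigma_algebraC. Qed.

Let rV_bigcup (F : (set 'rV[R]_n)^nat) :
  (forall i, g_sigma_preimage coors (F i)) ->
  g_sigma_preimage coors (\bigcup_i (F i)).
Proof. exact: sigma_algebra_bigcup. Qed.

HB.instance Definition _ := @isMeasurable.Build
  (measure_tuple_display default_measure_display)
  'rV[R]_n (g_sigma_preimage coors) rV_set0 rV_setC rV_bigcup.

Lemma measurable_coord (i : 'I_n) :
  measurable_fun [set: 'rV[R]_n] (fun x => x ord0 i : measurableTypeR R).
Proof.
move=> _ Y mY; rewrite setTI; apply: sub_sigma_algebra => /=.
rewrite -bigcup_seq/=; exists i => /=; first by rewrite mem_index_enum.
by exists Y => //; rewrite setTI.
Qed.

Lemma measurable_fun_coordP d (T : measurableType d) (f : T -> 'rV[R]_n) :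
  (forall i, measurable_fun [set: T]
               (fun x => f x ord0 i : measurableTypeR R)) ->
  measurable_fun [set: T] f.
Proof.
move=> mf.
have sub : g_sigma_preimage (fun i => coors i \o f) `<=` measurable.
  apply: smallest_sub; first exact: sigma_algebra_measurable.
  rewrite -bigcup_seq/=; apply: bigcup_sub => i _.
  by move=> A [B mB <-]; exact: mf.
move=> _ A mA; apply: sub.
by rewrite g_sigma_preimage_comp; exists A.
Qed.

End measurable_rV.

(* (x, t) in R^n x R seen as a vector of R^(n+1), with [t] as last coordinate,
   that is the coordinate of index [ord_max]. *)
Definition snoc (R : realType) (n : nat) (x : 'rV[R]_n) (t : R) : 'rV[R]_n.+1 :=
  \row_(i < n.+1) if unlift ord_max i is Some j then x ord0 j else t.

Section lebesgue_measure_rV.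
Context {R : realType}.

Let T (n : nat) : Type := (measurableTypeR R * 'rV[R]_n)%type.

Let glue (n : nat) (p : T n) : 'rV[R]_n.+1 := snoc p.2 p.1.

Let measurable_glue (n : nat) : measurable_fun [set: T n] (@glue n).
Proof.
apply: measurable_fun_coordP => i; rewrite /glue /snoc.
case: (unliftP ord_max i) => [j|] ->.
  rewrite [X in measurable_fun _ X](_ : _ =
      (fun x : 'rV[R]_n => x ord0 j : measurableTypeR R) \o snd).
    by apply: measurableT_comp; [exact: measurable_coord|exact: measurable_snd].
  by apply/funext => p /=; rewrite mxE liftK.
rewrite [X in measurable_fun _ X](_ : _ = fst); first exact: measurable_fst.
by apply/funext => p /=; rewrite mxE unlift_none.
Qed.

Let glueK (n : nat) (p : T n) :
  ((glue p) ord0 ord_max, \row_j (glue p) ord0 (lift ord_max j)) = p.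
Proof.
case: p => t x; rewrite /glue /snoc/=; congr pair.
  by rewrite mxE unlift_none.
by apply/rowP => j; rewrite !mxE liftK.
Qed.

Let measurable_unglue (n : nat) : measurable_fun [set: 'rV[R]_n.+1]
  (fun z => (z ord0 ord_max, \row_j z ord0 (lift ord_max j)) : T n).
Proof.
have m1 := @measurable_coord R n.+1 ord_max.
suff m2 : measurable_fun [set: 'rV[R]_n.+1]
    (fun z => \row_j z ord0 (lift ord_max j) : 'rV[R]_n).
  exact: measurable_fun_pair m1 m2.
apply: measurable_fun_coordP => i /=.
rewrite [X in measurable_fun _ X](_ : _ =
  (fun x : 'rV[R]_n.+1 => x ord0 (lift ord_max i) : measurableTypeR R)).
  exact: measurable_coord.
by apply/funext => z /=; rewrite mxE.
Qed.

Section step.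
Variables (n : nat) (mu : {sigma_finite_measure set 'rV[R]_n -> \bar R}).

(* Product of [mu] with the Lebesgue measure of the last coordinate. *)
Definition lebesgue_snoc : set 'rV[R]_n.+1 -> \bar R :=
  pushforward (lebesgue_measure \x mu)%E (fun p => snoc p.2 p.1).

Let lebesgue_snoc0 : lebesgue_snoc set0 = 0%E.
Proof. by rewrite /lebesgue_snoc /pushforward preimage_set0 measure0. Qed.

Let lebesgue_snoc_ge0 A : (0 <= lebesgue_snoc A)%E.
Proof. by rewrite /lebesgue_snoc /pushforward; exact: measure_ge0. Qed.

Let lebesgue_snoc_sigma_additive : semi_sigma_additive lebesgue_snoc.
Proof.
exact: (@measure_semi_sigma_additive _ _ _
  (measure_function_pushforward__canonical__measure_function_Measure
     (lebesgue_measure \x mu)%E (@measurable_glue n))).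
Qed.

HB.instance Definition _ := isMeasure.Build _ _ _ lebesgue_snoc
  lebesgue_snoc0 lebesgue_snoc_ge0 lebesgue_snoc_sigma_additive.

Let lebesgue_snoc_sigma_finite : sigma_finite setT lebesgue_snoc.
Proof.
have /sigma_finiteP[F [TF ndF Foo]] := sigma_finiteT (@lebesgue_measure R).
have /sigma_finiteP[G [TG ndG Goo]] := sigma_finiteT mu.
pose unglue (z : 'rV[R]_n.+1) : T n :=
  (z ord0 ord_max, \row_j z ord0 (lift ord_max j)).
exists (fun k => unglue @^-1` (F k `*` G k)).
  apply/esym; rewrite -subTset => z _.
  have : [set: measurableTypeR R] (unglue z).1 by [].
  rewrite TF => -[k _ Fk].
  have : [set: 'rV[R]_n] (unglue z).2 by [].
  rewrite TG => -[l _ Gl]; exists (maxn k l) => //; split.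
  - by move: Fk; exact/subsetPset/ndF/leq_maxl.
  - by move: Gl; exact/subsetPset/ndG/leq_maxr.
move=> k; have [mF Fk] := Foo k; have [mG Gk] := Goo k; split.
  rewrite -[X in measurable X]setTI; apply: measurable_unglue => //.
  exact: measurableX.
rewrite /lebesgue_snoc /pushforward (_ : _ @^-1` _ = F k `*` G k).
  by rewrite product_measure1E// lte_mul_pinfty// ge0_fin_numE.
rewrite -comp_preimage.
have -> : unglue \o (fun p : T n => snoc p.2 p.1) = id.
  by apply/funext => p; exact: (glueK p).
by rewrite preimage_id.
Qed.

HB.instance Definition _ := @Measure_isSigmaFinite.Build _ _ _ lebesgue_snoc
  lebesgue_snoc_sigma_finite.

End step.

(* Lebesgue measure on R^n; on the one-point space R^0 it is the unit mass. *)
Fixpoint vol (n : nat) : {sigma_finite_measure set 'rV[R]_n -> \bar R} :=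
  match n with
  | 0 => \d_(0 : 'rV[R]_0)
  | m.+1 => lebesgue_snoc (vol m)
  end.

End lebesgue_measure_rV.

(* [vol n] is normalized as expected: the volume of a box is the product of its
   side lengths. *)
Lemma measurable_box (R : realType) (n : nat) (a b : 'I_n -> R) :
  measurable [set x : 'rV[R]_n | forall i, a i <= x ord0 i <= b i].
Proof.
rewrite (_ : [set x | _] = \bigcap_(i in [set: 'I_n])
    ((fun x : 'rV[R]_n => x ord0 i : measurableTypeR R) @^-1`
      [set` `[a i, b i]])); last first.
  apply/seteqP; split=> x /= xab i; first by move=> _ /=; rewrite in_itv/=.
  by have := xab i I; rewrite /= in_itv/=.
apply: fin_bigcap_measurable => // i _.
by rewrite -[X in measurable X]setTI; apply: measurable_coord.
Qed.

Lemma vol_box (R : realType) (n : nat) (a b : 'I_n -> R) :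
  (forall i, a i <= b i) ->
  vol n [set x : 'rV[R]_n | forall i, a i <= x ord0 i <= b i] =
  (\prod_(i < n) (b i - a i))%:E.
Proof.
elim: n => [|n IHn] in a b * => ab /=.
  by rewrite big_ord0 diracE mem_set// => -[].
pose ab' := [set x : 'rV[R]_n |
  forall j, a (lift ord_max j) <= x ord0 j <= b (lift ord_max j)].
rewrite /lebesgue_snoc /pushforward.
rewrite (_ : _ @^-1` _ = [set` `[a ord_max, b ord_max]] `*` ab'); last first.
  apply/seteqP; split=> -[t x] /=.
    move=> abtx; split => [|j].
      by have := abtx ord_max; rewrite mxE unlift_none/= in_itv.
    by have := abtx (lift ord_max j); rewrite mxE liftK.
  move=> [+ abx] i; rewrite in_itv/= => abt.
  by rewrite mxE; case: unliftP => [j|] ->.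
rewrite product_measure1E//; last exact: measurable_box.
rewrite IHn; last by move=> j; exact: ab.
rewrite big_ord_recr/= mulrC EFinM lebesgue_measure_itv/= lte_fin.
have liftE j : lift ord_max j = widen_ord (leqnSn n) j.
  by apply/val_inj => /=; rewrite /bump leqNgt ltn_ord.
under eq_bigr do rewrite liftE.
have [_|ba] := ltP (a ord_max) (b ord_max); first by rewrite -EFinB.
by rewrite (_ : b ord_max = a ord_max) ?subrr//; apply/le_anti; rewrite ba ab.
Qed.

Section bodies.
Context {R : realType}.

(* The norm [`|x|] of the library on row vectors is the sup norm, hence the
   following definitions. *)
Definition dotv (n : nat) (x y : 'rV[R]_n) : R :=
  \sum_(i < n) x ord0 i * y ord0 i.

Definition norm2 (n : nat) (x : 'rV[R]_n) : R := Num.sqrt (dotv x x).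

Definition centroid (n : nat) (C : set 'rV[R]_n) : 'rV[R]_n :=
  (fine (vol n C))^-1 *: \row_(i < n) \int[vol n]_(x in C) x ord0 i.

(* C^x = (C - x)^o *)
Definition polar_at (n : nat) (C : set 'rV[R]_n) (x : 'rV[R]_n) :
  set 'rV[R]_n := [set y | forall z, C z -> dotv y (z - x) <= 1].

Definition polar (n : nat) (C : set 'rV[R]_n) : set 'rV[R]_n := polar_at C 0.

(* Volume product of C at x; +oo when C^x has infinite volume, as happens for
   x on the boundary of a convex body C. *)
Definition volume_product (n : nat) (C : set 'rV[R]_n) (x : 'rV[R]_n) :
  \bar R := (vol n C * vol n (polar_at C x))%E.

(* [s] is the unique point of C at which the volume product is minimal. *)
Definition is_santalo_point (n : nat) (C : set 'rV[R]_n) (s : 'rV[R]_n) : Prop :=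
  let minimizer x :=
    C x /\ forall y, C y -> (volume_product C x <= volume_product C y)%E in
  minimizer s /\ forall x, minimizer x -> x = s.

(* Meaningful only when [is_santalo_point C] is inhabited (it has at most one
   element); the default value 0 is returned otherwise. *)
Definition santalo_point (n : nat) (C : set 'rV[R]_n) : 'rV[R]_n :=
  xget 0 [set s | is_santalo_point C s].

Definition ball2 (n : nat) : set 'rV[R]_n := [set x | norm2 x <= 1].

Definition cube (n : nat) : set 'rV[R]_n :=
  [set x | forall i, -1 <= x ord0 i <= 1].

(* co[(K, h), (L, k)], for K and L in R^n placed at heights h and k. *)
Definition co_lift (n : nat) (K : set 'rV[R]_n) (h : R)
    (L : set 'rV[R]_n) (k : R) : set 'rV[R]_n.+1 :=
  [set z | exists x y (t : R), [/\ K x, L y, 0 <= t <= 1 &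
    z = t *: snoc x h + (1 - t) *: snoc y k]].

Definition bodyK (n : nat) : set 'rV[R]_n :=
  [set (fine (vol n (@ball2 n)) `^ (n%:R)^-1)^-1 *: x | x in @ball2 n].

Definition bodyL (n : nat) : set 'rV[R]_n :=
  [set 2^-1 *: x | x in @cube n].

Definition bodyM (n : nat) : set 'rV[R]_n.+1 :=
  let a := 1 in
  let b := 1 / (expR 1 - 1) in
  co_lift (@bodyK n) (- a) (@bodyL n) b.

End bodies.

Arguments bodyM R n : clear implicits.

(* Main.v *)
Require Import Defs.
From mathcomp Require Import all_boot all_order all_algebra.
From mathcomp Require Import all_classical all_reals all_analysis.
From mathcomp Require Import measurable_realfun ring lra.

Set Implicit Arguments.
Unset Strict Implicit.
Unset Printing Implicit Defensive.

Import Order.TTheory GRing.Theory Num.Theory.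
Import numFieldNormedType.Exports.

Local Open Scope classical_set_scope.
Local Open Scope ring_scope.

Local Notation mu := lebesgue_measure.

(* The section of M_n at height t is the sum of a cube and a euclidean ball, so
   by Steiner's formula the last coordinate of g(M_n) is determined by a weighted
   mean of j <= n with weights vol(B_2^j) r^j, r being the radius of K; the
   recursion of the ball volumes and the log-concavity of the weights give its
   limit.
   The polar of M_n at a point of its axis consists of the (x, s) with
   r |x|_2 <= 1 + al s and |x|_1 / 2 <= 1 - be s.  For s above s1 almost all of
   the cross-polytope given by the second inequality satisfies the first one,
   and for s below s0 almost all of the ball given by the first inequality
   satisfies the second one: both follow from Markov's inequality and from the
   means of |x|_2^2 over the cross-polytope and of |x|_1 over the ball.  Hence
   beyond these heights the polar is comparable to a cone whose centroid is
   within O(1 / n) of its base, which bounds its centroid.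
   The bipolar of M_n - g(M_n) is itself, with centroid 0, and a body whose
   polar P has centroid 0 has its Santalo point at 0: the volume of its polar at
   x is the integral over y in P of a function of <x, y> that is at least
   1 + (m + 1) <x, y>, in dimension m, and strictly larger on part of P, while
   the integral of this affine function is the volume of P. *)

(** * Changes of variables *)

(** The constants s0 and s1 are the heights at which the two means become critical in the limit.
    Since n / r^2 tends to 2 pi e, the mean of r^2 |x|_2^2 / (1 + s)^2 over the cross-polytope tends
    to 4 / (e pi) times ((1 - b s) / (1 + s))^2, which is 1 at s1, and the mean of |x|_1 / (2 (1 - b
    s)) over the ball tends to sqrt e times (1 + s) / (1 - b s), which is 1 at s0. Between these
    heights neither inequality is shown to be nearly redundant, so the centroid is only located
    between them. The point of the axis at which the polar is taken is only asked to have a height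
    tending to 0: the height 0 gives the polar of M_n and the height of g(M_n) gives the other body,
    so one estimate serves both. Only the n-th root of the volume of the ball matters, so bounds on
    factorials up to polynomial factors suffice. *)

Section affine_change_of_variable.
Context {R : realType}.

Let affine (a b : R) : measurableTypeR R -> measurableTypeR R := fun t => a * t + b.

Let maffine a b : measurable_fun setT (affine a b).
Proof. by apply: measurable_funD => //; exact: measurable_funM. Qed.

(** Both sides are measures in [A], so by uniqueness of Lebesgue measure it suffices to compare them
    on half-open intervals. *)
Lemma lebesgue_measure_affine (a b : R) (A : set (measurableTypeR R)) :
  0 < a -> measurable A ->
  (a%:E * mu (affine a b @^-1` A) = mu A)%E.
Proof.
move=> a0 mA.
pose pm := measure_function_pushforward__canonical__measure_function_Measure
             (@lebesgue_measure R) (maffine a b).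
pose sm := mscale (NngNum (ltW a0)) pm.
suff : lebesgue_measure A = sm A by move=> ->.
apply: lebesgue_measure_unique => //= _ [[c d]] _ <-.
rewrite /sm /mscale /= /pushforward.
rewrite (_ : affine a b @^-1` _ = `](c - b) / a, (d - b) / a]%classic); last first.
  by apply/seteqP; split => t /=; rewrite /affine !in_itv/= ltr_pdivrMr// ler_pdivlMr// ltrBlDr lerBrDr (mulrC t).
rewrite !lebesgue_measure_itv/= !lte_fin ltr_pM2r ?invr_gt0// ltrD2r.
case: ifPn => _; last by rewrite mule0.
rewrite -EFinB -EFinM; congr EFin; field; lra.
Qed.

Lemma integral_affine_gt0 (a b : R) (f : measurableTypeR R -> \bar R) : 0 < a ->
  measurable_fun setT f -> (forall t, 0 <= f t)%E ->
  (\int[mu]_t f t = a%:E * \int[mu]_t f (a * t + b)%R)%E.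
Proof.
move=> a0 mf f0.
pose pm := measure_function_pushforward__canonical__measure_function_Measure
             (@lebesgue_measure R) (maffine a b).
pose sm := mscale (NngNum (ltW a0)) pm.
transitivity (\int[sm]_t f t)%E.
  apply: eq_measure_integral => A mA _.
  exact/esym/lebesgue_measure_affine.
rewrite ge0_integral_mscale//=; congr (_ * _)%E.
by rewrite ge0_integral_pushforward.
Qed.

Lemma integral_oppr (f : measurableTypeR R -> \bar R) :
  measurable_fun setT f -> (forall t, 0 <= f t)%E ->
  (\int[mu]_t f t = \int[mu]_t f (- t)%R)%E.
Proof.
move=> mf f0.
have mN : measurable_fun setT (-%R : measurableTypeR R -> measurableTypeR R) by [].
pose pm := measure_function_pushforward__canonical__measure_function_Measure
             (@lebesgue_measure R) mN.
transitivity (\int[pm]_t f t)%E.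
  by apply: eq_measure_integral => A mA _; exact/esym/lebesgue_measureN.
by rewrite ge0_integral_pushforward.
Qed.

Lemma integral_affine (a b : R) (f : measurableTypeR R -> \bar R) : a != 0 ->
  measurable_fun setT f -> (forall t, 0 <= f t)%E ->
  (\int[mu]_t f t = `|a|%:E * \int[mu]_t f (a * t + b)%R)%E.
Proof.
move=> /lt_total/orP[a0|a0] mf f0; last by rewrite gtr0_norm//; exact: integral_affine_gt0.
rewrite ltr0_norm// (integral_affine_gt0 (a := - a) b) ?oppr_gt0//.
congr (_ * _)%E; rewrite integral_oppr//; last exact: (measurableT_comp mf (@maffine (- a) b)).
by under eq_integral do rewrite mulrNN.
Qed.

Lemma integral_shift (b : R) (f : measurableTypeR R -> \bar R) :
  measurable_fun setT f -> (forall t, 0 <= f t)%E ->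
  (\int[mu]_t f t = \int[mu]_t f (t + b)%R)%E.
Proof.
move=> mf f0; rewrite (integral_affine_gt0 b ltr01)// mul1e.
by under eq_integral do rewrite mul1r.
Qed.

End affine_change_of_variable.

Section integral_rV.
Context {R : realType}.

Lemma measurable_snoc (n : nat) :
  measurable_fun setT (fun p : measurableTypeR R * 'rV[R]_n => snoc p.2 p.1).
Proof.
apply: measurable_fun_coordP => i; rewrite /snoc.
case: (unliftP ord_max i) => [j|] ->.
  rewrite [X in measurable_fun _ X](_ : _ =
      (fun x : 'rV[R]_n => x ord0 j : measurableTypeR R) \o snd).
    by apply: measurableT_comp; [exact: measurable_coord|exact: measurable_snd].
  by apply/funext => p /=; rewrite mxE liftK.
rewrite [X in measurable_fun _ X](_ : _ = fst); first exact: measurable_fst.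
by apply/funext => p /=; rewrite mxE unlift_none.
Qed.

Lemma measurable_snoc1 (n : nat) (t : R) :
  measurable_fun setT (fun x : 'rV[R]_n => snoc x t).
Proof.
apply: measurable_fun_coordP => i; case: (unliftP ord_max i) => [j|] ->.
  under eq_fun do rewrite mxE liftK.
  exact: measurable_coord.
by under eq_fun do rewrite mxE unlift_none; exact: measurable_cst.
Qed.

(** Volumes and moments are computed below by induction on the dimension, from horizontal sections,
    through this form of Tonelli's theorem. *)
Lemma integral_snoc (n : nat) (f : 'rV[R]_n.+1 -> \bar R) :
  measurable_fun setT f -> (forall z, 0 <= f z)%E ->
  (\int[vol n.+1]_z f z = \int[mu]_t \int[vol n]_x f (snoc x t))%E.
Proof.
move=> mf f0.
transitivity (\int[mu \x vol n]_p f (snoc p.2 p.1))%E.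
  exact: (ge0_integral_pushforward (@measurable_snoc n)
    (mu \x vol n)%E measurableT mf (fun z _ => f0 z)).
rewrite (@fubini_tonelli1 _ _ _ _ _ mu (vol n) (fun p => f (snoc p.2 p.1)))//=.
exact: (measurableT_comp mf (@measurable_snoc n)).
Qed.

Lemma measurable_integral_snoc (n : nat) (f : 'rV[R]_n.+1 -> \bar R) :
  measurable_fun setT f -> (forall z, 0 <= f z)%E ->
  measurable_fun setT
    (fun t : measurableTypeR R => \int[vol n]_x f (snoc x t))%E.
Proof.
move=> mf f0.
have mg := measurableT_comp mf (@measurable_snoc n).
exact: (@measurable_fun_fubini_tonelli_F _ _ _ _ _ (vol n) (fun p => f (snoc p.2 p.1))).
Qed.

Lemma measurable_section (n : nat) (A : set 'rV[R]_n.+1) (t : R) :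
  measurable A -> measurable [set x | A (snoc x t)].
Proof. by move=> mA; rewrite -[X in measurable X]setTI; apply: measurable_snoc1. Qed.

Lemma vol_indic (n : nat) (A : set 'rV[R]_n) : measurable A ->
  (vol n A = \int[vol n]_x (\1_A x)%:E)%E.
Proof. by move=> mA; rewrite integral_indic// setIT. Qed.

Lemma measurable_eindic (n : nat) (A : set 'rV[R]_n) : measurable A ->
  measurable_fun setT (fun x => (\1_A x)%:E : \bar R).
Proof. by move=> mA; exact/measurable_EFinP/measurable_indic. Qed.

Lemma vol_snoc (n : nat) (A : set 'rV[R]_n.+1) : measurable A ->
  (vol n.+1 A = \int[mu]_t vol n [set x | A (snoc x t)])%E.
Proof.
move=> mA.
rewrite vol_indic// integral_snoc//; last exact: measurable_eindic.
apply: eq_integral => t _; rewrite vol_indic//; exact: measurable_section.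
Qed.

Lemma measurable_vol_section (n : nat) (A : set 'rV[R]_n.+1) : measurable A ->
  measurable_fun setT (fun t : measurableTypeR R => vol n [set x | A (snoc x t)]).
Proof.
move=> mA.
rewrite [X in measurable_fun _ X](_ : _ =
  (fun t => \int[vol n]_x (\1_A (snoc x t))%:E)%E); last first.
  by apply/funext => t; rewrite vol_indic//; exact: measurable_section.
by apply: (@measurable_integral_snoc n (fun z => (\1_A z)%:E)) => //; exact: measurable_eindic.
Qed.

Lemma snocZ (n : nat) (c : R) (x : 'rV[R]_n) t : c *: snoc x t = snoc (c *: x) (c * t).
Proof. by apply/rowP => i; rewrite !mxE; case: unlift => [j|//]; rewrite mxE. Qed.

Lemma snocD (n : nat) (x y : 'rV[R]_n) t s : snoc x t + snoc y s = snoc (x + y) (t + s).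
Proof. by apply/rowP => i; rewrite !mxE; case: unlift => [j|//]; rewrite mxE. Qed.

Lemma snoc_max (n : nat) (x : 'rV[R]_n) t : snoc x t ord0 ord_max = t.
Proof. by rewrite mxE unlift_none. Qed.

Lemma snoc_lift (n : nat) (x : 'rV[R]_n) t j : snoc x t ord0 (lift ord_max j) = x ord0 j.
Proof. by rewrite mxE liftK. Qed.

Lemma snocP (n : nat) (z : 'rV[R]_n.+1) :
  z = snoc (\row_j z ord0 (lift ord_max j)) (z ord0 ord_max).
Proof. by apply/rowP => i; rewrite !mxE; case: unliftP => [j|] ->; rewrite ?mxE. Qed.

Lemma big_snoc (n : nat) (T : Type) (idx : T) (op : Monoid.law idx)
    (F : 'I_n.+1 -> T) :
  \big[op/idx]_(i < n.+1) F i = op (\big[op/idx]_(j < n) F (lift ord_max j)) (F ord_max).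
Proof.
rewrite big_ord_recr/=; congr (op _ _); apply: eq_bigr => j _; congr F.
by apply/val_inj => /=; rewrite /bump leqNgt ltn_ord.
Qed.

Lemma measurable_scale (n : nat) (c : R) :
  measurable_fun setT (fun x : 'rV[R]_n => c *: x).
Proof.
apply: measurable_fun_coordP => i.
under eq_fun do rewrite mxE.
by apply: measurable_funM => //; exact: measurable_coord.
Qed.

Lemma integral_scale (n : nat) (c : R) (f : 'rV[R]_n -> \bar R) : c != 0 ->
  measurable_fun setT f -> (forall x, 0 <= f x)%E ->
  (\int[vol n]_x f x = (`|c| ^+ n)%:E * \int[vol n]_x f (c *: x)%R)%E.
Proof.
move=> c0; elim: n f => [|n IHn] f mf f0.
  by rewrite expr0 mul1e; apply: eq_integral => x _; congr f; apply/rowP => -[].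
rewrite (integral_snoc mf f0) (integral_affine 0 c0)//; last 2 first.
- exact: measurable_integral_snoc.
- by move=> t; exact: integral_ge0.
have mfc : measurable_fun setT (fun z : 'rV[R]_n.+1 => f (c *: z)).
  exact: measurableT_comp mf (@measurable_scale n.+1 c).
rewrite (integral_snoc mfc (fun z => f0 (c *: z))) exprSr EFinM -muleA [in RHS]muleCA; congr (_ * _)%E.
rewrite -ge0_integralZl//; last 2 first.
- exact: (@measurable_integral_snoc n (fun z => f (c *: z))).
- by move=> t _; exact: integral_ge0.
apply: eq_integral => t _; rewrite addr0 (IHn (fun x => f (snoc x (c * t))))//.
  by congr (_ * _)%E; apply: eq_integral => x _; rewrite snocZ.
exact: measurableT_comp mf (@measurable_snoc1 n (c * t)).
Qed.

Lemma vol_scale (n : nat) (c : R) (A : set 'rV[R]_n) : c != 0 -> measurable A ->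
  (vol n A = (`|c| ^+ n)%:E * vol n [set x | A (c *: x)%R])%E.
Proof.
move=> c0 mA.
have mcA : measurable [set x | A (c *: x)].
  by rewrite -[X in measurable X]setTI; apply: measurable_scale.
by rewrite !vol_indic// (integral_scale c0)//; exact: measurable_eindic.
Qed.

(** Only shifts along the last axis occur, because the centroid of M_n lies on that axis. *)
Lemma integral_shift_last (n : nat) (b : R) (f : 'rV[R]_n.+1 -> \bar R) :
  measurable_fun setT f -> (forall z, 0 <= f z)%E ->
  (\int[vol n.+1]_z f z = \int[vol n.+1]_z f (z + snoc 0 b)%R)%E.
Proof.
move=> mf f0.
have mfb : measurable_fun setT (fun z : 'rV[R]_n.+1 => f (z + snoc 0 b)).
  apply: measurableT_comp mf _; apply: measurable_fun_coordP => i.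
  under eq_fun do rewrite mxE.
  by apply: measurable_funD => //; exact: measurable_coord.
rewrite (integral_snoc mf f0) (integral_snoc mfb (fun z => f0 (z + snoc 0 b))).
rewrite (integral_shift b (measurable_integral_snoc mf f0)); last first.
  by move=> t; exact: integral_ge0.
by apply: eq_integral => t _; apply: eq_integral => x _; rewrite snocD addr0.
Qed.

(** On each horizontal section this is the dilation of ratio -1; it is the symmetry that places the
    centroids on the last axis. *)
Lemma integral_reflect (n : nat) (f : 'rV[R]_n.+1 -> \bar R) :
  measurable_fun setT f -> (forall z, 0 <= f z)%E ->
  (\int[vol n.+1]_z f z =
   \int[vol n.+1]_z f (snoc (- \row_j z ord0 (lift ord_max j)) (z ord0 ord_max)))%E.
Proof.
move=> mf f0.
have mfr : measurable_fun setT (fun z : 'rV[R]_n.+1 =>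
    f (snoc (- \row_j z ord0 (lift ord_max j)) (z ord0 ord_max))).
  apply: measurableT_comp mf _; apply: measurable_fun_coordP => i.
  case: (unliftP ord_max i) => [j|] ->.
    under eq_fun do rewrite snoc_lift !mxE.
    by apply: measurableT_comp => //; exact: measurable_coord.
  by under eq_fun do rewrite snoc_max; exact: measurable_coord.
rewrite (integral_snoc mf f0) (integral_snoc mfr (fun=> f0 _)).
apply: eq_integral => t _.
rewrite (@integral_scale n (-1) (fun x => f (snoc x t))) ?oppr_eq0//; last first.
  exact: measurableT_comp mf (@measurable_snoc1 n t).
rewrite normrN1 expr1n mul1e; apply: eq_integral => x _; rewrite scaleN1r snoc_max.
by congr (f (snoc (- _) _)); apply/rowP => j; rewrite mxE snoc_lift.
Qed.

End integral_rV.

(** * Wallis integrals *)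

Section one_variable_integrals.
Context {R : realType}.
Implicit Types (k : nat) (x : R).

Lemma integral_is_derive (F f : R -> R) (a b : R) : a < b ->
  (forall x, is_derive x 1 F (f x)) -> continuous f ->
  (\int[mu]_(x in `[a, b]) (f x)%:E = (F b - F a)%:E)%E.
Proof.
move=> ab dF cf.
have cF : continuous F.
  by move=> x; apply/differentiable_continuous/derivable1_diffP; case: (dF x).
rewrite (@continuous_FTC2 _ f F)// ?EFinB//.
- exact: continuous_subspaceT.
- split=> [x _||]; first by case: (dF x).
  + exact/cvg_at_right_filter/cF.
  + exact/cvg_at_left_filter/cF.
- by move=> x _; rewrite derive1E; apply: derive_val.
Qed.

Lemma Rintegral_is_derive (F f : R -> R) (a b : R) : a < b ->
  (forall x, is_derive x 1 F (f x)) -> continuous f ->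
  \int[mu]_(x in `[a, b]) f x = F b - F a.
Proof. by move=> ab dF cf; rewrite /Rintegral (integral_is_derive ab dF cf). Qed.

Lemma continuous_cosX k : continuous (fun x : R => cos x ^+ k).
Proof.
move=> x; apply: (@continuous_comp _ _ _ cos (fun y => y ^+ k)).
  exact: continuous_cos.
exact: exprn_continuous.
Qed.

(** The index is shifted by one so that [wallis k] is also the integral of (1 - t^2)^(k/2) over
    [-1, 1], the ratio of the volumes of the unit balls in dimensions k + 1 and k. *)
Definition wallis k : R := \int[mu]_(x in `[- (pi / 2), pi / 2]) cos x ^+ k.+1.

Let pihalf_itv : - (pi / 2) < pi / 2 :> R.
Proof. by have := @pi_gt0 R; lra. Qed.

Let sinNpihalf : sin (- (pi / 2)) = - 1 :> R.
Proof. by rewrite sinN sin_pihalf. Qed.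

Let cosNpihalf : cos (- (pi / 2)) = 0 :> R.
Proof. by rewrite cosN cos_pihalf. Qed.

Let icos k : (@mu R).-integrable `[- (pi / 2), pi / 2] (fun x : R => (cos x ^+ k)%:E).
Proof.
apply: continuous_compact_integrable; first exact: segment_compact.
exact/continuous_subspaceT/continuous_cosX.
Qed.

Lemma EFin_wallis k :
  ((wallis k)%:E = \int[mu]_(x in `[(- (pi / 2))%R, (pi / 2)%R]) (cos x ^+ k.+1)%:E)%E.
Proof. by rewrite fineK//; apply: integrable_fin_num. Qed.

(** The function sin x cos^(k+2) x vanishes at both ends, and its derivative is the difference of
    the two integrands once sin^2 is written as 1 - cos^2. *)
Lemma wallisSS k : k.+3%:R * wallis k.+2 = k.+2%:R * wallis k.
Proof.
have ik j c : (@mu R).-integrable `[- (pi / 2), pi / 2] (fun x : R => (c * cos x ^+ j)%:E).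
  exact: (integrableZl _ c (icos j)).
apply/eqP; rewrite -subr_eq0; apply/eqP.
have E j c : \int[mu]_(x in `[- (pi / 2), pi / 2]) (c * cos x ^+ j) =
    c * \int[mu]_(x in `[- (pi / 2), pi / 2]) (cos x ^+ j) :> R.
  by rewrite RintegralZl//; exact: icos.
rewrite /wallis -!E -RintegralB//=; [|exact: ik|exact: ik].
have dF x : is_derive x 1 (fun x : R => sin x * cos x ^+ k.+2)
    (k.+3%:R * cos x ^+ k.+3 - k.+2%:R * cos x ^+ k.+1).
  have := is_deriveM (is_derive_sin x) (is_deriveX k.+2 (is_derive_cos x)).
  rewrite (_ : sin * _ = fun x : R => sin x * cos x ^+ k.+2); last first.
    by apply/funext => y; rewrite fctE exprfctE.
  move=> dsc; apply: (is_derive_eq dsc); rewrite exprfctE /GRing.scale/=.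
  rewrite (_ : sin x * (k.+2%:R * cos x ^+ k.+1 * - sin x) =
    - (k.+2%:R * cos x ^+ k.+1 * sin x ^+ 2)); last by ring.
  by rewrite sin2cos2 !exprS -!natr1; ring.
rewrite (Rintegral_is_derive pihalf_itv dF).
  by rewrite cos_pihalf cosNpihalf !expr0n/= !mulr0 subr0.
move=> x; apply: cvgB; apply: cvgM; try exact: cvg_cst; exact: continuous_cosX.
Qed.

Lemma wallis0 : wallis 0 = 2.
Proof.
rewrite /wallis (Rintegral_is_derive pihalf_itv (@is_derive_sin R) (@continuous_cosX 1)).
by rewrite sin_pihalf sinNpihalf; ring.
Qed.

Lemma wallis1 : wallis 1 = pi / 2.
Proof.
have dF x : is_derive x 1 (fun x : R => 2^-1 * (x + sin x * cos x)) (cos x ^+ 2).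
  have := is_deriveZ 2^-1 (is_deriveD (is_derive_id x 1)
    (is_deriveM (is_derive_sin x) (is_derive_cos x))).
  move=> dsc; apply: (is_derive_eq dsc); rewrite /GRing.scale/=.
  rewrite (_ : sin x * - sin x = - sin x ^+ 2); last by ring.
  by rewrite sin2cos2; field.
rewrite /wallis (Rintegral_is_derive pihalf_itv dF (@continuous_cosX 2)).
by rewrite cos_pihalf cosNpihalf; field.
Qed.

(** By [wallisSS] the left side does not depend on k. Together with monotonicity this encloses the
    square of each Wallis integral between consecutive multiples of pi. *)
Lemma wallisM k : k.+2%:R * (wallis k.+1 * wallis k) = 2 * pi.
Proof.
elim: k => [|k <-]; first by rewrite wallis0 wallis1; field.
by rewrite mulrA wallisSS; ring.
Qed.

Let cos01 x : x \in `[- (pi / 2), pi / 2] -> 0 <= cos x <= 1.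
Proof. by rewrite in_itv/= => /cos_ge0_pihalf ->; exact: cos_le1. Qed.

Lemma wallis_nincr k : wallis k.+1 <= wallis k.
Proof.
apply: le_Rintegral => //; [exact: icos|exact: icos|].
move=> x /cos01/andP[c0 c1]; rewrite exprS -[leRHS]mul1r.
by rewrite ler_wpM2r// exprn_ge0.
Qed.

(** The integral is nonnegative, and by [wallisM] it is a factor of a nonzero number. *)
Lemma wallis_gt0 k : 0 < wallis k.
Proof.
have ge0 : 0 <= wallis k.
  by apply: Rintegral_ge0 => x /cos01/andP[c0 _]; rewrite exprn_ge0.
rewrite lt_neqAle ge0 andbT; apply/negP => /eqP k0.
by have := wallisM k; rewrite -k0 !mulr0; have := @pi_gt0 R; lra.
Qed.

Let sinitv x : x \in `[- (pi / 2), pi / 2] -> Num.sqrt (1 - sin x ^+ 2) = cos x.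
Proof.
by move=> /cos01/andP[c0 _]; rewrite -cos2sin2 sqrtr_sqr ger0_norm.
Qed.

Lemma continuous_sqrt1B k : continuous (fun t : R => Num.sqrt (1 - t ^+ 2) ^+ k).
Proof.
move=> t; apply: (@continuous_comp _ _ _ (fun t : R => Num.sqrt (1 - t ^+ 2)) (fun x : R => x ^+ k)); last exact: exprn_continuous.
apply: (@continuous_comp _ _ _ (fun t : R => 1 - t ^+ 2) Num.sqrt); last exact: sqrt_continuous.
by apply: cvgB; [exact: cvg_cst|exact: exprn_continuous].
Qed.

Lemma integral_sin_subst (G : R -> R) (a b : R) : - (pi / 2) <= a -> a <= b -> b <= pi / 2 ->
  continuous G ->
  (\int[mu]_(x in `[sin a, sin b]) (G x)%:E =
   \int[mu]_(x in `[a, b]) (G (sin x) * cos x)%:E)%E.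
Proof.
move=> a1 ab b1 cG.
have dsin : derive1 (@sin R) = cos by apply/funext => x; rewrite derive1E derive_val.
rewrite (@integration_by_substitution_increasing _ sin)//; rewrite ?dsin//.
- move=> x y /[!in_itv]/= /andP[ax xb] /andP[ay yb] xy.
  by rewrite ltr_sin// in_itv/=; apply/andP; split; lra.
- by move=> x _; exact: continuous_cos.
- by apply: (cvgP (cos a)); exact/cvg_at_right_filter/continuous_cos.
- by apply: (cvgP (cos b)); exact/cvg_at_left_filter/continuous_cos.
- split=> [x _||]; first exact: derivable_sin.
  + exact/cvg_at_right_filter/continuous_sin.
  + exact/cvg_at_left_filter/continuous_sin.
- exact: continuous_subspaceT.
Qed.

Lemma integral_sqrt1BX k :
  (\int[mu]_(t in `[(-1)%R, 1%R]) (Num.sqrt (1 - t ^+ 2) ^+ k)%:E = (wallis k)%:E)%E.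
Proof.
rewrite EFin_wallis.
have := @integral_sin_subst (fun t => Num.sqrt (1 - t ^+ 2) ^+ k) _ _ (lexx _) (ltW pihalf_itv) (lexx _)
  (@continuous_sqrt1B k).
rewrite sinNpihalf sin_pihalf => ->.
by apply: eq_integral => x; rewrite inE/= => xI; rewrite sinitv// exprSr.
Qed.

Lemma integral_even (f : R -> \bar R) : measurable_fun setT f ->
  (forall t, 0 <= f t)%E -> (forall t, f (- t) = f t) ->
  (\int[mu]_t f t = 2%:E * \int[mu]_(t in `[0%R, +oo[) f t)%E.
Proof.
move=> mf f0 fN.
rewrite -(setUv `[0%R, +oo[%classic) ge0_integral_setU//=; last 3 first.
- exact: measurableC.
- by rewrite setUv.
- exact/disj_setPCl.
rewrite mule_natl mule2n; congr +%E.
rewrite setCitvr integral_itv_bndo_bndc; last exact: measurable_funTS.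
rewrite ge0_integration_by_substitution0//.
by apply: eq_integral => t _; rewrite fN.
Qed.

(** After halving by parity, t = sin x turns the integrand into sin x cos^(k+1) x, which has an
    explicit primitive. This is the share of the last coordinate in the integral of |x|_1 over the
    ball. *)
Lemma integral_norm_sqrt1BX k :
  (\int[mu]_(t in `[(-1)%R, 1%R]) (`|t| * Num.sqrt (1 - t ^+ 2) ^+ k)%:E = (2 / k.+2%:R : R)%:E)%E.
Proof.
pose g (t : R) : R := t * Num.sqrt (1 - t ^+ 2) ^+ k.
pose f (t : R) : \bar R := ((EFin \o (fun t => `|t| * Num.sqrt (1 - t ^+ 2) ^+ k)) \_ `[(-1)%R, 1%R]) t.
have cg : continuous g.
  by move=> t; apply: cvgM; [exact: cvg_id|exact: continuous_sqrt1B].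
have f0 t : (0 <= f t)%E.
  by rewrite /f patchE; case: ifPn => // _; rewrite lee_fin mulr_ge0// exprn_ge0// sqrtr_ge0.
have mf : measurable_fun setT f.
  apply/measurable_restrict => //; apply/measurable_EFinP; apply: measurable_funM.
    exact: measurable_funTS.
  by apply: measurable_funTS; apply: continuous_measurable_fun; exact: continuous_sqrt1B.
rewrite integral_mkcond (integral_even mf f0); last first.
  move=> t; rewrite /f !patchE/= normrN sqrrN; congr (if _ then _ else _).
  by apply/idP/idP; rewrite !inE/= !in_itv/=; lra.
rewrite -integral_mkcondr (_ : _ `&` _ = `[0%R, 1%R]%classic); last first.
  apply/seteqP; split => t /=; rewrite !in_itv/=; lra.
transitivity (2%:E * \int[mu]_(t in `[0%R, 1%R]) (g t)%:E)%E.
  congr (_ * _)%E; apply: eq_integral.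
  by move=> t; rewrite inE/= in_itv/= => /andP[t0 _]; rewrite /= ger0_norm.
have := @integral_sin_subst g 0 (pi / 2) _ _ (lexx _) cg.
rewrite sin0 sin_pihalf => ->; [|have := @pi_gt0 R; lra|have := @pi_gt0 R; lra].
transitivity (2%:E * \int[mu]_(x in `[0%R, (pi / 2)%R]) (sin x * cos x ^+ k.+1 : R)%:E)%E.
  congr (_ * _)%E; apply: eq_integral.
  move=> x; rewrite inE/= in_itv/= => x0; rewrite /g sinitv ?in_itv/=; last by have := @pi_gt0 R; lra.
  by rewrite exprSr mulrA.
have dF (x : R) : is_derive x 1 (fun x : R => - k.+2%:R^-1 * cos x ^+ k.+2)
    (sin x * cos x ^+ k.+1).
  have := is_deriveZ (- k.+2%:R^-1) (is_deriveX k.+2 (is_derive_cos x)).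
  rewrite (_ : _ \*: _ = fun x : R => - k.+2%:R^-1 * cos x ^+ k.+2); last first.
    by apply/funext => y; rewrite /= exprfctE.
  move=> dsc; apply: (is_derive_eq dsc); rewrite /GRing.scale/=.
  by field; rewrite -natr1; have := ler0n R k.+1; lra.
rewrite (integral_is_derive _ dF); [|by have := @pi_gt0 R; lra|]; last first.
  by move=> x; apply: cvgM; [exact: continuous_sin|exact: continuous_cosX].
rewrite -EFinM cos_pihalf cos0 expr0n expr1n/= mulr0 mulr1 sub0r opprK.
by [].
Qed.

End one_variable_integrals.

(** * Nonnegative integrals, sections, and the norms on R^n *)

Section ge0_real_integrals.
Context d (T : measurableType d) {R : realType} (m : {measure set T -> \bar R}).
Variables (D : set T) (mD : measurable D).

Lemma ge0_integralZl_real (c : R) (g : T -> R) : 0 <= c ->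
  measurable_fun D g -> (forall x, D x -> 0 <= g x) ->
  (\int[m]_(x in D) (c * g x)%:E = c%:E * \int[m]_(x in D) (g x)%:E)%E.
Proof.
move=> c0 mg g0; under eq_integral do rewrite EFinM.
by rewrite ge0_integralZl//; exact/measurable_EFinP.
Qed.

Lemma ge0_integralD_real (f g : T -> R) :
  measurable_fun D f -> (forall x, D x -> 0 <= f x) ->
  measurable_fun D g -> (forall x, D x -> 0 <= g x) ->
  (\int[m]_(x in D) (f x + g x)%:E =
   \int[m]_(x in D) (f x)%:E + \int[m]_(x in D) (g x)%:E)%E.
Proof.
move=> mf f0 mg g0; under eq_integral do rewrite EFinD.
by rewrite ge0_integralD//; exact/measurable_EFinP.
Qed.

End ge0_real_integrals.

Section more_one_variable.
Context {R : realType}.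

Lemma integral_beta (i j : nat) :
  (\int[mu]_(t in `[0%R, 1%R]) (t ^+ i * (1 - t) ^+ j : R)%:E =
   (i`!%:R * j`!%:R / (i + j).+1`!%:R : R)%:E)%E.
Proof.
have := @beta_fun_fact R i j; rewrite natrM => <-.
rewrite EFin_beta_fun [LHS]integral_mkcond; apply: eq_integral => t _.
by rewrite !patchE; case: ifPn.
Qed.

Lemma integral_affine_itv (c d : R) (f : measurableTypeR R -> \bar R) : c < d ->
  measurable_fun setT f -> (forall t, 0 <= f t)%E ->
  (\int[mu]_(t in `[c, d]) f t =
   (d - c)%:E * \int[mu]_(s in `[0%R, 1%R]) f (c + (d - c) * s)%R)%E.
Proof.
move=> cd mf f0; have dc0 : 0 < d - c by lra.
rewrite integral_mkcond (integral_affine_gt0 c dc0); last 2 first.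
- exact/(measurable_restrictT _ _).1/measurable_funTS.
- by move=> t; rewrite patchE; case: ifPn.
congr (_ * _)%E; rewrite [RHS]integral_mkcond; apply: eq_integral => s _.
rewrite !patchE addrC; congr (if _ then _ else _).
apply/idP/idP; rewrite !inE/= !in_itv/= => /andP[h1 h2]; apply/andP; split; nra.
Qed.

Lemma integral_even_itv (g : R -> R) : continuous g -> (forall t, 0 <= t <= 1 -> 0 <= g t) ->
  (\int[mu]_(t in `[(-1)%R, 1%R]) (g `|t|)%:E = 2%:E * \int[mu]_(t in `[0%R, 1%R]) (g t)%:E)%E.
Proof.
move=> cg g0.
pose f (t : R) : \bar R := ((EFin \o (fun t => g `|t|)) \_ `[(-1)%R, 1%R]) t.
have f0 t : (0 <= f t)%E.
  rewrite /f patchE; case: ifPn => //; rewrite inE/= in_itv/= -ler_norml => t1.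
  by rewrite lee_fin g0// normr_ge0.
have mf : measurable_fun setT f.
  apply/measurable_restrict => //; apply/measurable_EFinP.
  apply: measurableT_comp; first exact: continuous_measurable_fun.
  exact: measurable_funTS.
rewrite integral_mkcond (integral_even mf f0); last first.
  move=> t; rewrite /f !patchE/= normrN; congr (if _ then _ else _).
  by apply/idP/idP; rewrite !inE/= !in_itv/=; lra.
rewrite -integral_mkcondr (_ : _ `&` _ = `[0%R, 1%R]%classic); last first.
  by apply/seteqP; split => t /=; rewrite !in_itv/=; lra.
congr (_ * _)%E; apply: eq_integral => t.
by rewrite inE/= in_itv/= => /andP[t0 _]; rewrite /= ger0_norm.
Qed.

(** The values at the two ends are left free: the formulas for the sections hold at positive radii
    only, and the ends form a null set. *)
Lemma integral_support (f : R -> \bar R) (g : R -> R) (a b : R) :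
  measurable_fun setT f -> (forall t, ~ (a <= t <= b) -> f t = 0%E) ->
  (forall t, a < t < b -> f t = (g t)%:E) ->
  (\int[mu]_t f t = \int[mu]_(t in `[a, b]) (g t)%:E)%E.
Proof.
move=> mf fout fin.
have fg t : t \in `]a, b[%classic -> f t = (g t)%:E.
  by rewrite inE/= in_itv/=; exact: fin.
transitivity (\int[mu]_(t in `[a, b]) f t)%E.
  rewrite [RHS]integral_mkcond; apply: eq_integral => t _.
  rewrite patchE; case: ifPn => //; rewrite notin_setE/= in_itv/=; exact: fout.
rewrite integral_itv_bndoo; last exact: measurable_funTS.
rewrite [RHS]integral_itv_bndoo; first exact: eq_integral.
by apply: (eq_measurable_fun f) => //; exact: measurable_funTS.
Qed.

End more_one_variable.

Section sections.
Context {R : realType}.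

Lemma integral_snoc_in (n : nat) (D : set 'rV[R]_n.+1) (f : 'rV[R]_n.+1 -> \bar R) :
  measurable D -> measurable_fun setT f -> (forall z, 0 <= f z)%E ->
  (\int[vol n.+1]_(z in D) f z =
   \int[mu]_t \int[vol n]_(x in [set x | D (snoc x t)]) f (snoc x t))%E.
Proof.
move=> mD mf f0; rewrite integral_mkcond integral_snoc; last 2 first.
- exact/(measurable_restrictT _ _).1/measurable_funTS.
- by move=> z; rewrite patchE; case: ifPn.
apply: eq_integral => t _; rewrite [RHS]integral_mkcond; apply: eq_integral => x _.
by rewrite !patchE; congr (if _ then _ else _); apply/idP/idP; rewrite !inE.
Qed.

Lemma measurable_integral_section (n : nat) (D : set 'rV[R]_n.+1) (f : 'rV[R]_n.+1 -> \bar R) :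
  measurable D -> measurable_fun setT f -> (forall z, 0 <= f z)%E ->
  measurable_fun setT (fun t : measurableTypeR R =>
    \int[vol n]_(x in [set x | D (snoc x t)]) f (snoc x t))%E.
Proof.
move=> mD mf f0.
rewrite (_ : (fun t => _) = (fun t => \int[vol n]_x (f \_ D) (snoc x t)))%E.
  apply: (@measurable_integral_snoc _ _ (f \_ D)).
  - exact/(measurable_restrictT _ _).1/measurable_funTS.
  - by move=> z; rewrite patchE; case: ifPn.
apply/funext => t; rewrite [LHS]integral_mkcond; apply: eq_integral => x _.
by rewrite !patchE; congr (if _ then _ else _); apply/idP/idP; rewrite !inE.
Qed.

Lemma integral_scale_in (n : nat) (c : R) (D : set 'rV[R]_n) (f : 'rV[R]_n -> \bar R) :
  c != 0 -> measurable D -> measurable_fun setT f -> (forall x, 0 <= f x)%E ->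
  (\int[vol n]_(x in D) f x =
   (`|c| ^+ n)%:E * \int[vol n]_(x in [set x | D (c *: x)]) f (c *: x)%R)%E.
Proof.
move=> c0 mD mf f0; rewrite integral_mkcond (integral_scale c0); last 2 first.
- exact/(measurable_restrictT _ _).1/measurable_funTS.
- by move=> z; rewrite patchE; case: ifPn.
congr (_ * _)%E; rewrite [RHS]integral_mkcond; apply: eq_integral => x _.
by rewrite !patchE; congr (if _ then _ else _); apply/idP/idP; rewrite !inE.
Qed.

Lemma measurable_le_set d (T : measurableType d) (f g : T -> R) :
  measurable_fun setT f -> measurable_fun setT g -> measurable [set x | f x <= g x].
Proof.
move=> mf mg; rewrite -[X in measurable X]setTI.
have mfg := measurable_fun_ler mf mg.
exact: (mfg measurableT [set true]).
Qed.

Definition norm1 (n : nat) (x : 'rV[R]_n) : R := \sum_(i < n) `|x ord0 i|.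

Lemma measurable_dotvv (n : nat) : measurable_fun setT (fun x : 'rV[R]_n => dotv x x).
Proof.
apply: measurable_sum => i; apply: measurable_funM; exact: measurable_coord.
Qed.

Lemma measurable_dotv (n : nat) (y : 'rV[R]_n) : measurable_fun setT (dotv y).
Proof.
apply: measurable_sum => i; apply: measurable_funM; [exact: measurable_cst|exact: measurable_coord].
Qed.

Lemma measurable_norm1 (n : nat) : measurable_fun setT (@norm1 n).
Proof.
apply: measurable_sum => i; apply: measurableT_comp => //; exact: measurable_coord.
Qed.

Lemma dotv_snoc (n : nat) (x y : 'rV[R]_n) t s :
  dotv (snoc x t) (snoc y s) = dotv x y + t * s.
Proof.
rewrite /dotv big_snoc !snoc_max; congr (_ + _).
by apply: eq_bigr => j _; rewrite !snoc_lift.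
Qed.

Lemma norm1_snoc (n : nat) (x : 'rV[R]_n) t : norm1 (snoc x t) = norm1 x + `|t|.
Proof.
rewrite /norm1 big_snoc !snoc_max; congr (_ + _).
by apply: eq_bigr => j _; rewrite !snoc_lift.
Qed.

Lemma dotvC (n : nat) (x y : 'rV[R]_n) : dotv x y = dotv y x.
Proof. by apply: eq_bigr => i _; rewrite mulrC. Qed.

Lemma dotvZl (n : nat) c (x y : 'rV[R]_n) : dotv (c *: x) y = c * dotv x y.
Proof. by rewrite mulr_sumr; apply: eq_bigr => i _; rewrite mxE mulrA. Qed.

Lemma dotvZr (n : nat) c (x y : 'rV[R]_n) : dotv x (c *: y) = c * dotv x y.
Proof. by rewrite dotvC dotvZl dotvC. Qed.

Lemma dotvDl (n : nat) (x y z : 'rV[R]_n) : dotv (x + y) z = dotv x z + dotv y z.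
Proof. by rewrite -big_split; apply: eq_bigr => i _; rewrite mxE mulrDl. Qed.

Lemma dotvDr (n : nat) (x y z : 'rV[R]_n) : dotv z (x + y) = dotv z x + dotv z y.
Proof. by rewrite dotvC dotvDl !(dotvC z). Qed.

Lemma dotv0l (n : nat) (x : 'rV[R]_n) : dotv 0 x = 0.
Proof. by rewrite -(scale0r 0) dotvZl mul0r. Qed.

Lemma dotv0r (n : nat) (x : 'rV[R]_n) : dotv x 0 = 0.
Proof. by rewrite dotvC dotv0l. Qed.

Lemma dotvv_ge0 (n : nat) (x : 'rV[R]_n) : 0 <= dotv x x.
Proof. by apply: sumr_ge0 => i _; rewrite -expr2 sqr_ge0. Qed.

Lemma norm1Z (n : nat) c (x : 'rV[R]_n) : norm1 (c *: x) = `|c| * norm1 x.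
Proof. by rewrite mulr_sumr; apply: eq_bigr => i _; rewrite mxE normrM. Qed.

Lemma norm1_ge0 (n : nat) (x : 'rV[R]_n) : 0 <= norm1 x.
Proof. exact: sumr_ge0. Qed.

Lemma measurable_dotvv_le (n : nat) (v : R) : measurable [set x : 'rV[R]_n | dotv x x <= v].
Proof. by apply: measurable_le_set; [exact: measurable_dotvv|exact: measurable_cst]. Qed.

Lemma measurable_norm1_le (n : nat) (v : R) : measurable [set x : 'rV[R]_n | norm1 x <= v].
Proof. by apply: measurable_le_set; [exact: measurable_norm1|exact: measurable_cst]. Qed.

End sections.

(** * Balls and cross-polytopes *)

Section euclidean_ball.
Context {R : realType}.
Implicit Types (n : nat) (v : R).

(** The volume of the euclidean unit ball, as [vol_eball] shows. *)
Definition omega n : R := \prod_(k < n) wallis k.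

Lemma omegaS n : omega n.+1 = omega n * wallis n.
Proof. by rewrite /omega big_ord_recr. Qed.

Lemma omega_gt0 n : 0 < omega n.
Proof. by apply: prodr_gt0 => k _; exact: wallis_gt0. Qed.

(** Indexed by the squared radius, so that the section at height t is again such a set, with
    parameter [v - t ^+ 2] and no square root. *)
Definition eball n v : set 'rV[R]_n := [set x | dotv x x <= v].

Arguments eball n v : clear implicits.

Lemma measurable_eball n v : measurable (eball n v).
Proof. exact: measurable_dotvv_le. Qed.

Lemma eball_scale n v : 0 < v ->
  [set x | eball n (v ^+ 2) (v *: x)] = eball n 1.
Proof.
move=> v0; apply/seteqP; split => x; rewrite /eball/= dotvZl dotvZr mulrA -expr2.
  by rewrite -[leRHS]mulr1 ler_pM2l ?exprn_gt0.
by move=> ?; rewrite -[leRHS]mulr1 ler_pM2l ?exprn_gt0.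
Qed.

Lemma eball_section n v t :
  [set x | eball n.+1 v (snoc x t)] = eball n (v - t ^+ 2).
Proof. by apply/seteqP; split => x; rewrite /eball/= dotv_snoc -expr2; lra. Qed.

Lemma eball_neg n v : v < 0 -> eball n v = set0.
Proof.
by move=> v0; apply/seteqP; split => x //; rewrite /eball/=; have := dotvv_ge0 x; lra.
Qed.

Let sqrt1B t : -1 < t < 1 -> 0 < Num.sqrt (1 - t ^+ 2) /\ 1 - t ^+ 2 = Num.sqrt (1 - t ^+ 2) ^+ 2 :> R.
Proof.
move=> t1; have h : 0 < 1 - t ^+ 2 by nra.
by rewrite sqrtr_gt0 sqr_sqrtr// ltW.
Qed.

(** Only the ball of radius 1 is integrated, its sections having radius sqrt (1 - t^2); the other
    radii follow by scaling. *)
Lemma vol_eball n v : 0 < v -> vol n (eball n (v ^+ 2)) = (omega n * v ^+ n)%:E.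
Proof.
have scale m : vol m (eball m 1) = (omega m)%:E ->
    forall v, 0 < v -> vol m (eball m (v ^+ 2)) = (omega m * v ^+ m)%:E.
  move=> E u u0; rewrite (@vol_scale _ _ u) ?gt_eqF//; last exact: measurable_eball.
  by rewrite /= eball_scale// E (gtr0_norm u0) mulrC EFinM.
elim: n v => [|n IHn] v v0.
  apply: (scale 0%N) => //=; rewrite diracE mem_set ?/omega ?big_ord0//=.
  by rewrite /eball/= /dotv big_ord0 ler01.
apply: scale => // {v v0}; rewrite vol_snoc; last exact: measurable_eball.
have mS := measurable_vol_section (@measurable_eball n.+1 1).
rewrite (integral_support (g := fun t => omega n * Num.sqrt (1 - t ^+ 2) ^+ n) (a := -1) (b := 1))//.
- rewrite ge0_integralZl_real//.
  + by rewrite integral_sqrt1BX -EFinM omegaS.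
  + exact/ltW/omega_gt0.
  + by apply: measurable_funTS; apply: continuous_measurable_fun; exact: continuous_sqrt1B.
- move=> t tout; rewrite eball_section eball_neg ?measure0//; apply: contrapT => tt.
  apply: tout; nra.
- move=> t /sqrt1B[]; set s := Num.sqrt _ => s0 s2.
  by rewrite eball_section s2 IHn.
Qed.

(** At radius 1 each of the n coordinates contributes [omega n.-1] times the integral of |t| (1 -
    t^2)^((n-1)/2), which is 2 / (n + 1). For n = 0 the meaningless factor [omega n.-1] is
    multiplied by 0. *)
Lemma integral_norm1_eball n v : 0 < v ->
  (\int[vol n]_(x in eball n (v ^+ 2)%R) (norm1 x)%:E =
   (n%:R * 2 / n.+1%:R * omega n.-1 * v ^+ n.+1)%:E)%E.
Proof.
have scale m a : (\int[vol m]_(x in eball m 1%R) (norm1 x)%:E = a%:E)%E ->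
    forall v, 0 < v ->
    (\int[vol m]_(x in eball m (v ^+ 2)%R) (norm1 x)%:E = (a * v ^+ m.+1)%:E)%E.
  move=> E u u0; rewrite (@integral_scale_in _ _ u) ?gt_eqF//; last 3 first.
  - exact: measurable_eball.
  - by apply/measurable_EFinP; exact: measurable_norm1.
  - by move=> x; rewrite lee_fin norm1_ge0.
  rewrite /= eball_scale// (gtr0_norm u0).
  under eq_integral do rewrite norm1Z (gtr0_norm u0).
  rewrite ge0_integralZl_real//; last 4 first.
  - exact: measurable_eball.
  - exact: ltW.
  - by apply: measurable_funTS; exact: measurable_norm1.
  - by move=> x _; exact: norm1_ge0.
  by rewrite E -!EFinM; congr EFin; rewrite exprSr; ring.
elim: n v => [|n IHn] v v0.
  rewrite !mul0r; under eq_integral do rewrite /norm1 big_ord0.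
  by rewrite integral0.
apply: scale => // {v v0}; rewrite integral_snoc_in; last 3 first.
- exact: measurable_eball.
- by apply/measurable_EFinP; exact: measurable_norm1.
- by move=> x; rewrite lee_fin norm1_ge0.
pose a := (n%:R * 2 / n.+1%:R * omega n.-1).
(* The first n coordinates contribute [a * wallis n.+1]; the recursion [wallisSS] brings it to the
   shape required in dimension n + 1. For n = 0 both sides vanish. *)
have wE : a * wallis n.+1 = n%:R * 2 / n.+2%:R * omega n.
  rewrite /a; case: n {IHn a} => [|n]; first by rewrite !mul0r.
  rewrite /= omegaS; have := @wallisSS R n; move: (wallis n.+2) (wallis n) => w2 w0 w.
  have -> : w2 = n.+2%:R * w0 / n.+3%:R by rewrite -w mulrC mulKf// pnatr_eq0.
  have /negbTE n2 : n.+2%:R != 0 :> R by rewrite pnatr_eq0.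
  have /negbTE n3 : n.+3%:R != 0 :> R by rewrite pnatr_eq0.
  move: (n.+2%:R : R) (n.+3%:R : R) n2 n3 => N2 N3 n2 n3.
  by field; rewrite n2 n3.
have mN1 : measurable_fun setT (fun x : 'rV[R]_n.+1 => (norm1 x)%:E).
  by apply/measurable_EFinP; exact: measurable_norm1.
have mS := measurable_integral_section (@measurable_eball n.+1 1) mN1 (fun x => norm1_ge0 x).
rewrite (integral_support (g := fun t => a * Num.sqrt (1 - t ^+ 2) ^+ n.+1 + omega n * (`|t| * Num.sqrt (1 - t ^+ 2) ^+ n)) (a := -1) (b := 1))//.
- have mX (D : set (measurableTypeR R)) k : measurable_fun D (fun t : measurableTypeR R => Num.sqrt (1 - t ^+ 2) ^+ k).
    by apply: measurable_funTS; apply: continuous_measurable_fun; exact: continuous_sqrt1B.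
  have X0 (t : R) k : 0 <= Num.sqrt (1 - t ^+ 2) ^+ k by rewrite exprn_ge0// sqrtr_ge0.
  have mN (D : set (measurableTypeR R)) : measurable_fun D (fun t : measurableTypeR R => `|t| * Num.sqrt (1 - t ^+ 2) ^+ n).
    by apply: measurable_funM => //; exact: measurable_funTS.
  have N0 (t : R) : 0 <= `|t| * Num.sqrt (1 - t ^+ 2) ^+ n by rewrite mulr_ge0.
  have a0 : 0 <= a by rewrite /a !mulr_ge0// ltW// omega_gt0.
  have o0 := ltW (omega_gt0 n).
  rewrite ge0_integralD_real//.
  + rewrite !ge0_integralZl_real// integral_sqrt1BX integral_norm_sqrt1BX.
    rewrite -!EFinM -EFinD; congr EFin; rewrite wE /=; field.
    by rewrite -natrD pnatr_eq0.
  + exact: measurable_funM.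
  + by move=> t _; rewrite mulr_ge0.
  + exact: measurable_funM.
  + by move=> t _; rewrite mulr_ge0.
- move=> t tout; rewrite eball_section eball_neg ?integral_set0//; apply: contrapT => tt.
  apply: tout; nra.
- move=> t /sqrt1B[]; set s := Num.sqrt _ => s0 s2; rewrite eball_section s2.
  under eq_integral do rewrite norm1_snoc.
  rewrite ge0_integralD_real//; last 3 first.
  + exact: measurable_eball.
  + by apply: measurable_funTS; exact: measurable_norm1.
  + by move=> x _; exact: norm1_ge0.
  rewrite IHn// integral_cst; last exact: measurable_eball.
  rewrite [X in (_ * X)%E]vol_eball// -EFinM -EFinD; congr EFin; rewrite /a; ring.
Qed.

End euclidean_ball.
Arguments eball {R} n v.

Section cross_polytope.
Context {R : realType}.
Implicit Types (n : nat) (v : R).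

Definition cross n v : set 'rV[R]_n := [set x | norm1 x <= v].

Arguments cross n v : clear implicits.

Lemma measurable_cross n v : measurable (cross n v).
Proof. exact: measurable_norm1_le. Qed.

Lemma cross_scale n v : 0 < v -> [set x | cross n v (v *: x)] = cross n 1.
Proof.
move=> v0; apply/seteqP; split => x; rewrite /cross/= norm1Z (gtr0_norm v0).
  by rewrite -[leRHS]mulr1 ler_pM2l.
by move=> ?; rewrite -[leRHS]mulr1 ler_pM2l.
Qed.

Lemma cross_section n v t : [set x | cross n.+1 v (snoc x t)] = cross n (v - `|t|).
Proof. by apply/seteqP; split => x; rewrite /cross/= norm1_snoc; lra. Qed.

Lemma cross_neg n v : v < 0 -> cross n v = set0.
Proof.
by move=> v0; apply/seteqP; split => x //; rewrite /cross/=; have := norm1_ge0 x; lra.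
Qed.

Let ge0_beta (i j : nat) (t : R) : -1 <= t <= 1 -> 0 <= `|t| ^+ i * (1 - `|t|) ^+ j.
Proof. by rewrite -ler_norml => t1; rewrite mulr_ge0 ?exprn_ge0//; lra. Qed.

Let continuous_beta (i j : nat) : continuous (fun t : R => t ^+ i * (1 - t) ^+ j).
Proof.
move=> t; apply: cvgM; first exact: exprn_continuous.
apply: (@continuous_comp _ _ _ (fun t : R => 1 - t) (fun t : R => t ^+ j)).
  by apply: cvgB; [exact: cvg_cst|exact: cvg_id].
exact: exprn_continuous.
Qed.

Let measurable_beta (i j : nat) (D : set (measurableTypeR R)) :
  measurable_fun D (fun t : measurableTypeR R => `|t| ^+ i * (1 - `|t|) ^+ j).
Proof.
apply: measurable_funTS.
by apply: measurable_funM; apply: measurable_funX => //; exact: measurable_funB.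
Qed.

Let integral_beta2 (i j : nat) :
  (\int[mu]_(t in `[(-1)%R, 1%R]) (`|t| ^+ i * (1 - `|t|) ^+ j : R)%:E =
   (2 * (i`!%:R * j`!%:R / (i + j).+1`!%:R) : R)%:E)%E.
Proof.
rewrite EFinM -integral_beta (@integral_even_itv _ (fun t : R => t ^+ i * (1 - t) ^+ j))//.
by move=> t /andP[t0 t1]; rewrite mulr_ge0 ?exprn_ge0//; lra.
Qed.

Lemma vol_cross n v : 0 < v -> vol n (cross n v) = (2 ^+ n / n`!%:R * v ^+ n)%:E.
Proof.
have scale m a : vol m (cross m 1) = a%:E ->
    forall v, 0 < v -> vol m (cross m v) = (a * v ^+ m)%:E.
  move=> E u u0; rewrite (@vol_scale _ _ u) ?gt_eqF//; last exact: measurable_cross.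
  by rewrite /= cross_scale// E (gtr0_norm u0) mulrC EFinM.
elim: n v => [|n IHn] v v0.
  apply: scale => //=; rewrite diracE mem_set ?expr0 ?fact0 ?divr1//=.
  by rewrite /cross/= /norm1 big_ord0 ler01.
apply: scale => // {v v0}; rewrite vol_snoc; last exact: measurable_cross.
have mS := measurable_vol_section (@measurable_cross n.+1 1).
rewrite (integral_support (g := fun t => 2 ^+ n / n`!%:R * (`|t| ^+ 0 * (1 - `|t|) ^+ n)) (a := -1) (b := 1))//.
- rewrite ge0_integralZl_real//.
  + rewrite integral_beta2 -EFinM add0n fact0 mul1r exprS factS natrM; congr EFin.
    by field; rewrite pnatr_eq0 -lt0n fact_gt0/= nat1r pnatr_eq0.
  + by move=> t /= t1; apply: ge0_beta; rewrite in_itv/= in t1.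
- move=> t tout; rewrite cross_section cross_neg ?measure0//; apply: contrapT => tt.
  by apply: tout; rewrite -ler_norml; lra.
- move=> t; rewrite -ltr_norml => t1.
  by rewrite cross_section IHn ?expr0 ?mul1r//; lra.
Qed.

(** At radius 1 each coordinate contributes the integral of t^2 against the volume of the section, a
    cross-polytope of radius 1 - |t|; this is a beta integral equal to 2^(n+1) / (n+2)!. *)
Lemma integral_dotvv_cross n v : 0 < v ->
  (\int[vol n]_(x in cross n v) (dotv x x)%:E =
   (n%:R * 2 ^+ n.+1 / n.+2`!%:R * v ^+ n.+2)%:E)%E.
Proof.
have mdot m : measurable_fun setT (fun x : 'rV[R]_m => (dotv x x)%:E).
  by apply/measurable_EFinP; exact: measurable_dotvv.
have scale m a : (\int[vol m]_(x in cross m 1%R) (dotv x x)%:E = a%:E)%E ->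
    forall v, 0 < v ->
    (\int[vol m]_(x in cross m v) (dotv x x)%:E = (a * v ^+ m.+2)%:E)%E.
  move=> E u u0; rewrite (@integral_scale_in _ _ u) ?gt_eqF//; last 2 first.
  - exact: measurable_cross.
  - by move=> x; rewrite lee_fin dotvv_ge0.
  rewrite /= cross_scale// (gtr0_norm u0).
  under eq_integral do rewrite dotvZl dotvZr mulrA -expr2.
  rewrite ge0_integralZl_real//; last 4 first.
  - exact: measurable_cross.
  - exact: sqr_ge0.
  - by apply: measurable_funTS; exact: measurable_dotvv.
  - by move=> x _; exact: dotvv_ge0.
  by rewrite E -!EFinM; congr EFin; rewrite !exprSr; ring.
elim: n v => [|n IHn] v v0.
  rewrite !mul0r; under eq_integral do rewrite /dotv big_ord0.
  by rewrite integral0.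
apply: scale => // {v v0}; rewrite integral_snoc_in; last 3 first.
- exact: measurable_cross.
- exact: mdot.
- by move=> x; rewrite lee_fin dotvv_ge0.
pose c : R := n%:R * 2 ^+ n.+1 / n.+2`!%:R.
pose w : R := 2 ^+ n / n`!%:R.
have mS := measurable_integral_section (@measurable_cross n.+1 1) (@mdot n.+1) (fun x => dotvv_ge0 x).
rewrite (integral_support (g := fun t => c * (`|t| ^+ 0 * (1 - `|t|) ^+ n.+2) + w * (`|t| ^+ 2 * (1 - `|t|) ^+ n)) (a := -1) (b := 1))//.
- have c0 : 0 <= c by rewrite /c !mulr_ge0.
  have w0 : 0 <= w by rewrite /w !mulr_ge0.
  rewrite ge0_integralD_real//.
  + rewrite [X in (X + _)%E]ge0_integralZl_real// ?[X in (_ + X)%E]ge0_integralZl_real//.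
    * rewrite !integral_beta2 -!EFinM -EFinD; congr EFin; rewrite /c /w add0n add2n.
      rewrite fact0 !factS !natrM !exprS.
      have : n`!%:R != 0 :> R by rewrite pnatr_eq0 -lt0n fact_gt0.
      move: (n`!%:R : R) => f f0; rewrite -!natr1.
      have := ler0n R n; move: (n%:R : R) => m m0; field.
      by rewrite f0 !gt_eqF//; lra.
    * by move=> t /= t1; apply: ge0_beta; rewrite in_itv/= in t1.
    * by move=> t /= t1; apply: ge0_beta; rewrite in_itv/= in t1.
  + exact: measurable_funM.
  + by move=> t /= t1; rewrite mulr_ge0//; apply: ge0_beta; rewrite in_itv/= in t1.
  + exact: measurable_funM.
  + by move=> t /= t1; rewrite mulr_ge0//; apply: ge0_beta; rewrite in_itv/= in t1.
- move=> t tout; rewrite cross_section cross_neg ?integral_set0//; apply: contrapT => tt.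
  by apply: tout; rewrite -ler_norml; lra.
- move=> t; rewrite -ltr_norml => t1; rewrite cross_section.
  under eq_integral do rewrite dotv_snoc.
  have t0 : 0 < 1 - `|t| by lra.
  rewrite ge0_integralD_real//; last 4 first.
  + exact: measurable_cross.
  + by apply: measurable_funTS; exact: measurable_dotvv.
  + by move=> x _; exact: dotvv_ge0.
  + by move=> x _; rewrite -expr2 sqr_ge0.
  rewrite IHn// integral_cst; last exact: measurable_cross.
  rewrite [X in (_ * X)%E]vol_cross// -EFinM -EFinD; congr EFin.
  by rewrite real_normK ?num_real// /c /w; ring.
Qed.

End cross_polytope.
Arguments cross {R} n v.

(** * Asymptotics of the radius of the ball of volume 1 *)

Section factorial_bounds.
Context {R : realType}.
Let e : R := expR 1.

Lemma expR1_gt0 : 0 < e. Proof. exact: expR_gt0. Qed.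

(** The induction step is (1 + 1/n)^n <= e. *)
Lemma expn_le_fact n : n%:R ^+ n <= e ^+ n * n`!%:R :> R.
Proof.
elim: n => [|n IHn]; first by rewrite !expr0 fact0 mulr1.
have [->|n0] := eqVneq n 0%N.
  by rewrite !expr1 mulr1 /e -[leLHS]addr0 (le_trans _ (expR_ge1Dx 1))// lerD2l.
have n0' : 0 < n%:R :> R by rewrite ltr0n lt0n.
have h : n.+1%:R ^+ n <= e * n%:R ^+ n :> R.
  rewrite (_ : n.+1%:R = (1 + n%:R^-1) * n%:R :> R); last first.
    by rewrite mulrDl mul1r mulVf ?gt_eqF// natr1.
  rewrite exprMn ler_wpM2r ?exprn_ge0// /e.
  rewrite (_ : expR 1 = expR n%:R^-1 ^+ n); last first.
    by rewrite -expRM_natl mulfV ?gt_eqF.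
  by rewrite lerXn2r ?nnegrE ?expR_ge0 ?expR_ge1Dx// addr_ge0// invr_ge0 ltW.
rewrite exprSr (le_trans (ler_wpM2r (ler0n _ _) h))// exprS factS natrM.
rewrite [leRHS](_ : _ = e * (e ^+ n * n`!%:R) * n.+1%:R); last by ring.
by rewrite ler_wpM2r// ler_wpM2l// ltW// expR1_gt0.
Qed.

(** With m = n + 1 this reads e^m m! <= e m^(m+1). The induction step is (m / (m+1))^(m+1) <= 1/e,
    that is 1 + x <= exp x at x = -1/(m+1). *)
Lemma fact_le_expn n : e ^+ n.+1 * n.+1`!%:R <= e * n.+1%:R ^+ n.+2 :> R.
Proof.
elim: n => [|n IHn]; first by rewrite !expr1 expr1n.
rewrite exprS factS natrM [leLHS](_ : _ = e * n.+2%:R * (e ^+ n.+1 * n.+1`!%:R)); last by ring.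
have e0 := expR1_gt0.
apply: (@le_trans _ _ (e * n.+2%:R * (e * n.+1%:R ^+ n.+2))).
  by rewrite ler_wpM2l// mulr_ge0// ltW.
have h : n.+1%:R / n.+2%:R <= expR (- n.+2%:R^-1) :> R.
  apply: le_trans (expR_ge1Dx _); rewrite -(@natr1 _ n.+1).
  rewrite ler_pdivrMr ?ltr_wpDl// mulrBl mul1r mulVf; last by rewrite natr1 pnatr_eq0.
  by rewrite addrK.
have {}h : (n.+1%:R / n.+2%:R) ^+ n.+2 <= e^-1 :> R.
  rewrite (le_trans (@lerXn2r _ n.+2 _ _ _ _ h)) ?nnegrE ?expR_ge0 ?divr_ge0//.
  by rewrite -expRM_natl mulrN mulfV ?pnatr_eq0// expRN.
rewrite -mulrA ler_wpM2l ?(ltW e0)// [leRHS]exprS ler_wpM2l//.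
rewrite -ler_pdivlMl//; apply: le_trans (ler_wpM2r _ h); last exact: exprn_ge0.
by rewrite expr_div_n mulfVK// expf_neq0// pnatr_eq0.
Qed.

End factorial_bounds.

Lemma cvg_eqn (T : topologicalType) (f g : nat -> T) (l : T) :
  (forall n, (0 < n)%N -> f n = g n) -> f @ \oo --> l -> g @ \oo --> l.
Proof.
move=> fg; apply: cvg_trans; apply: near_eq_cvg; near=> n.
by apply: fg; near: n; exact: nbhs_infty_gt.
Unshelve. all: by end_near. Qed.

Section radius.
Context {R : realType}.
Implicit Types n j k : nat.
Let e : R := expR 1.

Lemma wallis_sqr_bounds k :
  2 * pi / k.+2%:R <= wallis k ^+ 2 :> R /\ wallis k ^+ 2 <= 2 * pi / k.+1%:R :> R.
Proof.
have w0 := @wallis_gt0 R.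
split.
  rewrite -(wallisM k) mulrC mulKf ?pnatr_eq0// expr2 ler_wpM2r ?wallis_nincr//.
  exact: ltW.
case: k => [|k].
  by rewrite wallis0 divr1 expr2; have := @pi_ge2 R; lra.
rewrite -(wallisM k) mulrC mulKf ?pnatr_eq0// expr2 ler_wpM2l ?wallis_nincr//.
exact: ltW.
Qed.

(** The bounds on the squared Wallis integrals telescope, and the two sides differ by a factor n + 1
    only. *)
Lemma omega_sqr_bounds n :
  (2 * pi) ^+ n / n.+1`!%:R <= omega n ^+ 2 :> R /\ omega n ^+ 2 <= (2 * pi) ^+ n / n`!%:R :> R.
Proof.
have pi0 := @pi_gt0 R.
elim: n => [|n [IH1 IH2]].
  by rewrite /omega big_ord0 !expr0 expr1n; split; rewrite ?invr1 ?mulr1.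
have [w1 w2] := wallis_sqr_bounds n.
rewrite omegaS [(omega n * _) ^+ 2]exprMn; split.
  rewrite (_ : _ / _ = (2 * pi) ^+ n / n.+1`!%:R * (2 * pi / n.+2%:R)); last first.
    by rewrite (factS n.+1) natrM invfM exprSr; ring.
  by rewrite ler_pM// ?mulr_ge0 ?exprn_ge0 ?mulr_ge0 ?invr_ge0//; lra.
rewrite (_ : _ / _ = (2 * pi) ^+ n / n`!%:R * (2 * pi / n.+1%:R)); last first.
  by rewrite factS natrM invfM exprSr; ring.
by rewrite ler_pM// sqr_ge0.
Qed.

(* The radius of the euclidean ball of volume 1. *)
Definition rad n : R := (omega n `^ n%:R^-1)^-1.

Lemma rad_gt0 n : 0 < rad n.
Proof. by rewrite /rad invr_gt0 powR_gt0// omega_gt0. Qed.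

Lemma rad_omega n : (0 < n)%N -> omega n * rad n ^+ n = 1.
Proof.
move=> n0; rewrite /rad exprVn -powR_mulrn ?powR_ge0// -powRrM mulVf; last first.
  by rewrite pnatr_eq0 -lt0n.
by rewrite powRr1 ?mulfV ?gt_eqF ?ltW ?omega_gt0.
Qed.

Lemma bernoulli_ineq n (x : R) : -1 <= x -> 1 + n%:R * x <= (1 + x) ^+ n.
Proof.
move=> x1; elim: n => [|n IHn]; first by rewrite mul0r addr0 expr0.
rewrite exprS -natr1; apply: le_trans (ler_wpM2l _ IHn); last by lra.
have := ler0n R n; nra.
Qed.

(** If x n exceeded (1 + d)^4, Bernoulli's inequality would make its n-th power at least (n d)^4,
    which outgrows C n^2. *)
Lemma cvg_root1 (x : nat -> R) (C : R) : 0 < C ->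
  (forall n, (0 < n)%N -> 0 <= x n /\ 1 <= x n ^+ n <= C * n%:R ^+ 2) ->
  x @ \oo --> (1 : R).
Proof.
move=> C0 H; apply/cvgrPdist_le => eps eps0.
(* The sum 4 + 6 + 4 + 1 = 15 of binomial coefficients gives (1 + d)^4 <= 1 + 15 d for d <= 1. *)
pose d : R := Num.min (eps / 15) 1.
have d0 : 0 < d by rewrite lt_min ltr01 andbT divr_gt0.
have d1 : d <= 1 by rewrite ge_min lexx orbT.
have deps : 15 * d <= eps.
  by rewrite mulrC -ler_pdivlMr// ge_min lexx.
near=> n.
have n0 : (0 < n)%N by near: n; exact: nbhs_infty_gt.
have [x0 /andP[x1 xC]] := H n n0.
rewrite expr_ge1// in x1.
rewrite distrC ger0_norm ?subr_ge0//.
suff : x n <= (1 + d) ^+ 4.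
  have : (1 + d) ^+ 4 <= 1 + 15 * d.
    have d2 : d ^+ 2 <= d by nra.
    have d3 : d ^+ 3 <= d by rewrite exprS; nra.
    have d4 : d ^+ 4 <= d by rewrite exprS; nra.
    have -> : (1 + d) ^+ 4 = 1 + 4 * d + 6 * d ^+ 2 + 4 * d ^+ 3 + d ^+ 4 by ring.
    lra.
  lra.
rewrite leNgt; apply/negP => xd.
have nd : 0 <= n%:R * d by rewrite mulr_ge0// ltW.
have h1 : (n%:R * d) ^+ 4 <= x n ^+ n.
  apply: (@le_trans _ _ (((1 + d) ^+ 4) ^+ n)).
    rewrite exprAC lerXn2r ?nnegrE// ?exprn_ge0//; first by lra.
    by apply: le_trans (bernoulli_ineq n _); lra.
  by rewrite lerXn2r ?nnegrE ?exprn_ge0//; lra.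
have nR : 0 < n%:R :> R by rewrite ltr0n.
have h2 : n%:R ^+ 2 * d ^+ 4 <= C.
  rewrite -(ler_pM2r (exprn_gt0 2 nR)); apply: le_trans xC; apply: le_trans h1.
  by rewrite exprMn (exprD _ 2 2); nra.
have : C / d ^+ 4 < n%:R by near: n; exact: nbhs_infty_gtr.
rewrite ltr_pdivrMr ?exprn_gt0// => h3.
have n1 : 1 <= n%:R :> R by rewrite ler1n.
have : n%:R * d ^+ 4 <= n%:R ^+ 2 * d ^+ 4.
  by rewrite ler_wpM2r ?exprn_ge0 1?ltW// expr2; nra.
lra.
Unshelve. all: by end_near. Qed.

(** The n-th power of e times this quantity is e^n (2 pi)^n / (omega_n^2 n^n), which the bounds on
    the ball volumes and on the factorials place between 1 and 2 e n^2. *)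
Lemma cvg_rad : (2 * pi * rad n ^+ 2 / n%:R) @[n --> \oo] --> e^-1.
Proof.
have e0 : 0 < e by exact: expR_gt0.
have pi0 := @pi_gt0 R.
suff : (e * (2 * pi * rad n ^+ 2 / n%:R)) @[n --> \oo] --> (1 : R).
  move=> h; apply: (@cvg_eqn _ (fun n => e^-1 * (e * (2 * pi * rad n ^+ 2 / n%:R)))).
    by move=> n _; rewrite mulKf// gt_eqF.
  by rewrite -[X in _ --> X]mulr1; apply: cvgM => //; exact: cvg_cst.
apply: (@cvg_root1 _ (2 * e)); first by rewrite mulr_gt0.
move=> n n0; have nR : 0 < n%:R :> R by rewrite ltr0n.
have r0 := rad_gt0 n.
have f0 : 0 < n`!%:R :> R by rewrite ltr0n fact_gt0.
have o0 := @omega_gt0 R n.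
split.
  by rewrite ltW// mulr_gt0// divr_gt0// mulr_gt0// ?exprn_gt0// mulr_gt0.
have ro := rad_omega n0.
have {}ro : (rad n ^+ 2) ^+ n = (omega n ^+ 2)^-1.
  rewrite exprAC -[LHS]mulr1 -[X in _ * X](@mulfV _ (omega n ^+ 2)) ?gt_eqF ?exprn_gt0//.
  by rewrite mulrA -exprMn [rad n ^+ n * _]mulrC ro expr1n mul1r.
have [om1 om2] := omega_sqr_bounds n.
set E := (_ ^+ n).
have EE : E = e ^+ n * (2 * pi) ^+ n / omega n ^+ 2 / n%:R ^+ n.
  by rewrite /E [LHS]exprMn expr_div_n [in LHS](exprMn _ (2 * pi)) ro; ring.
have p2 : 0 < (2 * pi) ^+ n :> R by rewrite exprn_gt0// mulr_gt0.
have o2 : 0 < omega n ^+ 2 :> R by rewrite exprn_gt0.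
have en : 0 <= e ^+ n by rewrite exprn_ge0// ltW.
rewrite EE; apply/andP; split.
  rewrite ler_pdivlMr ?exprn_gt0// mul1r (le_trans (expn_le_fact n))//.
  rewrite -mulrA ler_wpM2l// ler_pdivlMr//.
  by rewrite mulrC -ler_pdivlMr.
rewrite ler_pdivrMr ?exprn_gt0//.
apply: (@le_trans _ _ (e ^+ n * n.+1`!%:R)).
  rewrite -mulrA ler_wpM2l// ler_pdivrMr//.
  by rewrite -ler_pdivrMl ?ltr0n ?fact_gt0// mulrC.
case: n n0 nR {r0 f0 o0 ro om1 om2 E EE p2 o2 en} => // n _ nR.
rewrite factS natrM mulrCA (le_trans (ler_wpM2l _ (@fact_le_expn R n)))//.
rewrite (_ : 2 * e * _ * _ = (2 * n.+1%:R) * (e * n.+1%:R ^+ n.+2)); last first.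
  by rewrite [in RHS]exprS; ring.
rewrite ler_wpM2r ?(mulr_ge0 (ltW e0)) ?exprn_ge0// -(@natr1 _ n.+1) -(@natr1 _ n).
by have := ler0n R n; lra.
Qed.

Lemma cvg_ratio (k : nat) : (n%:R / (n + k)%:R : R) @[n --> \oo] --> (1 : R).
Proof.
apply/cvgrPdist_le => eps eps0; near=> n.
have n0 : (0 < n)%N by near: n; exact: nbhs_infty_gt.
have nk : 0 < (n + k)%:R :> R by rewrite ltr0n addn_gt0 n0.
have -> : 1 - n%:R / (n + k)%:R = k%:R / (n + k)%:R :> R.
  by rewrite -{1}(@mulfV _ (n + k)%:R) ?gt_eqF// -mulrBl natrD addrAC subrr add0r.
rewrite ger0_norm ?divr_ge0// ler_pdivrMr//.
have : k%:R / eps < n%:R by near: n; exact: nbhs_infty_gtr.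
rewrite ltr_pdivrMr// natrD => h; have := ler0n R k; nra.
Unshelve. all: by end_near. Qed.

Lemma cvg_inv_nat : (n.+1%:R^-1 : R) @[n --> \oo] --> (0 : R).
Proof. exact: cvg_harmonic. Qed.

Lemma cvg_wallis : (wallis n.-1 ^+ 2 * n%:R : R) @[n --> \oo] --> (2 * pi : R).
Proof.
have pi0 := @pi_gt0 R.
apply: (@squeeze_cvgr _ _ _ _ (fun n => 2 * pi * (n%:R / (n + 1)%:R)) (fun=> 2 * pi)).
- near=> n.
  have n0 : (0 < n)%N by near: n; exact: nbhs_infty_gt.
  have nR : 0 < n%:R :> R by rewrite ltr0n.
  have [w1 w2] := wallis_sqr_bounds n.-1.
  rewrite addn1; rewrite prednK// in w1 w2; apply/andP; split.
    by rewrite mulrCA mulrC ler_wpM2r// mulrC.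
  by rewrite -ler_pdivlMr.
- rewrite -[X in _ --> X]mulr1; apply: cvgM; [exact: cvg_cst|exact: cvg_ratio].
- exact: cvg_cst.
Unshelve. all: by end_near. Qed.

Lemma cvg_rad_wallis : ((rad n * wallis n.-1)^-1) @[n --> \oo] --> Num.sqrt e.
Proof.
have e0 : 0 < e by exact: expR_gt0.
have pi0 := @pi_gt0 R.
have w0 := @wallis_gt0 R.
have r0 := rad_gt0.
apply: (@cvg_eqn _ (fun n => Num.sqrt (((rad n * wallis n.-1) ^+ 2)^-1))).
  by move=> n _; rewrite sqrtrV ?sqrtr_sqr ?sqr_ge0// ger0_norm// ltW// mulr_gt0.
apply: continuous_cvg; first exact: sqrt_continuous.
rewrite -[X in _ --> X]invrK; apply: cvgV; first by rewrite invr_eq0 gt_eqF.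
apply: (@cvg_eqn _ (fun n => (2 * pi * rad n ^+ 2 / n%:R) * (wallis n.-1 ^+ 2 * n%:R) * (2 * pi)^-1)).
  move=> n n0; have : n%:R != 0 :> R by rewrite pnatr_eq0 -lt0n.
  have : wallis n.-1 != 0 :> R by rewrite gt_eqF.
  have : rad n != 0 by rewrite gt_eqF.
  move: (n%:R : R) (wallis n.-1 : R) (rad n) (@pi R) pi0 => x w r p p0 r' w' x'.
  by field; rewrite x' gt_eqF.
rewrite (_ : e^-1 = e^-1 * (2 * pi) * (2 * pi)^-1); last first.
  by rewrite mulfK// gt_eqF// mulr_gt0.
apply: cvgM; last exact: cvg_cst.
by apply: cvgM; [exact: cvg_rad|exact: cvg_wallis].
Qed.

(** The quantity is the mean of |x|_1 / 2 over the ball of radius 1 / r. *)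
Lemma cvg_mean_norm1 :
  (n%:R / n.+1%:R * (rad n * wallis n.-1)^-1) @[n --> \oo] --> Num.sqrt e.
Proof.
rewrite -[X in _ --> X]mul1r; apply: cvgM; last exact: cvg_rad_wallis.
by apply: cvg_eqn (cvg_ratio 1) => n _; rewrite addn1.
Qed.

(** The quantity is the mean of r^2 |x|_2^2 over the cross-polytope of radius 2. *)
Lemma cvg_mean_dotvv :
  (rad n ^+ 2 * (8 * n%:R / (n.+1%:R * n.+2%:R))) @[n --> \oo] --> 4 / (e * pi).
Proof.
have e0 : 0 < e by exact: expR_gt0.
have pi0 := @pi_gt0 R.
apply: (@cvg_eqn _ (fun n => 4 / pi * (2 * pi * rad n ^+ 2 / n%:R) * (n%:R / (n + 1)%:R) * (n%:R / (n + 2)%:R))).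
  move=> n n0; rewrite addn1 addn2; have : n.+1%:R != 0 :> R by rewrite pnatr_eq0.
  have : n.+2%:R != 0 :> R by rewrite pnatr_eq0.
  have : n%:R != 0 :> R by rewrite pnatr_eq0 -lt0n.
  move: (n%:R : R) (n.+1%:R : R) (n.+2%:R : R) (@pi R) pi0 => x y z p p0 x0 y0 z0.
  by field; rewrite x0 y0 z0 gt_eqF.
rewrite (_ : 4 / (e * pi) = 4 / pi * e^-1 * 1 * 1); last first.
  by rewrite !mulr1 invfM (mulrC e^-1) mulrA.
apply: cvgM; last exact: cvg_ratio.
apply: cvgM; last exact: cvg_ratio.
by apply: cvgM; [exact: cvg_cst|exact: cvg_rad].
Qed.

(* [weight n j] is the volume of a j-dimensional ball of radius [rad n];
   up to binomial factors these are the coefficients of the Steiner polynomial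
   of the cube. *)
Definition weight n j : R := omega j * rad n ^+ j.

Lemma weight_gt0 n j : 0 < weight n j.
Proof. by rewrite mulr_gt0 ?exprn_gt0 ?omega_gt0 ?rad_gt0. Qed.

Lemma weightS n j : weight n j.+1 = weight n j * (rad n * wallis j).
Proof. by rewrite /weight omegaS exprSr; ring. Qed.

Lemma weightSS n j : j.+2%:R * weight n j.+2 = 2 * pi * rad n ^+ 2 * weight n j.
Proof. by rewrite !weightS -(wallisM j); ring. Qed.

Lemma weight_self n : (0 < n)%N -> weight n n = 1.
Proof. exact: rad_omega. Qed.

Lemma weight0 n : weight n 0 = 1.
Proof. by rewrite /weight /omega big_ord0 mulr1. Qed.

Lemma wallis_le i j : (i <= j)%N -> wallis j <= wallis i :> R.
Proof.
move=> /subnK <-; elim: (j - i)%N => // k IHk.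
by rewrite addSn (le_trans (wallis_nincr _)).
Qed.

(* The sequence [weight n] is log-concave and takes the value 1 at 0 and n. *)
Lemma weight_ge1 n j : (0 < n)%N -> (j <= n)%N -> 1 <= weight n j.
Proof.
move=> n0; case: j => [|j] jn; first by rewrite weight0.
have r0 := rad_gt0 n.
(* The ratios of consecutive weights decrease. If the one at j is at least 1, the weights grow from
   1 up to index j + 1; otherwise they decrease from index j + 1 on, down to the value 1 at n. *)
have [h|h] := leP 1 (rad n * wallis j).
  have : forall i, (i <= j)%N -> 1 <= weight n i.+1.
    elim=> [_|i IHi ij].
      by rewrite weightS weight0 mul1r (le_trans h)// ler_pM2l// wallis_le.
    rewrite weightS (le_trans (IHi (ltnW ij)))// ler_peMr ?(ltW (weight_gt0 _ _))//.
    by rewrite (le_trans h)// ler_pM2l// wallis_le.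
  exact.
have : forall k, (j.+1 + k <= n)%N -> weight n (j.+1 + k) <= weight n j.+1.
  elim=> [|k IHk] kn; first by rewrite addn0.
  rewrite addnS weightS (le_trans _ (IHk _))//; last by rewrite addnS in kn; exact: ltnW.
  rewrite ler_piMr ?(ltW (weight_gt0 _ _))//.
  by rewrite (le_trans _ (ltW h))// ler_pM2l// wallis_le// addSn ltnW// ltnS leq_addr.
move=> /(_ (n - j.+1)%N); rewrite subnKC// => /(_ (leqnn _)).
by rewrite weight_self.
Qed.

Definition total_weight n : R := \sum_(j < n.+1) weight n j.

Lemma total_weight_ge n : (0 < n)%N -> n.+1%:R <= total_weight n.
Proof.
move=> n0; rewrite -[n.+1 in leLHS]card_ord -sum1_card natr_sum.
by apply: ler_sum => j _; rewrite weight_ge1// -ltnS.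
Qed.

(** By [weightSS] the terms with j >= 2 are a fixed multiple of the weights of index j - 2, so the
    sum is the total weight without its last two terms, up to that multiple and the term j = 1. *)
Lemma sum_index_weight n : \sum_(j < n.+2) j%:R * weight n.+1 j =
  2 * pi * rad n.+1 ^+ 2 * (total_weight n.+1 - (weight n.+1 n + 1)) + weight n.+1 1.
Proof.
have -> : total_weight n.+1 - (weight n.+1 n + 1) = \sum_(j < n) weight n.+1 j.
  by rewrite /total_weight 2!big_ord_recr/= weight_self// -addrA addrK.
rewrite 2!big_ord_recl/= mul0r add0r mul1r addrC; congr (_ + _).
by rewrite mulr_sumr; apply: eq_bigr => j _; rewrite -weightSS.
Qed.

(* The mean of the convex coefficient over M_n. *)
Definition mean_weight n : R :=
  (\sum_(j < n.+1) j.+1%:R * weight n j) / (n.+2%:R * total_weight n).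

Lemma mean_weight_itv n : (0 < n)%N -> 0 < mean_weight n < 1.
Proof.
move=> n0; have S0 : 0 < total_weight n.
  by apply: lt_le_trans (total_weight_ge n0).
have h : \sum_(j < n.+1) j.+1%:R * weight n j <= n.+1%:R * total_weight n.
  rewrite mulr_sumr; apply: ler_sum => j _.
  by rewrite ler_wpM2r ?(ltW (weight_gt0 _ _))// ler_nat ltn_ord.
rewrite divr_gt0 ?mulr_gt0//=; last first.
  rewrite big_ord_recl/= ltr_pwDl//; first by rewrite weight0 mulr1.
  by apply: sumr_ge0 => j _; rewrite mulr_ge0// ltW// weight_gt0.
rewrite ltr_pdivrMr ?mulr_gt0// mul1r (le_lt_trans h)//.
by rewrite ltr_pM2r// ltr_nat.
Qed.

(** By [sum_index_weight] the main term is 2 pi r^2 / (n + 2), with limit 1 / e. The remaining terms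
    vanish because the total weight is at least n + 1. *)
Lemma cvg_mean_weight : mean_weight @ \oo --> e^-1.
Proof.
have pi0 := @pi_gt0 R.
have St n : (0 < n)%N -> 0 < total_weight n.
  by move=> n0; apply: lt_le_trans (total_weight_ge n0).
have inv0 : (total_weight n)^-1 @[n --> \oo] --> (0 : R).
  apply: (@squeeze_cvgr _ _ _ _ (fun=> 0) (fun n => n.+1%:R^-1)).
  - near=> n; have n0 : (0 < n)%N by near: n; exact: nbhs_infty_gt.
    rewrite invr_ge0 (ltW (St _ n0))/= lef_pV2 ?posrE ?St//.
    exact: total_weight_ge.
  - exact: cvg_cst.
  - exact: cvg_inv_nat.
have w1 : (weight n 1 / total_weight n / n.+2%:R) @[n --> \oo] --> (0 : R).
  apply: (@squeeze_cvgr _ _ _ _ (fun=> 0) (fun n => n.+1%:R^-1)).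
  - near=> n; have n0 : (0 < n)%N by near: n; exact: nbhs_infty_gt.
    apply/andP; split.
      apply: divr_ge0 => //; apply: divr_ge0; apply: ltW; [exact: weight_gt0|exact: St].
    rewrite ler_pdivrMr// ler_pdivrMr ?St//.
    apply: (@le_trans _ _ (total_weight n)).
      case: (n) n0 => // m _; rewrite /total_weight 2!big_ord_recl/= addrCA lerDl.
      apply: addr_ge0; first by apply: ltW; exact: weight_gt0.
      by apply: sumr_ge0 => j _; apply: ltW; exact: weight_gt0.
    rewrite ler_peMl ?(ltW (St _ n0))// mulrC ler_pdivlMr// mul1r ler_nat.
    exact: ltnW.
  - exact: cvg_cst.
  - exact: cvg_inv_nat.
apply: (@cvg_eqn _ (fun n => (2 * pi * rad n ^+ 2 / n%:R) * (n%:R / (n + 2)%:R) *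
    (1 - ((rad n * wallis n.-1)^-1 + 1) * (total_weight n)^-1) +
    weight n 1 / total_weight n / n.+2%:R + (n%:R / (n + 2)%:R) * (n%:R / (n + 1)%:R)^-1 * n.+1%:R^-1)).
  case=> // n _; rewrite /mean_weight.
  have -> : \sum_(j < n.+2) j.+1%:R * weight n.+1 j =
      \sum_(j < n.+2) j%:R * weight n.+1 j + total_weight n.+1.
    by rewrite /total_weight -big_split/=; apply: eq_bigr => j _; rewrite -natr1 mulrDl mul1r.
  rewrite sum_index_weight.
  have -> : weight n.+1 n = (rad n.+1 * wallis n)^-1.
    have := weight_self (ltn0Sn n); rewrite weightS => h.
    by rewrite -[RHS]mul1r -h mulfK// gt_eqF// mulr_gt0 ?rad_gt0 ?wallis_gt0.
  have := St _ (ltn0Sn n); move: (total_weight n.+1) => S S0.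
  rewrite addn2 addn1 -pred_Sn.
  have : n.+1%:R != 0 :> R by rewrite pnatr_eq0.
  have : n.+2%:R != 0 :> R by rewrite pnatr_eq0.
  have : n.+3%:R != 0 :> R by rewrite pnatr_eq0.
  have rw : rad n.+1 * wallis n != 0 by rewrite gt_eqF// mulr_gt0 ?rad_gt0 ?wallis_gt0.
  move: (rad n.+1 * wallis n) rw => q q0.
  move: (n.+1%:R : R) (n.+2%:R : R) (n.+3%:R : R) (@pi R) => x y z p x0 y0 z0.
  by field; rewrite x0 y0 z0 q0 gt_eqF.
rewrite (_ : e^-1 = e^-1 * 1 * (1 - (Num.sqrt e + 1) * 0) + 0 + 1 * 1^-1 * 0); last by ring.
apply: cvgD; first apply: cvgD => //.
  apply: cvgM; first by apply: cvgM; [exact: cvg_rad|exact: cvg_ratio].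
  apply: cvgB; first exact: cvg_cst.
  apply: cvgM => //; apply: cvgD; [exact: cvg_rad_wallis|exact: cvg_cst].
apply: cvgM; last exact: cvg_inv_nat.
apply: cvgM; first exact: cvg_ratio.
by apply: cvgV; [exact: oner_neq0|exact: cvg_ratio].
Unshelve. all: by end_near. Qed.

End radius.

(** * Steiner's formula for the cube *)

Section parallel_body.
Context {R : realType}.
Implicit Types (n : nat) (h v : R).

(** The distance from u to the interval [-h, h], for h >= 0. *)
Definition excess h (u : R) : R := Num.max (`|u| - h) 0.

Lemma excessN h u : excess h (- u) = excess h u.
Proof. by rewrite /excess normrN. Qed.

Lemma excess_ge0 h u : 0 <= excess h u.
Proof. by rewrite /excess le_max lexx orbT. Qed.

Lemma measurable_excess h (D : set (measurableTypeR R)) :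
  measurable_fun D (excess h : measurableTypeR R -> measurableTypeR R).
Proof.
apply: measurable_funTS; apply: measurable_maxr; last exact: measurable_cst.
by apply: measurable_funB.
Qed.

(** The interval [-h, h] gives the flat term, and the two outer half-lines are pushed together. This
    is Steiner's formula in one variable. *)
Lemma integral_excess h (g : measurableTypeR R -> \bar R) : 0 <= h ->
  measurable_fun setT g -> (forall s, 0 <= g s)%E ->
  (\int[mu]_u g (excess h u ^+ 2)%R =
   (2 * h)%:E * g 0%R + \int[mu]_u g (u ^+ 2)%R)%E.
Proof.
move=> h0 mg g0.
have msq : measurable_fun setT (fun u : measurableTypeR R => g (u ^+ 2)).
  exact: (measurableT_comp mg).
have mex : measurable_fun setT (fun u : measurableTypeR R => g (excess h u ^+ 2)).
  apply: (measurableT_comp mg); apply: measurable_funX; exact: measurable_excess.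
rewrite (integral_even mex) => [|t|t]; [|exact: g0|by rewrite excessN].
rewrite (integral_even msq) => [|t|t]; [|exact: g0|by rewrite sqrrN].
have cup : `[0, +oo[%classic = `[0, h]%classic `|` `]h, +oo[%classic :> set R.
  apply/seteqP; split => u /=; rewrite !in_itv/= !andbT.
    by move=> u0; have [uh|uh] := leP u h; [left; rewrite u0|right].
  by move=> [/andP[]//|hu]; rewrite ltW// (le_lt_trans h0).
rewrite [in LHS]cup ge0_integral_setU//; last 2 first.
- exact: measurable_funTS.
- apply/eqP; apply/seteqP; split => u //= -[]; rewrite !in_itv/= andbT => /andP[_ ?] ?; lra.
rewrite ge0_muleDr ?integral_ge0//; congr (_ + _)%E.
  rewrite (eq_integral (cst (g 0))); last first.
    move=> u; rewrite inE/= in_itv/= => /andP[u0 uh]; congr g.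
    by rewrite /excess ger0_norm// max_r ?expr0n//; lra.
  rewrite integral_cst//= lebesgue_measure_itv/= lte_fin.
  have [h0'|h0'] := ltP 0 h; last first.
    by rewrite (_ : h = 0) ?mulr0 ?mule0 ?mul0e//; apply/le_anti; rewrite h0' h0.
  by rewrite oppr0 adde0 (muleC (g 0)) muleA -EFinM.
congr (_ * _)%E; rewrite [LHS]integral_mkcond (integral_shift h); last 2 first.
- exact/(measurable_restrictT _ _).1/measurable_funTS.
- by move=> u; rewrite patchE; case: ifPn.
rewrite -(integral_itv_obnd_cbnd (r := 0)); last exact: measurable_funTS.
rewrite [RHS]integral_mkcond; apply: eq_integral => u _; rewrite !patchE.
have -> : (u + h \in `]h, +oo[%classic) = (u \in `]0, +oo[%classic).
  by apply/idP/idP; rewrite !inE/= !in_itv/= !andbT; lra.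
case: ifPn => //; rewrite inE/= in_itv/= andbT => u0; congr (g (_ ^+ 2)).
by rewrite /excess ger0_norm ?addrK ?max_l//; lra.
Qed.

Definition sqdist_cube n h (x : 'rV[R]_n) : R := \sum_(i < n) excess h (x ord0 i) ^+ 2.

Lemma sqdist_cube_snoc n h (x : 'rV[R]_n) t :
  sqdist_cube h (snoc x t) = sqdist_cube h x + excess h t ^+ 2.
Proof.
rewrite /sqdist_cube big_snoc !snoc_max; congr (_ + _).
by apply: eq_bigr => j _; rewrite !snoc_lift.
Qed.

Definition parallel_cube n h v : set 'rV[R]_n := [set x | sqdist_cube h x <= v].

Arguments parallel_cube n h v : clear implicits.

Lemma measurable_sqdist_cube n h : measurable_fun setT (@sqdist_cube n h).
Proof.
apply: measurable_sum => i; apply: measurable_funX.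
apply: measurableT_comp; [exact: measurable_excess|exact: measurable_coord].
Qed.

Lemma measurable_parallel_cube n h v : measurable (parallel_cube n h v).
Proof.
by apply: measurable_le_set; [exact: measurable_sqdist_cube|exact: measurable_cst].
Qed.

Lemma parallel_cube_section n h v t :
  [set x | parallel_cube n.+1 h v (snoc x t)] = parallel_cube n h (v - excess h t ^+ 2).
Proof.
by apply/seteqP; split => x; rewrite /parallel_cube/= sqdist_cube_snoc; lra.
Qed.

Lemma eball_fin j v : vol j (eball j v) = (fine (vol j (eball j v)))%:E.
Proof.
rewrite fineK// ge0_fin_numE//.
apply: (@le_lt_trans _ _ (vol j (eball j (Num.max 1 v ^+ 2)))); last first.
  by rewrite vol_eball ?ltry// lt_max ltr01.
apply: le_measure; rewrite ?inE; [exact: measurable_eball..|].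
move=> x; rewrite /eball/= => /le_trans; apply.
have : 1 <= Num.max 1 v by rewrite le_max lexx.
have : v <= Num.max 1 v by rewrite le_max lexx orbT.
by move: (Num.max 1 v) => m; nra.
Qed.

Lemma pascal_sum (a : R) (b : nat -> R) n :
  \sum_(j < n.+2) 'C(n.+1, j)%:R * a ^+ (n.+1 - j) * b j =
  a * (\sum_(j < n.+1) 'C(n, j)%:R * a ^+ (n - j) * b j) +
  \sum_(j < n.+1) 'C(n, j)%:R * a ^+ (n - j) * b j.+1.
Proof.
rewrite big_ord_recl/= bin0 subn0 mul1r.
under eq_bigr do rewrite /bump/= add1n binS natrD 2!mulrDl subSS.
rewrite big_split/= addrA; congr (_ + _).
rewrite mulr_sumr [in RHS]big_ord_recl/= bin0 subn0 mul1r exprS mulrA; congr (_ + _).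
rewrite big_ord_recr/= bin_small// !mul0r addr0.
apply: eq_bigr => j _; rewrite /bump/= add1n.
by rewrite -(subnSK (ltn_ord j)) exprS; ring.
Qed.

(** By [integral_excess] the last coordinate either lies in [-h, h], which yields a factor 2 h, or
    acts as a euclidean coordinate, which turns [eball j] into [eball j.+1]; Pascal's rule collects
    the two cases. The ball volumes stay implicit because v can become negative in the sections. *)
Lemma steiner_cube_eball n h v : 0 <= h ->
  vol n (parallel_cube n h v) =
  (\sum_(j < n.+1) 'C(n, j)%:R * (2 * h) ^+ (n - j) * fine (vol j (eball j v)))%:E.
Proof.
move=> h0; elim: n v => [|n IHn] v.
  rewrite big_ord_recl big_ord0 bin0 expr0 !mul1r addr0 -eball_fin; congr (vol 0 _).
  by apply/seteqP; split => x; rewrite /parallel_cube /eball/= /sqdist_cube /dotv !big_ord0.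
rewrite vol_snoc; last exact: measurable_parallel_cube.
under eq_integral do rewrite parallel_cube_section.
pose G (s : measurableTypeR R) := vol n (parallel_cube n h (v - s)).
have mG : measurable_fun setT G.
  (* To see that [G] is measurable, s is made the last coordinate of a set whose horizontal sections
     are these parallel bodies. *)
  pose A := [set z : 'rV[R]_n.+1 | sqdist_cube h (\row_j z ord0 (lift ord_max j)) + z ord0 ord_max <= v].
  have mA : measurable A.
    apply: measurable_le_set; last exact: measurable_cst.
    apply: measurable_funD; last exact: measurable_coord.
    rewrite /sqdist_cube; apply: measurable_sum => i; apply: measurable_funX.
    apply: measurableT_comp; first exact: measurable_excess.
    by under eq_fun do rewrite mxE; exact: measurable_coord.
  have := measurable_vol_section mA; congr (measurable_fun _ _).
  apply/funext => s; rewrite /G; congr (vol n _).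
  apply/seteqP; split => x; rewrite /A /parallel_cube/= snoc_max;
    rewrite (_ : \row_j _ = x) ?lerBrDr//; by apply/rowP => j; rewrite mxE snoc_lift.
rewrite (integral_excess (g := G))// /G subr0 IHn -EFinM.
under eq_integral do rewrite IHn -sumEFin.
rewrite ge0_integral_sum//; last 2 first.
- move=> j; under eq_fun do rewrite EFinM -eball_fin -eball_section.
  apply: measurable_funeM; apply: measurable_vol_section; exact: measurable_eball.
- by move=> j s _; rewrite lee_fin !mulr_ge0 ?exprn_ge0 ?mulr_ge0 ?fine_ge0.
rewrite (pascal_sum _ (fun j => fine (vol j (eball j v)))) EFinD; congr (_ + _)%E.
rewrite -sumEFin; apply: eq_bigr => j _.
under eq_integral do rewrite EFinM -eball_fin -eball_section.
rewrite ge0_integralZl//; last 2 first.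
- apply: measurable_vol_section; exact: measurable_eball.
- by rewrite lee_fin !mulr_ge0 ?exprn_ge0 ?mulr_ge0.
by rewrite -vol_snoc -?eball_fin ?EFinM -?eball_fin//; exact: measurable_eball.
Qed.

Lemma steiner_cube n h (rho : R) : 0 <= h -> 0 < rho ->
  vol n (parallel_cube n h (rho ^+ 2)) =
  (\sum_(j < n.+1) 'C(n, j)%:R * (2 * h) ^+ (n - j) * (omega j * rho ^+ j))%:E.
Proof.
move=> h0 r0; rewrite steiner_cube_eball//; congr EFin; apply: eq_bigr => j _.
by rewrite vol_eball.
Qed.

End parallel_body.
Arguments parallel_cube {R} n h v.

(** * The volume and the centroid of M_n *)

Section body_M.
Context {R : realType}.
Implicit Types n : nat.
Let e : R := expR 1.

Let sqr_normr (u : R) : `|u| ^+ 2 = u ^+ 2.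
Proof. by rewrite real_normK ?num_real. Qed.

Lemma snoc_inj n (x y : 'rV[R]_n) t s : snoc x t = snoc y s -> x = y /\ t = s.
Proof.
move=> E; split; last by rewrite -(snoc_max x t) E snoc_max.
by apply/rowP => i; rewrite -(snoc_lift x t) E snoc_lift.
Qed.

Definition height : R := 1 / (e - 1).
Local Notation b := height.

Lemma expR1_gt2 : 2 <= e.
Proof. by have := expR_ge1Dx (1 : R); rewrite /e; lra. Qed.

Lemma height_gt0 : 0 < b.
Proof. by rewrite divr_gt0//; have := expR1_gt2; lra. Qed.

Lemma vol_ball2 n : vol n (@ball2 R n) = (omega n)%:E.
Proof.
rewrite (_ : @ball2 R n = eball n (1 ^+ 2)) ?vol_eball ?expr1n ?mulr1//.
apply/seteqP; split => x; rewrite /ball2 /eball/= /norm2.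
  by rewrite -[X in _ <= X -> _]sqrtr1 ler_sqrt.
by rewrite -[X in _ -> _ <= X]sqrtr1 ler_sqrt.
Qed.

Lemma bodyKE n : @bodyK R n = eball n (rad n ^+ 2).
Proof.
have r0 := @rad_gt0 R n.
rewrite /bodyK vol_ball2/= -/(rad n).
have B x : @ball2 R n x <-> dotv x x <= 1.
  by rewrite /ball2/= /norm2 -[X in _ <= X]sqrtr1 ler_sqrt.
apply/seteqP; split => x.
  move=> [y /B y1 <-]; rewrite /eball/= dotvZl dotvZr mulrA -expr2.
  by rewrite -[leRHS]mulr1 ler_pM2l ?exprn_gt0.
rewrite /eball/= => xr; exists ((rad n)^-1 *: x); last first.
  by rewrite scalerA mulfV ?gt_eqF// scale1r.
apply/B; rewrite dotvZl dotvZr mulrA -expr2 exprVn.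
by rewrite mulrC ler_pdivrMr ?exprn_gt0// mul1r.
Qed.

Lemma bodyLE n : @bodyL R n = [set x | forall i, `|x ord0 i| <= 1 / 2].
Proof.
apply/seteqP; split => x.
  move=> [y y1 <-] i; rewrite mxE ler_norml; have := y1 i; lra.
move=> /= x1; exists (2 *: x); last by rewrite scalerA mulVf// scale1r.
by move=> i; rewrite mxE; have := x1 i; rewrite ler_norml; lra.
Qed.

(* The convex coefficient of the first body at height [t]. *)
Definition coef (t : R) : R := (b - t) / (1 + b).

Lemma coefE lam : coef (lam * - 1 + (1 - lam) * b) = lam.
Proof. by rewrite /coef; have := height_gt0; move: b => c c0; field; lra. Qed.

(** The witness is the projection of x onto the cube. The third property says that x - c is an outer
    normal at c: the scalar product of c and x - c is the support function of the cube at x - c. *)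
Lemma clamp_cube n h (x : 'rV[R]_n) : 0 <= h ->
  exists c : 'rV[R]_n,
    [/\ forall i, `|(x - c) ord0 i| = excess h (x ord0 i),
        forall i, `|c ord0 i| <= h &
        forall i, c ord0 i * (x - c) ord0 i = h * `|(x - c) ord0 i|].
Proof.
move=> h0; exists (\row_i Num.max (- h) (Num.min h (x ord0 i))).
suff H (u : R) : let c := Num.max (- h) (Num.min h u) in
    [/\ `|u - c| = excess h u, `|c| <= h & c * (u - c) = h * `|u - c|].
  by split => i; have [] := H (x ord0 i); rewrite !mxE.
rewrite /excess minEle maxEle maxEle.
case: (lerP h u) => hu; case: ifPn => [h1|]; rewrite -?ltNge.
- rewrite (@ger0_norm _ (u - h)); last by lra.
  rewrite (@ger0_norm _ u); last by lra.
  rewrite ger0_norm//; case: ifPn => [h2|_]; split => //; nra.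
- lra.
- rewrite subrr normr0 !mulr0; case: ifPn => [_|].
    by split => //; rewrite ler_norml; lra.
  rewrite -ltNge => h2.
  by have : `|u| <= h; [rewrite ler_norml; lra|lra].
- move=> h1; rewrite (@ler0_norm _ (u - - h)); last by lra.
  rewrite (@ler0_norm _ u); last by lra.
  rewrite normrN ger0_norm//; case: ifPn => [h2|_]; split => //; nra.
Qed.

(** The height determines the convex coefficient, so the section is a cube of half-side (1 - lam) /
    2 plus a ball of radius lam r. Conversely, x is split at its projection onto that cube. *)
Lemma bodyMP n (x : 'rV[R]_n) (t : R) : bodyM R n (snoc x t) <->
  0 <= coef t <= 1 /\ sqdist_cube ((1 - coef t) / 2) x <= (coef t * rad n) ^+ 2.
Proof.
have b0 := height_gt0.
rewrite /bodyM -/b /co_lift bodyKE bodyLE /=; split.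
  move=> [u [y [lam [Ku Ly lam01 E]]]].
  move: E; rewrite !snocZ snocD => /snoc_inj[xE tE].
  rewrite tE coefE; split => //; rewrite exprMn.
  apply: le_trans (ler_wpM2l (sqr_ge0 _) Ku); rewrite /dotv mulr_sumr.
  apply: ler_sum => i _; rewrite -expr2 -exprMn -[leRHS]sqr_normr.
  rewrite lerXn2r ?nnegrE ?excess_ge0// /excess ge_max normr_ge0 andbT xE !mxE.
  have := Ly i; have := ler_normD (lam * u ord0 i) ((1 - lam) * y ord0 i).
  rewrite (normrM (1 - lam)) (@ger0_norm _ (1 - lam)); last by lra.
  have : 0 <= 1 - lam by lra.
  by move: `|y ord0 i| => Y; nra.
move=> [c01 dx]; set lam := coef t in c01 dx.
have tE : t = lam * - 1 + (1 - lam) * b.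
  by rewrite /lam /coef; move: b b0 => c c0; field; lra.
pose h : R := (1 - lam) / 2.
have h0 : 0 <= h by rewrite /h; lra.
have [c [dE cE _]] := clamp_cube x h0.
have dd : dotv (x - c) (x - c) <= (lam * rad n) ^+ 2.
  apply: le_trans dx; apply: ler_sum => i _.
  by rewrite -expr2 -sqr_normr dE.
(* At lam = 0 or lam = 1 the inverse of 0 is 0, so the corresponding witness is the zero vector,
   which is in the body; the equality of vectors is then checked separately. *)
exists (lam^-1 *: (x - c)), ((1 - lam)^-1 *: c), lam; split => //.
- rewrite /eball/= dotvZl dotvZr mulrA.
  have [->|l0] := eqVneq lam 0; first by rewrite invr0 !mul0r sqr_ge0.
  rewrite -expr2 exprVn mulrC ler_pdivrMr ?exprn_even_gt0//.
  by rewrite -exprMn mulrC.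
- move=> i; rewrite mxE normrM; have := cE i.
  have [->|l0] := eqVneq (1 - lam) 0; first by rewrite invr0 normr0 mul0r; lra.
  rewrite ger0_norm; last by rewrite invr_ge0; lra.
  by rewrite mulrC ler_pdivrMr /h; lra.
- rewrite !snocZ !scalerA snocD -tE; congr snoc; apply/rowP => i.
  have [l0|l0] := eqVneq lam 0.
    have d0 : (x - c) ord0 i = 0.
      apply/eqP; rewrite -normr_eq0 dE -sqrf_eq0 eq_le sqr_ge0 andbT.
      apply: le_trans (_ : sqdist_cube h x <= _); last by rewrite (le_trans dx)// l0 mul0r expr0n.
      rewrite /sqdist_cube (bigD1 i)//= lerDl sumr_ge0// => j _; exact: sqr_ge0.
    move: d0; rewrite !mxE l0 !mul0r add0r subr0 invr1 mulr1 mul1r => /eqP.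
    by rewrite subr_eq0 => /eqP.
  have [l1|l1] := eqVneq (1 - lam) 0.
    have c0 : c ord0 i = 0.
      by apply/eqP; rewrite -normr_eq0 eq_le normr_ge0 andbT (le_trans (cE i))// /h l1 mul0r.
    move: c0; rewrite 2!mxE [in X in _ = X + _]mxE [in X in _ = _ + X]mxE => c0.
    by rewrite !mxE c0 mulfV// mul1r mulr0 addr0 subr0.
  by rewrite !mxE !mulfV// !mul1r subrK.
Qed.

Lemma measurable_coef (D : set (measurableTypeR R)) :
  measurable_fun D (coef : measurableTypeR R -> measurableTypeR R).
Proof.
apply: measurable_funM; last exact: measurable_cst.
by apply: measurable_funB; [exact: measurable_cst|exact: measurable_id].
Qed.

Lemma measurable_bodyM n : measurable (bodyM R n).
Proof.
have mc : measurable_fun setT (fun z : 'rV[R]_n.+1 => coef (z ord0 ord_max) : measurableTypeR R).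
  apply: measurableT_comp; [exact: measurable_coef|exact: measurable_coord].
rewrite (_ : bodyM R n = [set z | 0 <= coef (z ord0 ord_max)] `&`
    [set z | coef (z ord0 ord_max) <= 1] `&`
    [set z | \sum_(i < n) Num.max (`|z ord0 (lift ord_max i)| - (1 - coef (z ord0 ord_max)) / 2) 0 ^+ 2 <=
      (coef (z ord0 ord_max) * rad n) ^+ 2]).
  apply: measurableI; first apply: measurableI.
  - by apply: measurable_le_set => //; exact: measurable_cst.
  - by apply: measurable_le_set => //; exact: measurable_cst.
  - apply: measurable_le_set.
      apply: measurable_sum => i; apply: measurable_funX; apply: measurable_maxr => //.
      apply: measurable_funB.
        apply: measurableT_comp => //; exact: measurable_coord.
      by apply: measurable_funM => //; apply: measurable_funB.
    by apply: measurable_funX; apply: measurable_funM.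
apply/seteqP; split => z; rewrite (snocP z) bodyMP /= !snoc_max /sqdist_cube /excess.
  move=> [/andP[h1 h2] h3]; split => //; apply: le_trans h3.
  by under eq_bigr do rewrite snoc_lift.
move=> [[h1 h2] h3]; rewrite h1 h2; split => //; apply: le_trans h3.
by under [leRHS]eq_bigr do rewrite snoc_lift.
Qed.

Lemma steiner_section n (t : R) : -1 < t < b ->
  vol n [set x | bodyM R n (snoc x t)] =
  (\sum_(j < n.+1) 'C(n, j)%:R * weight n j * (coef t ^+ j * (1 - coef t) ^+ (n - j)))%:E.
Proof.
move=> tb; have b0 := height_gt0.
have c0 : 0 < coef t by rewrite /coef divr_gt0//; lra.
have c1 : coef t < 1 by rewrite /coef ltr_pdivrMr; lra.
rewrite (_ : [set x | _] = parallel_cube n ((1 - coef t) / 2) ((coef t * rad n) ^+ 2)).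
  rewrite steiner_cube; [|lra|by rewrite mulr_gt0// rad_gt0].
  congr EFin; apply: eq_bigr => j _; rewrite (_ : 2 * ((1 - coef t) / 2) = 1 - coef t); last by field.
  by rewrite /weight [(coef t * _) ^+ _]exprMn; ring.
apply/seteqP; split => x /=; rewrite bodyMP /parallel_cube/=; first by case.
by move=> h; split => //; lra.
Qed.

Lemma bodyM_section_out n (t : R) : ~ (-1 <= t <= b) ->
  [set x : 'rV[R]_n | bodyM R n (snoc x t)] = set0.
Proof.
move=> tb; apply/seteqP; split => x //= /bodyMP[+ _]; have b0 := height_gt0.
have b1 : 0 < 1 + b by lra.
by move=> c01; apply: tb; move: c01; rewrite /coef ler_pdivrMr// ler_pdivlMr//; lra.
Qed.

(** The case p = 0 gives the volume and p = 1 the mean of the coefficient. The absolute value keeps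
    the integrand nonnegative off the body too, as the section formula demands. *)
Lemma integral_bodyM n p :
  (\int[vol n.+1]_(z in bodyM R n) (`|coef (z ord0 ord_max)| ^+ p)%:E =
   ((1 + b) * \sum_(j < n.+1) 'C(n, j)%:R * weight n j *
      ((n - j)`!%:R * (j + p)`!%:R / (n + p).+1`!%:R))%:E)%E.
Proof.
have b0 := height_gt0.
have mcp m : measurable_fun setT (fun z : 'rV[R]_m.+1 => (`|coef (z ord0 ord_max)| ^+ p)%:E).
  apply/measurable_EFinP; apply: measurable_funX; apply: measurableT_comp => //.
  by apply: measurableT_comp; [exact: measurable_coef|exact: measurable_coord].
rewrite integral_snoc_in//; [|exact: measurable_bodyM].
have mS := measurable_integral_section (@measurable_bodyM n) (@mcp n)
  (fun x => exprn_ge0 p (normr_ge0 (coef (x ord0 ord_max)))).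
pose g (t : R) := \sum_(j < n.+1) 'C(n, j)%:R * weight n j * ((1 - coef t) ^+ (n - j) * coef t ^+ (j + p)).
rewrite (integral_support (g := g) (a := -1) (b := b))//; last 2 first.
- by move=> t tb; rewrite bodyM_section_out// integral_set0.
- move=> t tb; under eq_integral do rewrite snoc_max.
  have c0 : 0 < coef t by rewrite /coef divr_gt0//; lra.
  rewrite integral_cst; last exact: measurable_section (@measurable_bodyM n).
  rewrite [X in (_ * X)%E]steiner_section// -EFinM; congr EFin.
  rewrite mulr_sumr /g; apply: eq_bigr => j _; rewrite (gtr0_norm c0) exprD; ring.
have mg : measurable_fun setT (g : measurableTypeR R -> measurableTypeR R).
  apply: measurable_sum => j; apply: measurable_funM => //; apply: measurable_funM.
    by apply: measurable_funX; apply: measurable_funB => //; exact: measurable_coef.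
  by apply: measurable_funX; exact: measurable_coef.
have w0 j : 0 <= 'C(n, j)%:R * weight n j :> R.
  by apply: mulr_ge0 => //; apply: ltW; exact: weight_gt0.
have g0 (t : R) : -1 <= t <= b -> 0 <= g t.
  move=> tb; apply: sumr_ge0 => j _; apply: mulr_ge0; first exact: w0.
  apply: mulr_ge0; apply: exprn_ge0; rewrite ?subr_ge0 /coef.
    by rewrite ler_pdivrMr; lra.
  by apply: divr_ge0; lra.
(* The change of variable asks for a function that is nonnegative on the whole line, while [g] is
   known to be so on [-1, b] only. *)
pose gg (t : R) : \bar R := (Num.max (g t) 0)%:E.
transitivity (\int[mu]_(t in `[(-1)%R, b]) gg t)%E.
  apply: eq_integral => t; rewrite inE/= in_itv/= => tb.
  by rewrite /gg max_l// g0.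
rewrite integral_affine_itv; last 3 first.
- lra.
- by apply/measurable_EFinP; apply: measurable_maxr => //; exact: measurable_cst.
- by move=> t; rewrite lee_fin le_max lexx orbT.
rewrite (_ : b - -1 = 1 + b); last by ring.
rewrite EFinM; congr (_ * _)%E.
have cs (s : R) : coef (-1 + (1 + b) * s) = 1 - s.
  by rewrite /coef; move: b b0 => c c0; field; lra.
transitivity (\int[mu]_(s in `[0%R, 1%R]) (\sum_(j < n.+1)
    ('C(n, j)%:R * weight n j * (s ^+ (n - j) * (1 - s) ^+ (j + p)) : R)%:E))%E.
  apply: eq_integral => s; rewrite inE/= in_itv/= => s01.
  rewrite /gg max_l; last by apply: g0; nra.
  by rewrite /g cs (_ : 1 - (1 - s) = s) ?sumEFin//; ring.
rewrite ge0_integral_sum//; last 2 first.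
- move=> j; apply/measurable_EFinP; apply: measurable_funM => //; apply: measurable_funM.
    by apply: measurable_funX.
  by apply: measurable_funX; apply: measurable_funB.
- move=> j s; rewrite /= in_itv/= => s01; rewrite lee_fin; apply: mulr_ge0; first exact: w0.
  by apply: mulr_ge0; apply: exprn_ge0; lra.
rewrite -sumEFin; apply: eq_bigr => j _.
rewrite ge0_integralZl_real//.
- by rewrite integral_beta -EFinM addnA subnK// -ltnS.
- apply: measurable_funM; first exact: measurable_funX.
  by apply: measurable_funX; apply: measurable_funB.
- move=> s; rewrite /= in_itv/= => s01; by apply: mulr_ge0; apply: exprn_ge0; lra.
Qed.

(** The binomial coefficient cancels the beta integral, C(n,j) (n-j)! j! / (n+1)! = 1 / (n+1), so
    every weight enters with the same factor. *)
Lemma vol_bodyM n : vol n.+1 (bodyM R n) = ((1 + b) / n.+1%:R * total_weight n)%:E.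
Proof.
have := integral_bodyM n 0; under eq_integral do rewrite expr0.
rewrite integral_cst ?mul1e; last exact: measurable_bodyM.
move=> ->; congr EFin; rewrite -mulrA; congr (_ * _); rewrite /total_weight mulr_sumr.
apply: eq_bigr => j _; rewrite !addn0 factS natrM invfM.
rewrite (_ : 'C(n, j)%:R * _ * _ = ('C(n, j) * (j`! * (n - j)`!))%:R * weight n j / n`!%:R / n.+1%:R); last first.
  by rewrite !natrM; ring.
rewrite bin_fact -1?ltnS//; have : n`!%:R != 0 :> R by rewrite pnatr_eq0 -lt0n fact_gt0.
move: (n`!%:R : R) (n.+1%:R^-1 : R) => f c f0.
by field.
Qed.

Lemma total_weight_gt0 n : 0 < total_weight n :> R.
Proof.
rewrite /total_weight big_ord_recr/= ltr_wpDl ?weight_gt0//.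
by apply: sumr_ge0 => j _; rewrite ltW// weight_gt0.
Qed.

Lemma integral_coef_bodyM n :
  (\int[vol n.+1]_(z in bodyM R n) `|coef (z ord0 ord_max)|%:E =
   ((1 + b) / n.+1%:R * total_weight n * mean_weight n)%:E)%E.
Proof.
have := integral_bodyM n 1; under eq_integral do rewrite expr1.
move=> ->; congr EFin; rewrite -!mulrA; congr (_ * _).
have -> : total_weight n * mean_weight n =
    (\sum_(j < n.+1) j.+1%:R * weight n j) / n.+2%:R :> R.
  have : total_weight n != 0 :> R by rewrite gt_eqF// total_weight_gt0.
  have : n.+2%:R != 0 :> R by rewrite pnatr_eq0.
  rewrite /mean_weight; move: (\sum_(j < _) _) (total_weight n : R) (n.+2%:R : R) => S T N N0 T0.
  by field; rewrite N0 T0.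
rewrite mulr_suml mulr_sumr; apply: eq_bigr => j _.
rewrite !addn1 (factS n.+1) (factS n) (factS j) !natrM.
have := @bin_fact n j; rewrite -ltnS => /(_ (ltn_ord j)) /(congr1 (fun k => k%:R : R)).
rewrite !natrM => <-.
have : n.+1%:R != 0 :> R by rewrite pnatr_eq0.
have : n.+2%:R != 0 :> R by rewrite pnatr_eq0.
have : j`!%:R != 0 :> R by rewrite pnatr_eq0 -lt0n fact_gt0.
have : (n - j)`!%:R != 0 :> R by rewrite pnatr_eq0 -lt0n fact_gt0.
have : 'C(n, j)%:R != 0 :> R by rewrite pnatr_eq0 -lt0n bin_gt0 -ltnS.
move: (n.+1%:R : R) (n.+2%:R : R) (j`!%:R : R) ((n - j)`!%:R : R) ('C(n, j)%:R : R) (j.+1%:R : R) (weight n j : R).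
move=> N1 N2 f g c k w c0 g0 f0 N20 N10; field.
by rewrite c0 g0 f0 N20 N10.
Qed.

End body_M.

(** * Bounded sets, odd integrands and centroids of symmetric sets *)

Section bounded_sets.
Context {R : realType}.
Implicit Types n : nat.

Lemma vol_lty n (c : R) (D : set 'rV[R]_n) : measurable D -> 0 <= c ->
  (forall x : 'rV[R]_n, D x -> forall i, `|x ord0 i| <= c) -> (vol n D < +oo)%E.
Proof.
move=> mD c0 Dc; apply: (@le_lt_trans _ _
    (vol n [set x : 'rV[R]_n | forall i, - c <= x ord0 i <= c])).
  apply: le_measure; rewrite ?inE//; first exact: measurable_box.
  by move=> x Dx i; rewrite -ler_norml Dc.
by rewrite vol_box ?ltry// => i; lra.
Qed.

Lemma vol_gt0 n (c : 'rV[R]_n) (eps : R) (D : set 'rV[R]_n) : measurable D ->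
  0 < eps -> (forall x : 'rV[R]_n, (forall i, `|x ord0 i - c ord0 i| <= eps) -> D x) ->
  (0 < vol n D)%E.
Proof.
move=> mD eps0 Dc; apply: (@lt_le_trans _ _
    (vol n [set x : 'rV[R]_n | forall i, c ord0 i - eps <= x ord0 i <= c ord0 i + eps])).
  rewrite vol_box; last by move=> i; lra.
  by rewrite lte_fin; apply: prodr_gt0 => i _; lra.
apply: le_measure; rewrite ?inE//; first exact: measurable_box.
by move=> x cx; apply: Dc => i; rewrite ler_norml; have := cx i; lra.
Qed.

Lemma integrable_bounded n (D : set 'rV[R]_n) (f : 'rV[R]_n -> R) (c : R) :
  measurable D -> (vol n D < +oo)%E -> measurable_fun setT f ->
  (forall x, D x -> `|f x| <= c) -> (vol n).-integrable D (EFin \o f).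
Proof.
move=> mD Doo mf fc.
apply: measurable_bounded_integrable => //; first exact: measurable_funTS.
exists c; split; first exact: num_real.
by move=> M cM x Dx; apply: le_trans (fc x Dx) _; exact: ltW.
Qed.

Lemma integral_odd n (D : set 'rV[R]_n.+1) (f : 'rV[R]_n.+1 -> R) :
  measurable D -> measurable_fun setT f ->
  (forall x t, D (snoc x t) -> D (snoc (- x) t)) ->
  (forall x t, f (snoc (- x) t) = - f (snoc x t)) ->
  \int[vol n.+1]_(z in D) f z = 0.
Proof.
move=> mD mf Ds fs.
pose rf (z : 'rV[R]_n.+1) := snoc (- \row_j z ord0 (lift ord_max j)) (z ord0 ord_max).
have Drf z : (rf z \in D) = (z \in D).
  apply/idP/idP; rewrite !inE /rf => h.
    by rewrite (snocP z) -[\row_j _]opprK; exact: Ds.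
  by apply: Ds; rewrite -snocP.
have frf z : f (rf z) = - f z by rewrite [in RHS](snocP z) -fs.
have mp : measurable_fun setT ((EFin \o f)^\+ \_ D)%E.
  apply/(measurable_restrictT _ _).1 => //; apply: measurable_funTS.
  by apply: measurable_funepos; exact/measurable_EFinP.
have E : (\int[vol n.+1]_(z in D) ((EFin \o f)^\+ z) = \int[vol n.+1]_(z in D) ((EFin \o f)^\- z))%E.
  rewrite integral_mkcond (integral_reflect mp); last first.
    by move=> z; rewrite patchE; case: ifPn.
  rewrite [RHS]integral_mkcond; apply: eq_integral => z _.
  by rewrite !patchE -/(rf z) Drf; case: ifPn => // _; rewrite funeposE funenegE /= frf EFinN.
rewrite /Rintegral integralE E.
(* If the common value of the two parts is infinite, their difference is infinite as well and [fine]
   sends it to 0. *)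
by case: (integral _ _ _) => [r| |]//=; rewrite subrr.
Qed.

Lemma centroid_symmetric n (D : set 'rV[R]_n.+1) : measurable D ->
  (forall x t, D (snoc x t) -> D (snoc (- x) t)) ->
  centroid D = snoc 0 (centroid D ord0 ord_max).
Proof.
move=> mD Ds; apply/rowP => i; case: (unliftP ord_max i) => [j|] ->; last by rewrite snoc_max.
rewrite snoc_lift !mxE integral_odd ?mulr0//; first exact: measurable_coord.
by move=> x t; rewrite !snoc_lift mxE.
Qed.

Lemma norm2_snoc0 n (t : R) : norm2 (snoc (0 : 'rV[R]_n) t) = `|t|.
Proof. by rewrite /norm2 dotv_snoc dotv0l add0r -expr2 sqrtr_sqr. Qed.

End bounded_sets.

Section centroid_M.
Context {R : realType}.
Implicit Types n : nat.
Local Notation b := (@height R).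

Lemma sqdist_cubeN n h (x : 'rV[R]_n) : sqdist_cube h (- x) = sqdist_cube h x.
Proof. by apply: eq_bigr => i _; rewrite mxE excessN. Qed.

Lemma bodyM_symmetric n (x : 'rV[R]_n) t : bodyM R n (snoc x t) -> bodyM R n (snoc (- x) t).
Proof. by rewrite !bodyMP sqdist_cubeN. Qed.

Lemma bodyM_bounded n (x : 'rV[R]_n) t : bodyM R n (snoc x t) ->
  -1 <= t <= b /\ forall i, `|x ord0 i| <= 1 + rad n.
Proof.
have b0 := @height_gt0 R; have b1 : 0 < 1 + b by lra.
have r0 := @rad_gt0 R n.
move=> /bodyMP[c01 xr]; split.
  by move: c01; rewrite /coef ler_pdivrMr// ler_pdivlMr//; lra.
move=> i; have : excess ((1 - coef t) / 2) (x ord0 i) <= coef t * rad n.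
  have cr : 0 <= coef t * rad n by rewrite mulr_ge0//; lra.
  rewrite -(@ler_pXn2r _ 2%N) ?nnegrE ?excess_ge0//; apply: le_trans xr.
  by rewrite /sqdist_cube (bigD1 i)//= lerDl sumr_ge0// => j _; exact: sqr_ge0.
rewrite /excess ge_max => /andP[h _]; nra.
Qed.

Lemma bodyM_boundedE n : exists2 c : R, 0 <= c & forall z : 'rV[R]_n.+1, bodyM R n z -> forall i, `|z ord0 i| <= c.
Proof.
have b0 := @height_gt0 R; have r0 := @rad_gt0 R n.
exists (1 + b + rad n); first by lra.
move=> z; rewrite (snocP z) => /bodyM_bounded[t1 x1] i.
case: (unliftP ord_max i) => [j|] ->; rewrite ?snoc_lift ?snoc_max.
  by have := x1 j; lra.
by rewrite ler_norml; lra.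
Qed.

Lemma bodyM_interior n (tau : R) : -1 < tau < b -> exists2 eps : R, 0 < eps &
  forall z : 'rV[R]_n.+1, (forall i, `|z ord0 i - snoc (0 : 'rV[R]_n) tau ord0 i| <= eps) -> bodyM R n z.
Proof.
move=> tb; have b0 := @height_gt0 R; have b1 : 0 < 1 + b by lra.
(* The first two bounds keep t in [-1, b] with 1 + t >= (1 + tau) / 2; the section then contains the
   cube of half-side (1 + tau) / (4 (1 + b)), the third bound. *)
pose eps := Num.min ((b - tau) / 2) (Num.min ((1 + tau) / 2) ((1 + tau) / (4 * (1 + b)))).
have e1 : eps <= (b - tau) / 2 by rewrite ge_min lexx.
have e2 : eps <= (1 + tau) / 2 by rewrite !ge_min lexx orbT.
have e3 : eps <= (1 + tau) / (4 * (1 + b)) by rewrite !ge_min lexx !orbT.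
have e0 : 0 < eps.
  by rewrite !lt_min; apply/and3P; split; rewrite divr_gt0//; lra.
exists eps => // z zt; rewrite (snocP z); set t := z ord0 ord_max; set x := \row_j _.
have te : `|t - tau| <= eps by have := zt ord_max; rewrite snoc_max.
have xe i : `|x ord0 i| <= eps.
  by have := zt (lift ord_max i); rewrite snoc_lift mxE subr0 mxE.
move: te; rewrite ler_norml => te.
apply/bodyMP; split.
  by rewrite /coef ler_pdivrMr// ler_pdivlMr//; lra.
apply: (@le_trans _ _ 0); last exact: sqr_ge0.
rewrite /sqdist_cube big1// => i _; rewrite /excess max_r ?expr0n//.
have -> : (1 - coef t) / 2 = (1 + t) / (2 * (1 + b)).
  by rewrite /coef; move: b b1 b0 => c c1 c0; field; lra.
rewrite subr_le0 (le_trans (xe i))// (le_trans e3)//.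
rewrite ler_pdivrMr ?mulr_gt0// mulrAC ler_pdivlMr ?mulr_gt0//.
nra.
Qed.

(** The height at which [coef] equals [mean_weight n], hence the last coordinate of g(M_n). *)
Definition ctr n : R := b - (1 + b) * mean_weight n.

Lemma ctr_itv n : (0 < n)%N -> -1 < ctr n < b.
Proof.
by move=> n0; have := @mean_weight_itv R n n0; have := @height_gt0 R; rewrite /ctr; nra.
Qed.

Lemma integrable_last_bodyM n (f : R -> R) : measurable_fun setT (f : measurableTypeR R -> measurableTypeR R) ->
  (exists c, forall t, -1 <= t <= b -> `|f t| <= c) ->
  (vol n.+1).-integrable (bodyM R n) (EFin \o (fun z : 'rV[R]_n.+1 => f (z ord0 ord_max))).
Proof.
move=> mf [c fc]; apply: (@integrable_bounded _ _ _ _ c).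
- exact: measurable_bodyM.
- by rewrite vol_bodyM ltry.
- by apply: measurableT_comp => //; exact: measurable_coord.
- by move=> z; rewrite (snocP z) => /bodyM_bounded[t1 _]; rewrite snoc_max; exact: fc.
Qed.

Lemma Rintegral_last_bodyM n :
  \int[vol n.+1]_(z in bodyM R n) (z ord0 ord_max) = fine (vol n.+1 (bodyM R n)) * ctr n.
Proof.
have b0 := @height_gt0 R; have b1 : 0 < 1 + b by lra.
have := @integral_coef_bodyM R n.
rewrite (@eq_integral _ _ _ _ _ (EFin \o (fun z : 'rV[R]_n.+1 => coef (z ord0 ord_max)))); last first.
  move=> z; rewrite inE (snocP z) => /bodyM_bounded[t1 _]; rewrite /= snoc_max ger0_norm//.
  by rewrite /coef divr_ge0//; lra.
move=> /(congr1 fine); rewrite -[fine (integral _ _ _)]/(Rintegral _ _ _) [RHS]/fine => Ec.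
have ic : (vol n.+1).-integrable (bodyM R n) (EFin \o (fun z : 'rV[R]_n.+1 => coef (z ord0 ord_max))).
  apply: integrable_last_bodyM; first exact: measurable_coef.
  exists 1 => t t1; rewrite ger0_norm /coef ?ler_pdivrMr//; [lra|by apply: divr_ge0; lra].
rewrite (@eq_Rintegral _ _ _ _ _ (fun z : 'rV[R]_n.+1 => b - (1 + b) * coef (z ord0 ord_max))); last first.
  by move=> z _; rewrite /coef; move: b b1 b0 => c c1 c0; field; lra.
rewrite RintegralB; [|exact: measurable_bodyM| |].
- rewrite Rintegral_cst; last exact: measurable_bodyM.
  rewrite RintegralZl; [|exact: measurable_bodyM|exact: ic].
  rewrite Ec vol_bodyM [X in b * fine X]vol_bodyM/= /ctr; move: (n.+1%:R^-1 : R) (total_weight n : R) (mean_weight n : R).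
  by move: b => c N T m; ring.
- by apply: (@integrable_last_bodyM n (fun=> b)) => //; exists `|b|.
- apply: (@integrable_last_bodyM n (fun t => (1 + b) * coef t)).
    by apply: measurable_funM => //; exact: measurable_coef.
  exists (1 + b) => t t1; rewrite normrM (gtr0_norm b1) ler_piMr ?(ltW b1)//.
  rewrite ger0_norm /coef ?ler_pdivrMr//; [lra|by apply: divr_ge0; lra].
Qed.

Lemma centroid_bodyM n : centroid (bodyM R n) = snoc 0 (ctr n).
Proof.
rewrite centroid_symmetric; [|exact: measurable_bodyM|exact: bodyM_symmetric].
congr snoc; rewrite !mxE Rintegral_last_bodyM mulKf// vol_bodyM/= gt_eqF//.
rewrite mulr_gt0 ?total_weight_gt0// divr_gt0//; have := @height_gt0 R; lra.
Qed.

(** The value b = 1 / (e - 1) is the one for which b - (1 + b) / e vanishes. *)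
Lemma cvg_ctr : ctr @ \oo --> (0 : R).
Proof.
have e2 := @expR1_gt2 R.
rewrite (_ : 0 = b - (1 + b) * (expR 1)^-1); last first.
  by rewrite /height; move: (expR 1) e2 => e e2; field; lra.
apply: cvgB; first exact: cvg_cst.
by apply: cvgM; [exact: cvg_cst|exact: cvg_mean_weight].
Qed.

End centroid_M.

(** * The polars of M_n at the points of its axis *)

Section polar_M.
Context {R : realType}.
Implicit Types n : nat.
Local Notation b := (@height R).

Lemma snocB n (x y : 'rV[R]_n) t s : snoc x t - snoc y s = snoc (x - y) (t - s).
Proof. by rewrite -scaleN1r snocZ snocD scaleN1r mulN1r. Qed.

(* When al + be = 1 + b, this is the polar of M_n at the point (0, al - 1). *)
Definition polar_body n (al be : R) : set 'rV[R]_n.+1 := [set z |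
  rad n * Num.sqrt (dotv (\row_j z ord0 (lift ord_max j)) (\row_j z ord0 (lift ord_max j)))
    <= 1 + al * z ord0 ord_max /\
  norm1 (\row_j z ord0 (lift ord_max j)) / 2 <= 1 - be * z ord0 ord_max].

Arguments polar_body n al be : clear implicits.

Lemma polar_bodyP n al be (x : 'rV[R]_n) s : polar_body n al be (snoc x s) <->
  rad n * Num.sqrt (dotv x x) <= 1 + al * s /\ norm1 x / 2 <= 1 - be * s.
Proof.
rewrite /polar_body/= snoc_max (_ : \row_j _ = x)//.
by apply/rowP => j; rewrite mxE snoc_lift.
Qed.

Lemma dotv_le_norm2 n (x u : 'rV[R]_n) (r : R) : 0 < r -> dotv u u <= r ^+ 2 ->
  dotv x u <= r * Num.sqrt (dotv x x).
Proof.
move=> r0 ur; set N := Num.sqrt _.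
have N0 : 0 <= N by exact: sqrtr_ge0.
have N2 : N ^+ 2 = dotv x x by rewrite sqr_sqrtr// dotvv_ge0.
have [N00|N1] := eqVneq N 0.
  have x0 i : x ord0 i = 0.
    apply/eqP; rewrite -sqrf_eq0 eq_le sqr_ge0 andbT.
    have : dotv x x <= 0 by rewrite -N2 N00 expr0n.
    apply: le_trans; rewrite /dotv (bigD1 i)//= expr2 lerDl sumr_ge0// => j _.
    by rewrite -expr2 sqr_ge0.
  by rewrite N00 mulr0 /dotv big1// => i _; rewrite x0 mul0r.
have {N1}Ngt0 : 0 < N by rewrite lt_neqAle eq_sym N1.
have : 0 <= dotv (r *: x + - N *: u) (r *: x + - N *: u) by exact: dotvv_ge0.
rewrite !dotvDl !dotvDr !dotvZl !dotvZr (dotvC u x) -N2 => h.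
have : 2 * (r * N) * dotv x u <= 2 * (r * N) * (r * N) by nra.
by rewrite ler_pM2l// !mulr_gt0.
Qed.

Lemma dotv_le_norm1 n (x y : 'rV[R]_n) : (forall i, `|y ord0 i| <= 1 / 2) ->
  dotv x y <= norm1 x / 2.
Proof.
move=> y1; rewrite /norm1 mulr_suml; apply: ler_sum => i _.
rewrite (le_trans (ler_norm _))// normrM ler_wpM2l//.
by have := y1 i; rewrite mul1r.
Qed.

Lemma polar_atM n (tau : R) : -1 < tau < b ->
  polar_at (bodyM R n) (snoc 0 tau) = polar_body n (1 + tau) (b - tau).
Proof.
move=> tb; have r0 := @rad_gt0 R n.
apply/seteqP; split => z; rewrite (snocP z) polar_bodyP; set x := \row_j _; set s := z ord0 ord_max.
  move=> Hz; split.
    (* The point of K at which the scalar product with x is largest. For x = 0 division by 0 makes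
       it the origin. *)
    pose u : 'rV[R]_n := (rad n / Num.sqrt (dotv x x)) *: x.
    have : bodyM R n (snoc u (-1)).
      rewrite /bodyM /co_lift /=; exists u, 0, 1; split.
      - rewrite bodyKE /eball/= /u dotvZl dotvZr mulrA -expr2.
        have [x0|x0] := eqVneq (dotv x x) 0; first by rewrite x0 mulr0 sqr_ge0.
        by rewrite expr_div_n sqr_sqrtr ?dotvv_ge0// mulfVK.
      - by rewrite bodyLE/= => i; rewrite mxE normr0.
      - by rewrite ler01 lexx.
      - by rewrite scale1r subrr scale0r addr0.
    move=> /Hz; rewrite snocB subr0 dotv_snoc /u dotvZr.
    have [x0|x0] := eqVneq (dotv x x) 0.
      by rewrite x0 sqrtr0 !mulr0; lra.
    have N0 : 0 < Num.sqrt (dotv x x) by rewrite sqrtr_gt0 lt_neqAle eq_sym x0 dotvv_ge0.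
    rewrite -{2}(@sqr_sqrtr _ (dotv x x)) ?dotvv_ge0// expr2 mulrA mulfVK ?gt_eqF//.
    lra.
  (* A point of L at which the scalar product with x is largest; where x has a zero coordinate, so
     does y. *)
  pose y : 'rV[R]_n := \row_i (Num.sg (x ord0 i) / 2).
  have : bodyM R n (snoc y b).
    rewrite /bodyM /co_lift /=; exists 0, y, 0; split.
    - by rewrite bodyKE /eball/= dotv0l sqr_ge0.
    - rewrite bodyLE/= => i; rewrite mxE normrM normr_sg ger0_norm ?invr_ge0//.
      by case: (x ord0 i != 0); rewrite /= ?mul0r//; lra.
    - by rewrite ler01 lexx.
    - by rewrite subr0 scale1r scale0r add0r.
  move=> /Hz; rewrite snocB subr0 dotv_snoc.
  have -> : dotv x y = norm1 x / 2.
    rewrite /norm1 mulr_suml; apply: eq_bigr => i _.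
    have -> : y ord0 i = Num.sg (x ord0 i) / 2 by rewrite /y [LHS]mxE.
    by rewrite normrEsg mulrA (mulrC (x ord0 i)).
  lra.
move=> [h1 h2] w; rewrite /bodyM /co_lift bodyKE bodyLE /= => -[u [y [lam [Ku Ly lam01 ->]]]].
rewrite !snocZ snocD snocB subr0 dotv_snoc dotvDr !dotvZr.
have := dotv_le_norm2 x r0 Ku; have := dotv_le_norm1 x Ly.
rewrite -/b; move: (dotv x y) (dotv x u) (rad n * _) h1 (norm1 x / 2) h2 => xy xu N h1 N1 h2 xyN xuN.
have l1 : 0 <= 1 - lam by lra.
have : lam * xu <= lam * (1 + (1 + tau) * s) by rewrite ler_wpM2l//; lra.
have : (1 - lam) * xy <= (1 - lam) * (1 - (b - tau) * s) by rewrite ler_wpM2l//; lra.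
nra.
Qed.

(** One inclusion is formal. For the converse, the height is controlled by points of the polar on
    the axis, and each section by an explicit separating functional. *)
Lemma bipolar_M n (tau : R) : -1 < tau < b ->
  polar (polar_body n (1 + tau) (b - tau)) = [set y | bodyM R n (y + snoc 0 tau)].
Proof.
move=> tb; have b0 := @height_gt0 R; have r0 := @rad_gt0 R n.
apply/seteqP; split => y; last first.
  move=> /= My z; rewrite -polar_atM// => /(_ _ My).
  by rewrite addrK subr0 dotvC.
move=> Hy; rewrite /= (snocP (y + _)); set x := \row_j _; set t := (y + _) ord0 ord_max.
have yE : y = snoc x (t - tau).
  have : y + snoc 0 tau = snoc x t by rewrite [LHS]snocP.
  move=> /(congr1 (fun z => z - snoc 0 tau)); rewrite addrK => ->.
  by rewrite snocB subr0.
have {}Hy w s : rad n * Num.sqrt (dotv w w) <= 1 + (1 + tau) * s ->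
    norm1 w / 2 <= 1 - (b - tau) * s -> dotv w x + s * (t - tau) <= 1.
  move=> h1 h2; have := Hy (snoc w s); rewrite subr0 polar_bodyP yE dotv_snoc.
  by move=> /(_ (conj h1 h2)); rewrite dotvC mulrC.
have n10 : norm1 (0 : 'rV[R]_n) = 0.
  by rewrite /norm1 big1// => i _; rewrite mxE normr0.
(* The tests are the two points (0, -1 / (1 + tau)) and (0, 1 / (b - tau)) of the polar. *)
have tb' : -1 <= t <= b.
  apply/andP; split.
    have := Hy 0 (- (1 + tau)^-1); rewrite !dotv0l sqrtr0 mulr0 n10 mul0r mulrN mulfV; last by rewrite gt_eqF//; lra.
    rewrite subrr add0r mulNr => /(_ (lexx _)) h.
    have i0 : 0 < (1 + tau)^-1 by rewrite invr_gt0; lra.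
    have : - ((1 + tau)^-1 * (t - tau)) <= 1 by apply: h; rewrite mulrN opprK addr_ge0// mulr_ge0//; lra.
    by rewrite -mulrN ler_pdivrMl ?mulr1; lra.
  have := Hy 0 (b - tau)^-1; rewrite !dotv0l sqrtr0 mulr0 n10 mul0r mulfV; last by rewrite gt_eqF//; lra.
  rewrite subrr add0r => h.
  have i0 : 0 < (b - tau)^-1 by rewrite invr_gt0; lra.
  have : (b - tau)^-1 * (t - tau) <= 1 by apply: h => //; rewrite addr_ge0// mulr_ge0//; lra.
  by rewrite ler_pdivrMl ?mulr1; lra.
have b1 : 0 < 1 + b by lra.
have c01 : 0 <= coef t <= 1 by rewrite /coef ler_pdivrMr// ler_pdivlMr//; lra.
apply/bodyMP; split => //.
set lam := coef t in c01 *.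
have tE : t = b - (1 + b) * lam by rewrite /lam /coef; move: b b1 => c c1; field; lra.
pose h : R := (1 - lam) / 2.
have h0 : 0 <= h by rewrite /h; lra.
have [c [dE _ cd]] := clamp_cube x h0.
set d := x - c in dE cd.
have -> : sqdist_cube h x = dotv d d.
  by apply: eq_bigr => i _; rewrite -dE real_normK ?num_real.
have dx : dotv d x = dotv d d + h * norm1 d.
  rewrite -{1}(subrK c x) -/d dotvDr; congr (_ + _).
  by rewrite /norm1 mulr_sumr; apply: eq_bigr => i _; rewrite mulrC cd.
pose N := Num.sqrt (dotv d d).
have N0 : 0 <= N by exact: sqrtr_ge0.
have N2 : N ^+ 2 = dotv d d by rewrite sqr_sqrtr// dotvv_ge0.
have lr : 0 <= lam * rad n by apply: mulr_ge0; lra.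
rewrite -N2 lerXn2r ?nnegrE//.
rewrite leNgt; apply/negP => Nlam.
have Ngt0 : 0 < N by apply: le_lt_trans Nlam.
pose P := rad n * N; pose Q := norm1 d / 2.
have P0 : 0 < P by rewrite mulr_gt0.
have Q0 : 0 <= Q by rewrite divr_ge0// norm1_ge0.
(* With P and Q the support functions of the two bodies in the direction d,
   (d, s) / k is the point of the polar separating (x, t) from M_n. *)
pose k := ((b - tau) * P + (1 + tau) * Q) / (1 + b).
pose s := (P - Q) / (1 + b).
have k0 : 0 < k.
  by apply: divr_gt0 => //; apply: ltr_pwDl; [apply: mulr_gt0|apply: mulr_ge0] => //; lra.
have e1 : P = k + (1 + tau) * s by rewrite /k /s; move: b b1 => c' c1; field; lra.
have e2 : Q = k - (b - tau) * s by rewrite /k /s; move: b b1 => c' c1; field; lra.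
have := Hy (k^-1 *: d) (k^-1 * s); rewrite !dotvZl dotvZr norm1Z gtr0_norm ?invr_gt0//.
rewrite (_ : Num.sqrt (k^-1 * (k^-1 * dotv d d)) = k^-1 * N); last first.
  by rewrite mulrA -expr2 sqrtrM ?sqr_ge0// sqrtr_sqr gtr0_norm// invr_gt0.
have kV : k^-1 * k = 1 by rewrite mulVf// gt_eqF.
have f1 : rad n * (k^-1 * N) <= 1 + (1 + tau) * (k^-1 * s).
  by rewrite mulrCA -/P e1 mulrDr kV (mulrCA k^-1).
have f2 : k^-1 * norm1 d / 2 <= 1 - (b - tau) * (k^-1 * s).
  by rewrite -mulrA -/Q e2 mulrBr kV (mulrCA k^-1).
(* The left side becomes N^2 + k - lam r N, so the inequality would force N <= lam r. *)
move=> /(_ f1 f2); rewrite -mulrA -mulrDr ler_pdivrMl// mulr1 dx -N2.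
rewrite (_ : h * norm1 d = (1 - lam) * Q); last by rewrite /h /Q; field.
have -> : t - tau = (b - tau) - (1 + b) * lam by rewrite tE; ring.
have -> : s * (b - tau - (1 + b) * lam) = k - Q - lam * (P - Q).
  have -> : P - Q = (1 + b) * s by rewrite /s; move: b b1 => c' c1; field; lra.
  rewrite {1}e2; ring.
rewrite /P; nra.
Qed.

End polar_M.
Arguments polar_body {R} n al be.

(** * The Santalo point *)

Section santalo.
Context {R : realType}.
Variables (n : nat) (C P : set 'rV[R]_n) (x : 'rV[R]_n) (c eps : R).
Hypothesis PC : P = polar C.
Hypothesis C0 : C 0.
Hypothesis Cx : C x.
Hypothesis mP : measurable P.
Hypothesis Pc : forall y : 'rV[R]_n, P y -> forall i, `|y ord0 i| <= c.
Hypothesis eps0 : 0 < eps.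
Hypothesis Peps : forall y : 'rV[R]_n, (forall i, `|y ord0 i| <= eps) -> P y.
Hypothesis P0 : \int[vol n]_(y in P) dotv x y = 0.

Let v := dotv x.

Let PP y : P y <-> forall z, C z -> dotv y z <= 1.
Proof.
by rewrite PC /polar /polar_at/=; split => H z /H; rewrite subr0.
Qed.

Let mv : measurable_fun setT (v : 'rV[R]_n -> measurableTypeR R).
Proof. exact: measurable_dotv. Qed.

(* [cone t] is the dilate by t of the polar at x. *)
Let cone (t : R) : set 'rV[R]_n := [set y | 0 < t + v y /\ P ((t + v y)^-1 *: y)].

Let polar_cone : polar_at C x = cone 1.
Proof.
apply/seteqP; split => y; rewrite /polar_at/cone/=; last first.
  move=> [s0 /PP h] z Cz; have := h z Cz; rewrite dotvZl ler_pdivrMl// mulr1.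
  by rewrite -scaleN1r dotvDr dotvZr (dotvC y x) -/(v y); lra.
move=> h; have {}h z : C z -> dotv y z <= 1 + v y.
  by move=> /h; rewrite -scaleN1r dotvDr dotvZr (dotvC y x) -/(v y); lra.
have s0 : 0 <= 1 + v y by have := h _ C0; rewrite dotv0r.
suff s1 : 0 < 1 + v y.
  by split => //; apply/PP => z /h; rewrite dotvZl ler_pdivrMl// mulr1.
rewrite lt_neqAle s0 andbT; apply/negP => /eqP sE.
(* If 1 + <x, y> were 0, the whole ray through y would lie in the bounded set P, so y would be 0 and
   1 + <x, y> would be 1. *)
have Ply (l : R) : 0 < l -> P (l *: y).
  by move=> l0; apply/PP => z /h; rewrite -sE dotvZl => ?; rewrite (@le_trans _ _ 0)// pmulr_rle0.
suff y0 : y = 0 by move: sE; rewrite y0 /v dotv0r addr0 => /eqP; rewrite eq_sym oner_eq0.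
apply/rowP => i; rewrite mxE; apply/eqP; rewrite -normr_eq0.
apply/negPn/negP => yi.
have yi0 : 0 < `|y ord0 i| by rewrite lt_neqAle eq_sym yi normr_ge0.
have l0 : 0 < (`|c| + 1) / `|y ord0 i| by rewrite divr_gt0// ltr_wpDl.
have := Pc (Ply _ l0) i; rewrite mxE normrM (gtr0_norm l0) mulfVK ?gt_eqF//.
by have := ler_norm c; lra.
Qed.

Let coneZ (t : R) : 0 < t -> cone t = [set y | cone 1 (t^-1 *: y)].
Proof.
move=> t0; rewrite /cone /v; apply/seteqP; split => y /=; rewrite dotvZr;
  have -> : 1 + t^-1 * dotv x y = t^-1 * (t + dotv x y) by rewrite mulrDr mulVf ?gt_eqF.
  by move=> [s0 Ps]; rewrite mulr_gt0 ?invr_gt0// invfM invrK scalerA mulrAC mulfV ?gt_eqF// mul1r.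
by rewrite pmulr_rgt0 ?invr_gt0// invfM invrK scalerA mulrAC mulfV ?gt_eqF// mul1r.
Qed.

Let cone_neg (t : R) : t < 0 -> cone t = set0.
Proof.
move=> t0; apply/seteqP; split => y //= -[s0 /PP h].
by have := h x Cx; rewrite dotvZl ler_pdivrMl// mulr1 dotvC -/(v y); lra.
Qed.

Let T : Type := (measurableTypeR R * 'rV[R]_n)%type.

(* The volume of the truncated cone [slab] is read off its sections, which are
   dilates of the polar at x; the shear t = u + <x, y> followed by the dilation
   y -> u y turns it into an integral over P of integrals along rays. *)
Let slab : set T := [set p | p.1 <= 1 /\ cone p.1 p.2].

Let sheared : set T := [set p | p.1 - v p.2 <= 1 /\ (0 < p.1 /\ P (p.1^-1 *: p.2))].

Let straight : set T := [set p | p.1 * (1 - v p.2) <= 1 /\ (0 < p.1 /\ P p.2)].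

Let mv2 : measurable_fun setT (fun p : T => v p.2 : measurableTypeR R).
Proof. exact: (measurableT_comp mv measurable_snd). Qed.

Let m1 : measurable_fun setT (fun p : T => p.1).
Proof. exact: measurable_fst. Qed.

Let measurable_dilate (f : T -> measurableTypeR R) : measurable_fun setT f ->
  measurable [set p | 0 < f p /\ P ((f p)^-1 *: p.2)].
Proof.
move=> mf; rewrite (_ : [set p | _] = [set p | 0 < f p] `&` [set p | P (f p `^ (-1) *: p.2)]); last first.
  have E p : 0 < f p -> f p `^ (-1) = (f p)^-1 by move=> /ltW/powR_inv1.
  by apply/seteqP; split => p [f0 h]; split => //; move: h; rewrite /= E.
apply: measurableI.
  have mfg := measurable_fun_ltr (measurable_cst (0 : R)) mf.
  by rewrite -[X in measurable X]setTI; exact: (mfg measurableT [set true]).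
rewrite -[X in measurable X]setTI.
suff : measurable_fun setT (fun p : T => f p `^ (-1) *: p.2) by apply.
apply: measurable_fun_coordP => i; under eq_fun do rewrite mxE.
apply: measurable_funM.
  exact: (measurableT_comp (measurable_powR (-1)) mf).
exact: (measurableT_comp (@measurable_coord R n i) measurable_snd).
Qed.

Let mslab : measurable slab.
Proof.
apply: (@measurableI _ _ [set p : T | p.1 <= 1] [set p : T | cone p.1 p.2]).
  by apply: measurable_le_set => //; exact: measurable_cst.
apply: measurable_dilate; exact: measurable_funD.
Qed.

Let msheared : measurable sheared.
Proof.
apply: (@measurableI _ _ [set p : T | p.1 - v p.2 <= 1]); last exact: measurable_dilate.
by apply: measurable_le_set; [exact: measurable_funB|exact: measurable_cst].
Qed.

Let mstraight : measurable straight.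
Proof.
apply: (@measurableI _ _ [set p : T | p.1 * (1 - v p.2) <= 1]).
  apply: measurable_le_set; last exact: measurable_cst.
  by apply: measurable_funM => //; exact: measurable_funB.
apply: (@measurableI _ _ [set p : T | 0 < p.1] [set p : T | P p.2]).
  have mfg := measurable_fun_ltr (measurable_cst (0 : R)) m1.
  by rewrite -[X in measurable X]setTI; exact: (mfg measurableT [set true]).
by rewrite -[X in measurable X]setTI; exact: measurable_snd.
Qed.

Let tonelli (f : T -> \bar R) : measurable_fun setT f -> (forall p, 0 <= f p)%E ->
  (\int[mu]_t \int[vol n]_y f (t, y) = \int[vol n]_y \int[mu]_t f (t, y))%E.
Proof. by move=> mf f0; exact: (@fubini_tonelli _ _ _ _ _ mu (vol n) f mf f0). Qed.

Let meind (A : set T) : measurable A -> measurable_fun setT (fun p => (\1_A p)%:E : \bar R).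
Proof. by move=> mA; apply/measurable_EFinP; exact: measurable_indic. Qed.

Let mcone (t : R) : measurable (cone t).
Proof.
have mpair : measurable_fun setT (fun y : 'rV[R]_n => (t, y) : T).
  exact: measurable_pair1.
have md : measurable [set p : T | cone p.1 p.2].
  by apply: measurable_dilate; exact: measurable_funD.
by have := mpair measurableT _ md; rewrite setTI.
Qed.

(** Between 0 and 1 the section at t has volume w t^n; below 0 it is empty because x belongs to
    C. *)
Let slab_section (w : R) : vol n (polar_at C x) = w%:E ->
  (\int[mu]_t \int[vol n]_y (\1_slab (t, y))%:E = (w / n.+1%:R)%:E)%E.
Proof.
move=> wE.
have sec (t : R) : (\int[vol n]_y (\1_slab (t, y))%:E)%E =
    vol n [set y | t <= 1 /\ cone t y].
  rewrite vol_indic//.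
  have [t1|t1] := leP t 1.
    by rewrite (_ : [set y | _] = cone t) ?mcone//; apply/seteqP; split => y //= -[].
  by rewrite (_ : [set y | _] = set0)//; apply/seteqP; split => y //= -[].
rewrite (integral_support (g := fun t => w * (t ^+ n * (1 - t) ^+ 0)) (a := 0) (b := 1)).
- rewrite ge0_integralZl_real//.
  + by rewrite integral_beta addn0 fact0 mulr1 factS natrM invfM mulrCA mulfV ?mulr1// pnatr_eq0 -lt0n fact_gt0.
  + by rewrite -lee_fin -wE.
  + apply: measurable_funM; first exact: measurable_funX.
    by apply: measurable_funX; apply: measurable_funB.
  + by move=> t; rewrite /= in_itv/= expr0 mulr1 => /andP[t0 _]; rewrite exprn_ge0.
- apply: (@measurable_fun_fubini_tonelli_F _ _ _ _ _ (vol n) (fun p => (\1_slab p)%:E)) => //.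
  exact: meind.
- move=> t t01; rewrite sec; have [t0|t0] := ltP t 0.
    rewrite cone_neg// (_ : [set y | _] = set0) ?measure0//.
    by apply/seteqP; split => y //= -[].
  rewrite (_ : [set y | _] = set0) ?measure0//; apply/seteqP; split => y //= -[t1 _].
  by apply: t01; rewrite t0.
- move=> t t01; have t0 : 0 < t by lra.
  rewrite sec (_ : [set y | _] = [set y | cone 1 (t^-1 *: y)]); last first.
    rewrite -coneZ//; apply/seteqP; split => y /=; first by case.
    by move=> ?; split => //; lra.
  have tV : t^-1 != 0 by rewrite invr_eq0 gt_eqF.
  have := wE; rewrite polar_cone (vol_scale tV (mcone 1)) ger0_norm ?invr_ge0 ?(ltW t0)//.
  case: (vol n _) => [r| |].
  + rewrite -EFinM => -[<-]; congr EFin.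
    by rewrite expr0 mulr1 exprVn mulrC mulVKf// expf_neq0// gt_eqF.
  + by rewrite gt0_muley ?lte_fin ?exprn_gt0 ?invr_gt0.
  + by rewrite gt0_muleNy ?lte_fin ?exprn_gt0 ?invr_gt0.
Qed.

Let slab_straight :
  (\int[mu]_t \int[vol n]_y (\1_slab (t, y))%:E =
   \int[vol n]_y \int[mu]_u (`|u| ^+ n * \1_straight (u, y))%:E)%E.
Proof.
rewrite (tonelli (f := fun p => (\1_slab p)%:E)); [|exact: meind|by []].
transitivity (\int[vol n]_y \int[mu]_u (\1_sheared (u, y))%:E)%E.
  apply: eq_integral => y _.
  have my : measurable_fun setT (fun t : measurableTypeR R => (\1_slab (t, y))%:E : \bar R).
    exact: (measurableT_comp (meind mslab) (measurable_pair2 y)).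
  rewrite (integral_shift (- v y) my)//; apply: eq_integral => u _.
  congr EFin; rewrite !indicE; congr (_%:R); congr nat_of_bool.
  by apply/idP/idP; rewrite !inE /slab /sheared /cone/= subrK.
(* The order of integration changes again: the shear acts on t for fixed y, the dilation on y for
   fixed u. *)
rewrite -(tonelli (f := fun p => (\1_sheared p)%:E)); [|exact: meind|by []].
rewrite -(tonelli (f := fun p => (`|p.1| ^+ n * \1_straight p)%:E)); last 2 first.
- apply/measurable_EFinP; apply: measurable_funM; last exact: measurable_indic.
  by apply: measurable_funX; exact: measurableT_comp.
- by move=> p; rewrite lee_fin mulr_ge0// exprn_ge0.
apply: eq_integral => u _ /=.
have mu1 (A : set T) : measurable A -> measurable_fun setT (fun y : 'rV[R]_n => (\1_A (u, y))%:E : \bar R).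
  by move=> mA; exact: (measurableT_comp (meind mA) (measurable_pair1 u)).
have [u0|u0] := ltP 0 u; last first.
  rewrite !integral0_eq// => y _.
    rewrite indicE memNset ?mulr0//= => -[_ [+ _]]; rewrite /=; lra.
  by rewrite indicE memNset//= => -[_ [+ _]]; rewrite /=; lra.
rewrite (integral_scale (lt0r_neq0 u0) (mu1 _ msheared))//.
rewrite ge0_integralZl_real// ?exprn_ge0//; last 1 first.
- by apply/measurable_EFinP; exact: mu1.
congr (_ * _)%E; apply: eq_integral => y _.
congr EFin; rewrite !indicE; congr (_%:R); congr nat_of_bool.
rewrite /sheared /straight /v; apply/idP/idP; rewrite !inE/= dotvZr scalerA mulVf ?gt_eqF// scale1r;
  by rewrite mulrBr mulr1.
Qed.

Let vol_P_lty : (vol n P < +oo)%E.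
Proof. by apply: (@vol_lty _ _ `|c|) => // y Py i; rewrite (le_trans (Pc Py i))// ler_norm. Qed.

(** The section of [straight] over y consists of the u > 0 with u (1 - a) <= 1, and W is any number
    such that ]0, W[ lies in it. This form also covers a >= 1, where that section is unbounded. *)
Let integral_ray (W a : R) (y : 'rV[R]_n) : 0 <= W -> W * (1 - a) <= 1 -> v y = a -> P y ->
  ((W ^+ n.+1 / n.+1%:R)%:E <= \int[mu]_u (`|u| ^+ n * \1_straight (u, y))%:E)%E.
Proof.
move=> W0 Wa vy Py.
have my : measurable_fun setT (fun u : measurableTypeR R => (`|u| ^+ n * \1_straight (u, y))%:E : \bar R).
  apply/measurable_EFinP; apply: measurable_funM; first exact: measurable_funX.
  by apply/measurable_EFinP; exact: (measurableT_comp (meind mstraight) (measurable_pair2 y)).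
have [->|W1] := eqVneq W 0.
  by rewrite expr0n mul0r; apply: integral_ge0 => u _; rewrite lee_fin mulr_ge0// exprn_ge0.
have {W1}W0' : 0 < W by rewrite lt_neqAle eq_sym W1.
have mX : measurable_fun setT (fun u : measurableTypeR R => (`|u| ^+ n)%:E : \bar R).
  by apply/measurable_EFinP; exact: measurable_funX.
have -> : (W ^+ n.+1 / n.+1%:R)%:E = (\int[mu]_(u in `[0%R, W]) (`|u| ^+ n)%:E)%E.
  rewrite (integral_affine_itv W0' mX); last by move=> u; rewrite lee_fin exprn_ge0.
  rewrite subr0 (eq_integral (fun s : measurableTypeR R => (W ^+ n * (s ^+ n * (1 - s) ^+ 0))%:E)); last first.
    move=> s; rewrite inE/= in_itv/= => /andP[s0 _].
    by rewrite add0r normrM !ger0_norm// exprMn expr0 mulr1.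
  rewrite ge0_integralZl_real//.
  - rewrite integral_beta addn0 fact0 mulr1 -!EFinM factS natrM exprS; congr EFin.
    have : n`!%:R != 0 :> R by rewrite pnatr_eq0 -lt0n fact_gt0.
    have : n.+1%:R != 0 :> R by rewrite pnatr_eq0.
    move: (n`!%:R : R) (n.+1%:R : R) (W ^+ n) => F N Z N0 F0; field; exact/andP.
  - by rewrite exprn_ge0.
  - apply: measurable_funM; first exact: measurable_funX.
    by apply: measurable_funX; apply: measurable_funB.
  - by move=> s; rewrite /= in_itv/= expr0 mulr1 => /andP[s0 _]; rewrite exprn_ge0.
rewrite integral_itv_bndoo; last exact: measurable_funTS.
rewrite integral_mkcond; apply: ge0_le_integral => //.
- by move=> u _; rewrite patchE; case: ifPn => //; rewrite lee_fin exprn_ge0.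
- exact/(measurable_restrictT _ _).1/measurable_funTS.
move=> u _; rewrite patchE; case: ifPn; last by rewrite lee_fin mulr_ge0// exprn_ge0.
rewrite inE/= in_itv/= => /andP[u0 uW].
rewrite indicE mem_set ?mulr1// /straight/= vy; split => //.
have [a1|a1] := leP a 1; last by nra.
by rewrite (le_trans _ Wa)// ler_wpM2r ?(ltW uW)//; lra.
Qed.

Lemma vol_polar_lt : x != 0 -> (vol n P < vol n (polar_at C x))%E.
Proof.
move=> x0.
have [wfin|] := boolP (vol n (polar_at C x) \is a fin_num); last first.
  by rewrite ge0_fin_numE// -leNgt leye_eq => /eqP ->.
pose w := fine (vol n (polar_at C x)).
have wE : vol n (polar_at C x) = w%:E by rewrite fineK.
pose X := norm1 x.
have X0 : 0 < X.
  rewrite lt_neqAle norm1_ge0 andbT eq_sym; apply: contra x0 => /eqP X0.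
  apply/eqP/rowP => i; rewrite mxE; apply/eqP; rewrite -normr_eq0 eq_le normr_ge0 andbT.
  by rewrite -X0 /X /norm1 (bigD1 i)//= lerDl sumr_ge0.
have xX i : `|x ord0 i| <= X by rewrite /X /norm1 (bigD1 i)//= lerDl sumr_ge0.
have D0 : 0 < dotv x x.
  rewrite lt_neqAle dotvv_ge0 andbT eq_sym; apply: contra x0 => /eqP D0.
  apply/eqP/rowP => i; rewrite mxE; apply/eqP; rewrite -sqrf_eq0 eq_le sqr_ge0 andbT -D0.
  rewrite /dotv (bigD1 i)//= -expr2 lerDl sumr_ge0// => j _; by rewrite -expr2 sqr_ge0.
(* The gain is localised near eta x. This choice keeps eta x within eps / 2 of 0, and rho is small
   enough for the box of radius rho around it to stay in P and in the half-space where <x, y> is at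
   least half its value at eta x. *)
pose eta := eps / (2 * X).
have eta0 : 0 < eta by rewrite divr_gt0// mulr_gt0.
pose rho := Num.min (eps / 2) (eta * dotv x x / (2 * X)).
have r1 : rho <= eps / 2 by rewrite ge_min lexx.
have r2 : rho <= eta * dotv x x / (2 * X) by rewrite ge_min lexx orbT.
have r0 : 0 < rho.
  rewrite lt_min; apply/andP; split; first exact: divr_gt0.
  by apply: divr_gt0; exact: mulr_gt0.
pose v0 := eta * dotv x x / 2.
have v0_gt0 : 0 < v0 by rewrite divr_gt0// mulr_gt0.
pose B : set 'rV[R]_n := [set y | v0 <= v y].
have mB : measurable B by apply: measurable_le_set => //; exact: measurable_cst.
have PB : (0 < vol n (P `&` B))%E.
  apply: (@vol_gt0 _ _ (eta *: x) rho); [exact: measurableI|by []|].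
  move=> y yx; split.
    apply: Peps => i; have := yx i; rewrite mxE.
    have : `|eta * x ord0 i| <= eps / 2.
      rewrite normrM (gtr0_norm eta0) (le_trans (ler_wpM2l (ltW eta0) (xX i)))//.
      by rewrite /eta invfM mulrA mulfVK// gt_eqF.
    by have := ler_normD (y ord0 i - eta * x ord0 i) (eta * x ord0 i); rewrite subrK; lra.
  rewrite /B/= /v -(subrK (eta *: x) y) dotvDr dotvZr.
  have : `|dotv x (y - eta *: x)| <= X * rho.
    rewrite (le_trans (ler_norm_sum _ _ _))// /X /norm1 mulr_suml; apply: ler_sum => i _.
    by rewrite normrM ler_wpM2l//; have := yx i; rewrite !mxE.
  rewrite ler_norml => /andP[h _].
  have : X * rho <= v0.
    rewrite mulrC -ler_pdivlMr// (le_trans r2)// /v0 invfM mulrA; lra.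
  by move: h; rewrite /v0; move: (eta * dotv x x) => E; lra.
(* The affine minorant plus a gain on B: as <x, y> has integral 0 over P, the integral of l is vol P
   plus v0^2 times the positive volume of the intersection of P and B. *)
pose l (y : 'rV[R]_n) : R := 1 + n.+1%:R * v y + v0 ^+ 2 * \1_B y.
have ml : measurable_fun setT (l : 'rV[R]_n -> measurableTypeR R).
  apply: measurable_funD; first apply: measurable_funD => //; first exact: measurable_funM.
  by apply: measurable_funM => //; exact: measurable_indic.
(* The ray integrals are nonnegative, so they can be compared with the positive part of l by
   monotonicity of nonnegative integrals. *)
pose lp y := Num.max (l y) 0.
have mlp : measurable_fun setT (lp : 'rV[R]_n -> measurableTypeR R).
  by apply: measurable_maxr => //; exact: measurable_cst.
have vb y : P y -> `|v y| <= X * `|c|.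
  move=> Py; rewrite (le_trans (ler_norm_sum _ _ _))// /X /norm1 mulr_suml; apply: ler_sum => i _.
  by rewrite normrM ler_wpM2l// (le_trans (Pc Py i))// ler_norm.
have iv : (vol n).-integrable P (EFin \o v).
  by apply: (@integrable_bounded _ _ _ _ (X * `|c|)).
have i1 (A : set 'rV[R]_n) : measurable A -> (vol n).-integrable P (EFin \o (\1_A : _ -> R)).
  move=> mA; apply: (@integrable_bounded _ _ _ _ 1) => //.
  by move=> y _; rewrite indicE; case: (_ \in _); rewrite /= ?normr1 ?normr0.
have il : (vol n).-integrable P (EFin \o l).
  apply: (@integrable_bounded _ _ _ _ (1 + n.+1%:R * (X * `|c|) + v0 ^+ 2)) => //.
  move=> y Py; rewrite (le_trans (ler_normD _ _))// lerD//; last first.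
    rewrite normrM ger0_norm ?sqr_ge0// ler_piMr ?sqr_ge0// indicE.
    by case: (_ \in _); rewrite /= ?normr1 ?normr0.
  by rewrite (le_trans (ler_normD _ _))// normr1 lerD2l normrM ger0_norm// ler_wpM2l// vb.
have ilp : (vol n).-integrable P (EFin \o lp).
  apply: (le_integrable mP _ _ il); first by apply: measurable_funTS; exact/measurable_EFinP.
  move=> y _; rewrite /= lee_fin /lp; case: (leP (l y) 0) => h; rewrite ?normr0//.
have El : \int[vol n]_(y in P) l y = fine (vol n P) + v0 ^+ 2 * fine (vol n (P `&` B)).
  have i1' : (vol n).-integrable P (EFin \o (fun=> 1 : R)).
    by apply: (@integrable_bounded _ _ _ _ 1) => // y _; rewrite normr1.
  have iNv : (vol n).-integrable P (EFin \o (fun y => n.+1%:R * v y)).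
    exact: (integrableZl mP n.+1%:R iv).
  have iB : (vol n).-integrable P (EFin \o (fun y => v0 ^+ 2 * (\1_B y : R))).
    exact: (integrableZl mP (v0 ^+ 2) (i1 _ mB)).
  have i1N : (vol n).-integrable P (EFin \o (fun y => 1 + n.+1%:R * v y)).
    exact: (integrableD mP i1' iNv).
  rewrite /l (RintegralD mP i1N iB) (RintegralD mP i1' iNv).
  rewrite (RintegralZl _ mP iv) (RintegralZl _ mP (i1 _ mB)) P0 mulr0 addr0.
  by rewrite Rintegral_cst// mul1r /Rintegral integral_indic// setIC.
have wl : \int[vol n]_(y in P) lp y <= w.
  have N0 : 0 < n.+1%:R :> R by [].
  have ilpN : (vol n).-integrable P (EFin \o (fun y => n.+1%:R^-1 * lp y)).
    exact: (integrableZl mP n.+1%:R^-1 ilp).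
  rewrite -(ler_pM2l (x := n.+1%:R^-1)) ?invr_gt0// -(RintegralZl _ mP ilp) (mulrC _ w).
  rewrite -lee_fin -(slab_section wE) slab_straight fineK; last exact: integrable_fin_num ilpN.
  rewrite integral_mkcond; apply: ge0_le_integral => //.
  - move=> y _; rewrite patchE; case: ifPn => // _; rewrite /= lee_fin.
    by apply: mulr_ge0; rewrite ?invr_ge0// le_max lexx orbT.
  - apply/(measurable_restrictT _ _).1 => //; apply: measurable_funTS.
    by apply/measurable_EFinP; exact: measurable_funM.
  - apply: (@measurable_fun_fubini_tonelli_G _ _ _ _ _ mu (fun p : T => (`|p.1| ^+ n * \1_straight p)%:E)).
    + apply/measurable_EFinP; apply: measurable_funM; last exact: measurable_indic.
      by apply: measurable_funX; exact: measurableT_comp.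
    + by move=> p; rewrite lee_fin mulr_ge0// exprn_ge0.
  have ray0 y : (0 <= \int[mu]_u (`|u| ^+ n * \1_straight (u, y))%:E)%E.
    by apply: integral_ge0 => u _; rewrite lee_fin mulr_ge0// exprn_ge0.
  move=> y _; rewrite patchE; case: ifPn => [|_]; last exact: ray0.
  rewrite inE => Py; rewrite /= /lp; have [ly|ly] := leP (l y) 0; first by rewrite mulr0 ray0.
  have N1 : 1 <= n.+1%:R :> R by rewrite ler1n.
  move: ly; rewrite /l indicE; have [yB|yB] := boolP (y \in B).
    move=> _; have vy : v0 <= v y by rewrite inE in yB.
    have vy0 := le_trans (ltW v0_gt0) vy.
    (* W = 1 + v + v^2 is admissible because W (1 - v) = 1 - v^3. By Bernoulli, W^(n+1) is at least
       1 + (n + 1) (v + v^2), which exceeds the affine function by at least v0^2. *)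
    apply: (le_trans _ (@integral_ray (1 + (v y + v y ^+ 2)) (v y) y _ _ erefl Py)).
    - rewrite lee_fin mulrC ler_pM2r ?invr_gt0// mulr1.
      apply: le_trans (bernoulli_ineq _ _); last by nra.
      by have : v0 ^+ 2 <= v y ^+ 2 by [rewrite lerXn2r// nnegrE ltW]; nra.
    - by nra.
    - have -> : (1 + (v y + v y ^+ 2)) * (1 - v y) = 1 - v y ^+ 3 by ring.
      by rewrite gerBl exprn_ge0.
  rewrite mulr0 addr0 => ly.
  (* Where l is positive, (n + 1) v > -1, so that W = 1 + v is nonnegative. *)
  have vy : - 1 <= v y by nra.
  apply: (le_trans _ (@integral_ray (1 + v y) (v y) y _ _ erefl Py)).
  - by rewrite lee_fin mulrC ler_pM2r ?invr_gt0// bernoulli_ineq.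
  - by lra.
  - have -> : (1 + v y) * (1 - v y) = 1 - v y ^+ 2 by ring.
    by rewrite gerBl sqr_ge0.
have PBfin : vol n (P `&` B) \is a fin_num.
  rewrite ge0_fin_numE//; apply: le_lt_trans vol_P_lty.
  by apply: le_measure; rewrite ?inE//; exact: measurableI.
rewrite wE -(fineK (_ : vol n P \is a fin_num)) ?ge0_fin_numE// lte_fin.
rewrite (lt_le_trans _ wl)//.
apply: (@lt_le_trans _ _ (\int[vol n]_(y in P) l y)).
  rewrite El ltrDl mulr_gt0 ?exprn_gt0// -lte_fin fineK//.
apply: le_Rintegral => //.
by move=> y _; rewrite /lp le_max lexx.
Qed.

End santalo.

Lemma is_santalo_point0 (R : realType) (n : nat) (C : set 'rV[R]_n) (c eps : R) :
  C 0 -> (0 < vol n C < +oo)%E -> measurable (polar C) ->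
  (forall y : 'rV[R]_n, polar C y -> forall i, `|y ord0 i| <= c) ->
  0 < eps -> (forall y : 'rV[R]_n, (forall i, `|y ord0 i| <= eps) -> polar C y) ->
  (forall x, \int[vol n]_(y in polar C) dotv x y = 0) ->
  is_santalo_point C 0.
Proof.
move=> C0 /andP[vC0 vCoo] mP Pc eps0 Peps P0.
have vCfin : vol n C \is a fin_num by rewrite ge0_fin_numE.
have lt0 x : C x -> x != 0 -> (volume_product C 0 < volume_product C x)%E.
  move=> Cx x0; rewrite /volume_product lte_pmul2l//.
  exact: (vol_polar_lt erefl C0 Cx mP Pc eps0 Peps (P0 x) x0).
split.
  split => // y Cy; have [->//|y0] := eqVneq y 0.
  exact/ltW/lt0.
move=> x [Cx xmin]; apply/eqP/negPn/negP => x0.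
by have := lt0 _ Cx x0; rewrite ltNge xmin.
Qed.

(** * The polar bodies: size, symmetries and Santalo point *)

Section polar_body.
Context {R : realType}.
Implicit Types n : nat.
Local Notation b := (@height R).

Lemma Rintegral_change n (phi : 'rV[R]_n -> 'rV[R]_n) (D : set 'rV[R]_n) (f : 'rV[R]_n -> R) :
  (forall h : 'rV[R]_n -> \bar R, measurable_fun setT h -> (forall z, 0 <= h z)%E ->
    (\int[vol n]_z h z = \int[vol n]_z h (phi z))%E) ->
  measurable D -> measurable_fun setT f ->
  \int[vol n]_(z in D) f z = \int[vol n]_(z in phi @^-1` D) f (phi z).
Proof.
move=> hphi mD mf.
have change (h : 'rV[R]_n -> \bar R) : measurable_fun setT h -> (forall z, 0 <= h z)%E ->
    (\int[vol n]_(z in D) h z = \int[vol n]_(z in phi @^-1` D) h (phi z))%E.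
  move=> mh h0; rewrite integral_mkcond hphi; last 2 first.
  - by apply/(measurable_restrictT _ _).1 => //; exact: measurable_funTS.
  - by move=> z; rewrite patchE; case: ifPn.
  rewrite [RHS]integral_mkcond; apply: eq_integral => z _; rewrite !patchE.
  by congr (if _ then _ else _); apply/idP/idP; rewrite !inE.
rewrite /Rintegral integralE [in RHS]integralE.
have mEf : measurable_fun setT (EFin \o f) by exact/measurable_EFinP.
congr (fine (_ - _)); rewrite change.
- by apply: eq_integral => z _; rewrite !funeposE.
- exact: measurable_funepos.
- exact: funepos_ge0.
- by apply: eq_integral => z _; rewrite !funenegE.
- exact: measurable_funeneg.
- exact: funeneg_ge0.
Qed.

Definition flip n (z : 'rV[R]_n.+1) : 'rV[R]_n.+1 :=
  snoc (\row_j z ord0 (lift ord_max j)) (- z ord0 ord_max).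

Lemma flip_snoc n (x : 'rV[R]_n) t : flip (snoc x t) = snoc x (- t).
Proof.
by rewrite /flip snoc_max; congr snoc; apply/rowP => j; rewrite mxE snoc_lift.
Qed.

Lemma measurable_flip n : measurable_fun setT (@flip n).
Proof.
apply: measurable_fun_coordP => i; case: (unliftP ord_max i) => [j|] ->.
  by under eq_fun do rewrite snoc_lift mxE; exact: measurable_coord.
under eq_fun do rewrite snoc_max.
by apply: measurableT_comp => //; exact: measurable_coord.
Qed.

Lemma integral_flip n (f : 'rV[R]_n.+1 -> \bar R) :
  measurable_fun setT f -> (forall z, 0 <= f z)%E ->
  (\int[vol n.+1]_z f z = \int[vol n.+1]_z f (flip z))%E.
Proof.
move=> mf f0; have mff := measurableT_comp mf (@measurable_flip n).
rewrite (integral_snoc mf f0) (integral_snoc mff (fun=> f0 _)).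
rewrite (integral_oppr (measurable_integral_snoc mf f0)); last first.
  by move=> t; exact: integral_ge0.
by apply: eq_integral => t _; apply: eq_integral => x _; rewrite /= flip_snoc.
Qed.

(** Reversing the last axis reduces lower bounds on the centroid to upper bounds. *)
Lemma centroid_flip n (D : set 'rV[R]_n.+1) (c : R) : measurable D -> 0 <= c ->
  (forall z : 'rV[R]_n.+1, D z -> forall i, `|z ord0 i| <= c) ->
  centroid (@flip n @^-1` D) ord0 ord_max = - centroid D ord0 ord_max.
Proof.
move=> mD c0 Dc; have ml := @measurable_coord R n.+1 ord_max.
have mD' : measurable (@flip n @^-1` D).
  by rewrite -[X in measurable X]setTI; exact: measurable_flip.
have -> : @flip n @^-1` D = [set z | D (flip z)] by [].
rewrite !mxE (_ : vol n.+1 [set z | D (flip z)] = vol n.+1 D); last first.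
  rewrite [RHS]vol_indic// integral_flip; [|exact: measurable_eindic|by []].
  by rewrite vol_indic.
rewrite -mulrN; congr (_ * _).
have -> : \int[vol n.+1]_(z in [set z | D (flip z)]) (z ord0 ord_max) =
    \int[vol n.+1]_(z in D) (-1 * z ord0 ord_max).
  rewrite (Rintegral_change (@integral_flip n) mD); last exact: measurable_funM.
  by apply: eq_Rintegral => z _; rewrite /flip snoc_max mulN1r opprK.
rewrite RintegralZl ?mulN1r//.
exact: (integrable_bounded mD (vol_lty mD c0 Dc) ml (fun z Dz => Dc z Dz _)).
Qed.

Lemma measurable_polar_body n (al be : R) : measurable (polar_body n al be).
Proof.
have mp : measurable_fun setT (fun z : 'rV[R]_n.+1 => \row_j z ord0 (lift ord_max j) : 'rV[R]_n).
  apply: measurable_fun_coordP => i; under eq_fun do rewrite mxE.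
  exact: measurable_coord.
have ml := @measurable_coord R n.+1 ord_max.
apply: measurableI; apply: measurable_le_set.
- apply: measurable_funM => //; apply: measurableT_comp.
    apply: continuous_measurable_fun; exact: sqrt_continuous.
  exact: (measurableT_comp (@measurable_dotvv R n) mp).
- by apply: measurable_funD => //; exact: measurable_funM.
- by apply: measurable_funM => //; exact: (measurableT_comp (@measurable_norm1 R n) mp).
- by apply: measurable_funB => //; exact: measurable_funM.
Qed.

Lemma polar_body_last n (al be : R) (x : 'rV[R]_n) s : polar_body n al be (snoc x s) ->
  0 <= 1 + al * s /\ 0 <= 1 - be * s.
Proof.
move=> /polar_bodyP[h1 h2]; split.
  by rewrite (le_trans _ h1)// mulr_ge0// ?(ltW (rad_gt0 n)) ?sqrtr_ge0.
by rewrite (le_trans _ h2)// divr_ge0// norm1_ge0.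
Qed.

Lemma le_norm1 n (x : 'rV[R]_n) i : `|x ord0 i| <= norm1 x.
Proof. by rewrite /norm1 (bigD1 i)//= lerDl sumr_ge0. Qed.

Lemma norm2_le_norm1 n (x : 'rV[R]_n) : Num.sqrt (dotv x x) <= norm1 x.
Proof.
rewrite -(ger0_norm (norm1_ge0 x)) -sqrtr_sqr ler_wsqrtr// expr2 {1}/norm1 mulr_suml.
apply: ler_sum => i _; rewrite -[leLHS]ger0_norm -?expr2 ?sqr_ge0// normrX expr2.
by rewrite ler_wpM2l// le_norm1.
Qed.

Lemma polar_body_bounded n (al be : R) : 0 < al -> 0 < be -> exists2 c : R, 0 <= c &
  forall z : 'rV[R]_n.+1, polar_body n al be z -> forall i, `|z ord0 i| <= c.
Proof.
move=> al0 be0; pose c := 2 * (1 + be / al) + al^-1 + be^-1.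
have ai : 0 < al^-1 by rewrite invr_gt0.
have bi : 0 < be^-1 by rewrite invr_gt0.
have ba : 0 < be / al by exact: mulr_gt0.
exists c; first by rewrite /c; lra.
move=> z; rewrite (snocP z); set x := \row_j _; set s := z _ _ => zP.
have [s1 s2] := polar_body_last zP.
have {}s1 : - al^-1 <= s by rewrite -(ler_pM2l al0) mulrN mulfV ?gt_eqF//; lra.
have {}s2 : s <= be^-1 by rewrite -(ler_pM2l be0) mulfV ?gt_eqF//; lra.
move=> i; case: (unliftP ord_max i) => [j|] ->; rewrite ?snoc_lift ?snoc_max.
  have [_ h] := (polar_bodyP _ _ _ _).1 zP.
  have : be * - s <= be * al^-1 by rewrite ler_pM2l//; lra.
  by have := le_norm1 x j; rewrite /c mulrN; lra.
by rewrite ler_norml /c; lra.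
Qed.

Lemma polar_body_interior n (al be : R) : 0 < al -> 0 < be -> exists2 eps : R, 0 < eps &
  forall z : 'rV[R]_n.+1, (forall i, `|z ord0 i| <= eps) -> polar_body n al be z.
Proof.
move=> al0 be0; have r0 := @rad_gt0 R n.
have N0 : 0 <= n%:R :> R by [].
have rN0 : 0 <= rad n * n%:R :> R by apply: mulr_ge0 => //; exact: ltW.
(* All coefficients of eps in the two constraints are summed in k, so neither constraint loses more
   than k eps = 1/2. *)
pose k : R := 1 + al + be + n%:R + rad n * n%:R.
have k0 : 0 < k by rewrite /k; lra.
exists (2 * k)^-1; first by rewrite invr_gt0 mulr_gt0.
set eps := (2 * k)^-1.
have e0 : 0 < eps by rewrite invr_gt0 mulr_gt0.
have ke : k * eps = 1 / 2 by rewrite /eps; field; rewrite gt_eqF.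
move=> z; rewrite (snocP z); set x := \row_j _; set s := z _ _ => zP.
have := zP ord_max; rewrite snoc_max ler_norml => se.
have x1 : norm1 x <= n%:R * eps.
  rewrite /norm1 (le_trans (ler_sum _ (G := fun=> eps) _))//.
    by move=> i _; have := zP (lift ord_max i); rewrite snoc_lift.
  by rewrite sumr_const card_ord mulr_natl.
have x0 := norm1_ge0 x.
have ae : al * - eps <= al * s by rewrite ler_pM2l//; lra.
have bs : be * s <= be * eps by rewrite ler_pM2l//; lra.
have : 0 <= al * eps by apply: mulr_ge0; exact: ltW.
have : 0 <= be * eps by apply: mulr_ge0; exact: ltW.
have : 0 <= n%:R * eps by apply: mulr_ge0 => //; exact: ltW.
have : 0 <= rad n * n%:R * eps by apply: mulr_ge0 => //; exact: ltW.
move: ke; rewrite /k !mulrDl => ke h1 h2 h3 h4.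
apply/polar_bodyP; split; last by lra.
apply: (@le_trans _ _ (rad n * n%:R * eps)); last by lra.
rewrite -mulrA ler_wpM2l ?(ltW r0)//; exact: le_trans (norm2_le_norm1 x) x1.
Qed.

Lemma polar_body_symmetric n (al be : R) (x : 'rV[R]_n) s :
  polar_body n al be (snoc x s) -> polar_body n al be (snoc (- x) s).
Proof.
rewrite !polar_bodyP (_ : dotv (- x) (- x) = dotv x x); last first.
  by apply: eq_bigr => i _; rewrite !mxE mulrNN.
by rewrite (_ : norm1 (- x) = norm1 x)//; apply: eq_bigr => i _; rewrite !mxE normrN.
Qed.

Lemma vol_polar_body n (al be : R) : 0 < al -> 0 < be -> (0 < vol n.+1 (polar_body n al be) < +oo)%E.
Proof.
move=> al0 be0; have mp := @measurable_polar_body n al be.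
have [c c0 cP] := polar_body_bounded n al0 be0.
have [eps eps0 epsP] := polar_body_interior n al0 be0.
apply/andP; split; last exact: (vol_lty mp c0 cP).
apply: (vol_gt0 (c := 0) mp eps0) => z ze; apply: epsP => i.
by have := ze i; rewrite mxE subr0.
Qed.

Lemma santalo_polar_atM n : (0 < n)%N ->
  is_santalo_point (polar_at (bodyM R n) (centroid (bodyM R n))) 0.
Proof.
move=> n0; have := @ctr_itv R n n0; set tau := ctr n => tb.
have -> : polar_at (bodyM R n) (centroid (bodyM R n)) = polar_body n (1 + tau) (b - tau).
  by rewrite centroid_bodyM; exact: polar_atM.
have al0 : 0 < 1 + tau by lra.
have be0 : 0 < b - tau by lra.
have [eps1 eps1_0 eps1P] := polar_body_interior n al0 be0.
have [c c0 cP] := @bodyM_boundedE R n.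
have [eps eps0 epsP] := bodyM_interior n tb.
have mt : measurable_fun setT (fun z : 'rV[R]_n.+1 => z + snoc 0 tau).
  apply: measurable_fun_coordP => i; under eq_fun do rewrite mxE.
  by apply: measurable_funD => //; exact: measurable_coord.
have mP : measurable [set y : 'rV[R]_n.+1 | bodyM R n (y + snoc 0 tau)].
  by have := mt measurableT _ (@measurable_bodyM R n); rewrite setTI.
have Pc (y : 'rV[R]_n.+1) : bodyM R n (y + snoc 0 tau) -> forall i, `|y ord0 i| <= c + `|tau|.
  move=> /cP h i; have := h i; rewrite !mxE.
  have : `|snoc (0 : 'rV[R]_n) tau ord0 i| <= `|tau|.
    by case: (unliftP ord_max i) => [j|] ->; rewrite ?snoc_lift ?snoc_max// mxE normr0.
  rewrite mxE; move: (y ord0 i) (match unlift _ _ with Some _ => _ | None => _ end) => u w h1 h2.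
  by have := ler_normB (u + w) w; rewrite addrK; lra.
apply: (is_santalo_point0 (c := c + `|tau|) (eps := eps)).
- by apply: eps1P => i; rewrite mxE normr0 ltW.
- exact: vol_polar_body.
- by rewrite bipolar_M.
- by rewrite bipolar_M//; exact: Pc.
- by [].
- move=> y ye; rewrite bipolar_M//=; apply: epsP => i; rewrite mxE addrK; exact: ye.
rewrite bipolar_M// => x.
set P := [set y | _] in mP *.
have Poo : (vol n.+1 P < +oo)%E by apply: (vol_lty mP _ Pc); exact: addr_ge0.
have ml := @measurable_coord R n.+1 ord_max.
have max0 : \int[vol n.+1]_(y in P) (y ord0 ord_max) = 0.
  transitivity (\int[vol n.+1]_(z in bodyM R n) (z ord0 ord_max - tau)).
    rewrite (Rintegral_change (@integral_shift_last R n tau) (@measurable_bodyM R n)); last by exact: measurable_funB.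
    by apply: eq_Rintegral => y _; rewrite mxE snoc_max addrK.
  have Moo : (vol n.+1 (bodyM R n) < +oo)%E by rewrite vol_bodyM ltry.
  rewrite RintegralB; [|exact: measurable_bodyM| |].
  - rewrite Rintegral_last_bodyM Rintegral_cst; last exact: measurable_bodyM.
    by rewrite mulrC subrr.
  - by apply: (integrable_bounded (c := c) (@measurable_bodyM R n) Moo ml) => z /cP.
  - by apply: (integrable_bounded (c := `|tau|) (@measurable_bodyM R n) Moo).
(* The direction is split into a horizontal part, whose integral vanishes by symmetry, and an axial
   part, handled by [max0]. *)
rewrite (snocP x); set x' := \row_j _; set s := x _ _.
have mx : measurable_fun setT (fun y : 'rV[R]_n.+1 => dotv (snoc x' 0) y) by exact: measurable_dotv.
have E (y : 'rV[R]_n.+1) : dotv (snoc x' s) y = dotv (snoc x' 0) y + s * y ord0 ord_max.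
  by rewrite (snocP y) !dotv_snoc snoc_max mul0r addr0.
rewrite (@eq_Rintegral _ _ _ _ _ (fun y => dotv (snoc x' 0) y + s * y ord0 ord_max)); last by move=> y _.
have i2 : (vol n.+1).-integrable P (EFin \o (fun y : 'rV[R]_n.+1 => y ord0 ord_max)).
  by apply: (integrable_bounded mP Poo ml) => y Py; exact: Pc.
have i1 : (vol n.+1).-integrable P (EFin \o (fun y : 'rV[R]_n.+1 => dotv (snoc x' 0) y)).
  apply: (integrable_bounded (c := \sum_(i < n.+1) `|snoc x' 0 ord0 i| * (c + `|tau|)) mP Poo mx).
  move=> y Py; rewrite (le_trans (ler_norm_sum _ _ _))//; apply: ler_sum => i _.
  by rewrite normrM ler_wpM2l// Pc.
have i3 : (vol n.+1).-integrable P (EFin \o (fun y : 'rV[R]_n.+1 => s * y ord0 ord_max)).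
  exact: (integrableZl mP s i2).
rewrite (RintegralD mP i1 i3) (RintegralZl _ mP i2) max0 mulr0 addr0.
apply: integral_odd => // [y t|y t].
  by rewrite /P/= !snocD !addr0; exact: bodyM_symmetric.
rewrite !dotv_snoc !mul0r !addr0 /dotv -sumrN; apply: eq_bigr => i _.
by rewrite !mxE mulrN.
Qed.

End polar_body.

(** * The centroid of a nearly conical body *)

Section centroid_bound.
Context {R : realType}.
Implicit Types n : nat.

(** For i = 0 this is the volume above sg of a cone with apex at height 1 / be, for i = 1 its moment
    about sg. The absolute values make the integrand nonnegative everywhere. *)
Lemma integral_cone (i n : nat) (V sg be : R) : 0 <= V -> 0 < be -> 0 < 1 - be * sg ->
  (\int[mu]_(s in `[sg, be^-1%R]) (`|s - sg| ^+ i * (V * `|1 - be * s| ^+ n))%R%:E =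
   (V * (1 - be * sg) ^+ (i + n).+1 / be ^+ i.+1 * (i`!%:R * n`!%:R / (i + n).+1`!%:R))%R%:E)%E.
Proof.
move=> V0 be0 l0; set l := 1 - be * sg in l0 *.
have lE : be^-1 - sg = l / be by rewrite /l mulrBl mul1r mulrAC mulfV ?gt_eqF// mul1r.
have lbe : 0 < l / be by exact: divr_gt0.
rewrite integral_affine_itv; last 3 first.
- by rewrite -subr_gt0 lE.
- apply/measurable_EFinP; apply: measurable_funM.
    by apply: measurable_funX; apply: measurableT_comp => //; exact: measurable_funB.
  apply: measurable_funM => //; apply: measurable_funX; apply: measurableT_comp => //.
  by apply: measurable_funB => //; exact: measurable_funM.
- by move=> s; rewrite lee_fin; apply: mulr_ge0; [exact: exprn_ge0|apply: mulr_ge0 => //; exact: exprn_ge0].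
rewrite lE (eq_integral (fun t : measurableTypeR R =>
  ((l / be) ^+ i * (V * l ^+ n) * (t ^+ i * (1 - t) ^+ n))%:E)); last first.
  move=> t; rewrite inE/= in_itv/= => /andP[t0 t1]; congr EFin.
  have -> : sg + l / be * t - sg = l / be * t by ring.
  have -> : 1 - be * (sg + l / be * t) = l * (1 - t) by rewrite /l; field; rewrite gt_eqF.
  have h1 : 0 <= l / be * t by apply: mulr_ge0 => //; exact: ltW.
  have h2 : 0 <= l * (1 - t) by apply: mulr_ge0; lra.
  by rewrite !ger0_norm// !exprMn; ring.
rewrite ge0_integralZl_real//.
- rewrite integral_beta -!EFinM; congr EFin.
  rewrite expr_div_n !exprS exprD; move: (i`!%:R * n`!%:R / _ : R) (l ^+ i) (l ^+ n) => F A B.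
  by field; rewrite expf_neq0 gt_eqF.
- apply: mulr_ge0; first by apply: exprn_ge0; exact: ltW.
  by apply: mulr_ge0 => //; apply: exprn_ge0; exact: ltW.
- apply: measurable_funM; apply: measurable_funX => //.
  by apply: measurable_funB.
- move=> t; rewrite /= in_itv/= => /andP[t0 t1].
  by apply: mulr_ge0; apply: exprn_ge0 => //; lra.
Qed.

(* If the sections of P above height sg are pinched between c and 1 times those
   of a cone with apex at height 1 / be, the part of P above sg has its centroid
   within O(1 / n) of sg, because this is so for the cone. *)
Lemma centroid_last_le n (P : set 'rV[R]_n.+1) (M sg be V c : R) :
  measurable P -> 0 <= M -> (forall z : 'rV[R]_n.+1, P z -> forall i, `|z ord0 i| <= M) ->
  0 < be -> 0 < 1 - be * sg -> 0 < V -> 0 < c ->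
  (forall x s, P (snoc x s) -> s <= be^-1) ->
  (forall s, sg < s < be^-1 ->
    ((c * (V * (1 - be * s) ^+ n))%R%:E <= vol n [set x | P (snoc x s)] /\
     vol n [set x | P (snoc x s)] <= (V * (1 - be * s) ^+ n)%R%:E)%E) ->
  centroid P ord0 ord_max <= sg + (1 - be * sg) / (c * be * n.+2%:R).
Proof.
move=> mP M0 PM be0 l0 V0 c0 Ptop Psec; set l := 1 - be * sg in l0 *.
have Poo := vol_lty mP M0 PM.
have vPfin : vol n.+1 P \is a fin_num by rewrite ge0_fin_numE.
have ml := @measurable_coord R n.+1 ord_max.
have mW := measurable_vol_section mP.
(* The volume of the outer cone above sg. Its moment about sg is l / (be (n + 2)) times Q, the
   source of the O(1 / n). *)
pose Q := V * l ^+ n.+1 / be / n.+1%:R.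
have Q0 : 0 < Q by rewrite /Q divr_gt0// divr_gt0// mulr_gt0// exprn_gt0.
have msp : measurable_fun setT (fun s : measurableTypeR R => Num.max (s - sg) 0 : measurableTypeR R).
  by apply: measurable_maxr => //; exact: measurable_funB.
have sp0 (s : R) : 0 <= Num.max (s - sg) 0 by rewrite le_max lexx orbT.
have mpw i (A : R) : measurable_fun setT (fun s : measurableTypeR R =>
    (`|s - sg| ^+ i * (A * `|1 - be * s| ^+ n))%:E : \bar R).
  apply/measurable_EFinP; apply: measurable_funM.
    by apply: measurable_funX; apply: measurableT_comp => //; exact: measurable_funB.
  apply: measurable_funM => //; apply: measurable_funX; apply: measurableT_comp => //.
  by apply: measurable_funB => //; exact: measurable_funM.
have abs1 s : s \in `]sg, be^-1[ -> `|1 - be * s| = 1 - be * s /\ `|s - sg| = s - sg.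
  rewrite in_itv/= => /andP[s1 s2]; rewrite !ger0_norm//; first by lra.
  by rewrite subr_ge0 -(@ler_pM2l _ be^-1) ?invr_gt0// mulKf ?gt_eqF// mulr1 ltW.
have volP : ((c * Q)%R%:E <= vol n.+1 P)%E.
  rewrite vol_snoc//.
  have -> : (c * Q)%:E = (\int[mu]_(s in `[sg, be^-1%R])
      (`|s - sg| ^+ 0 * (c * V * `|1 - be * s| ^+ n))%R%:E)%E.
    rewrite integral_cone//; last by apply: mulr_ge0; exact: ltW.
    rewrite add0n fact0 mul1r expr1 factS natrM -/l /Q; congr EFin.
    have F0 : n`!%:R != 0 :> R by rewrite pnatr_eq0 -lt0n fact_gt0.
    have N0 : n.+1%:R != 0 :> R by rewrite pnatr_eq0.
    move: F0 N0; move: (n`!%:R : R) (n.+1%:R : R) (l ^+ n.+1) => F N X F0 N0.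
    by field; rewrite F0 N0 gt_eqF.
  rewrite integral_itv_bndoo; last by apply: measurable_funTS; exact: mpw.
  rewrite integral_mkcond; apply: ge0_le_integral => //.
  - move=> s _; rewrite patchE; case: ifPn => // _; rewrite lee_fin expr0 mul1r.
    by apply: mulr_ge0; [apply: mulr_ge0; exact: ltW|exact: exprn_ge0].
  - by apply/(measurable_restrictT _ _).1 => //; apply: measurable_funTS; exact: mpw.
  move=> s _; rewrite patchE; case: ifPn => [|_]; last exact: measure_ge0.
  rewrite inE => sI.
  have [-> _] := abs1 _ sI; rewrite expr0 mul1r -mulrA.
  by move: sI; rewrite /= in_itv/= => /Psec[].
have intP : (\int[vol n.+1]_(z in P) (Num.max (z ord0 ord_max - sg) 0)%R%:E <=
    (l / be / n.+2%:R * Q)%R%:E)%E.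
  rewrite integral_snoc_in//; last 2 first.
  - by apply/measurable_EFinP; exact: (measurableT_comp msp ml).
  - by move=> z; rewrite lee_fin.
  rewrite (eq_integral (fun s : measurableTypeR R =>
      ((Num.max (s - sg) 0)%R%:E * vol n [set x | P (snoc x s)])%E)); last first.
    move=> s _; rewrite -integral_cst; last exact: measurable_section.
    by apply: eq_integral => x _; rewrite snoc_max.
  have -> : (l / be / n.+2%:R * Q)%:E = (\int[mu]_(s in `[sg, be^-1%R])
      (`|s - sg| ^+ 1 * (V * `|1 - be * s| ^+ n))%R%:E)%E.
    rewrite integral_cone ?ltW// add1n !factS !natrM fact0 -/l /Q; congr EFin.
    have F0 : n`!%:R != 0 :> R by rewrite pnatr_eq0 -lt0n fact_gt0.
    have N0 : n.+1%:R != 0 :> R by rewrite pnatr_eq0.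
    have N20 : n.+2%:R != 0 :> R by rewrite pnatr_eq0.
    rewrite (exprS l n.+1).
    move: F0 N0 N20; move: (n`!%:R : R) (n.+1%:R : R) (n.+2%:R : R) (l ^+ n.+1) => F N N2 X F0 N0 N20.
    by field; rewrite F0 N0 N20 gt_eqF.
  have mF : measurable_fun setT (fun s : measurableTypeR R =>
      ((Num.max (s - sg) 0)%R%:E * vol n [set x | P (snoc x s)])%E).
    by apply: emeasurable_funM => //; exact/measurable_EFinP.
  have F0 s : (0 <= (Num.max (s - sg) 0)%R%:E * vol n [set x | P (snoc x s)])%E.
    by apply: mule_ge0 => //; rewrite lee_fin.
  rewrite (_ : (\int[mu]_t _)%E = (\int[mu]_(s in `[sg, be^-1%R])
      ((Num.max (s - sg) 0)%R%:E * vol n [set x | P (snoc x s)]))%E); last first.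
    rewrite [RHS]integral_mkcond; apply: eq_integral => s _; rewrite patchE; case: ifPn => // sI.
    have [s1|s1] := leP s sg.
      by rewrite max_r ?mul0e//; lra.
    rewrite (_ : [set x | _] = set0) ?measure0 ?mule0//.
    apply/seteqP; split => x //= /Ptop s2; move: sI.
    by rewrite notin_setE/= in_itv/= => /negP; rewrite (ltW s1) s2.
  rewrite integral_itv_bndoo; last exact: measurable_funTS.
  rewrite [leRHS]integral_itv_bndoo; last by apply: measurable_funTS; exact: mpw.
  apply: ge0_le_integral => //.
  - exact: measurable_funTS.
  - by apply: measurable_funTS; exact: mpw.
  move=> s sI; have [-> ->] := abs1 _ sI; move: sI; rewrite /= in_itv/= => sI.
  have [_ h] := Psec _ sI.
  have s1 : 0 <= s - sg by lra.
  by rewrite max_l// expr1 EFinM; apply: lee_wpmul2l => //; rewrite lee_fin.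
rewrite !mxE; set v := fine (vol n.+1 P).
have vE : vol n.+1 P = v%:E by rewrite fineK.
have v1 : c * Q <= v by rewrite -lee_fin -vE.
have v0 : 0 < v by apply: lt_le_trans v1; exact: mulr_gt0.
have i1 : (vol n.+1).-integrable P (EFin \o (fun z : 'rV[R]_n.+1 => z ord0 ord_max)).
  exact: (integrable_bounded mP Poo ml (fun z Pz => PM z Pz _)).
have mpos : measurable_fun setT (fun z : 'rV[R]_n.+1 => Num.max (z ord0 ord_max - sg) 0).
  exact: (measurableT_comp msp ml).
have i2 : (vol n.+1).-integrable P (EFin \o (fun z : 'rV[R]_n.+1 => Num.max (z ord0 ord_max - sg) 0)).
  apply: (integrable_bounded (c := M + `|sg|) mP Poo mpos) => z Pz.
  rewrite ger0_norm// ge_max; apply/andP; split; last exact: addr_ge0.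
  by have := PM z Pz ord_max; have := ler_norm (z ord0 ord_max); have := ler_norm (- sg); rewrite normrN; lra.
have i3 : (vol n.+1).-integrable P (EFin \o (fun=> sg)).
  by apply: (integrable_bounded (c := `|sg|) mP Poo).
have i23 : (vol n.+1).-integrable P (EFin \o (fun z : 'rV[R]_n.+1 => sg + Num.max (z ord0 ord_max - sg) 0)).
  exact: (integrableD mP i3 i2).
(* The last coordinate is at most sg plus its positive excess over sg, so the part of P below sg
   only adds to the volume. *)
rewrite ler_pdivrMl// (le_trans (le_Rintegral mP i1 i23 _))//.
  by move=> z _; rewrite -lerBlDl le_max lexx.
rewrite (RintegralD mP i3 i2) Rintegral_cst// -/v mulrDr mulrC lerD2l.
have : \int[vol n.+1]_(z in P) Num.max (z ord0 ord_max - sg) 0 <= l / be / n.+2%:R * Q.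
  by rewrite -lee_fin fineK//; exact: integrable_fin_num i2.
move/le_trans; apply.
have -> : v * (l / (c * be * n.+2%:R)) = l / be / n.+2%:R * (v / c).
  by field; rewrite !gt_eqF// addrC -natrD natr1 pnatr_eq0.
apply: ler_wpM2l; last by rewrite ler_pdivlMr// mulrC.
by apply: divr_ge0 => //; apply: divr_ge0; exact: ltW.
Qed.

End centroid_bound.

Section centroid_polar.
Context {R : realType}.
Implicit Types n : nat.

(** On D the indicator of the set plus f / A is at least 1; this is then integrated. *)
Lemma markov_section n (D : set 'rV[R]_n) (f : 'rV[R]_n -> R) (A v w : R) :
  measurable D -> measurable_fun setT f -> (forall x, 0 <= f x) -> 0 < A ->
  vol n D = v%:E -> (\int[vol n]_(x in D) (f x)%:E = w%:E)%E ->
  ((v - w / A)%:E <= vol n [set x | D x /\ (f x <= A)%R])%E.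
Proof.
move=> mD mf f0 A0 vD wf; set S := [set x | _].
have mS : measurable S.
  apply: measurableI => //; apply: measurable_le_set => //; exact: measurable_cst.
rewrite EFinB leeBlDr//.
have -> : ((w / A)%:E = \int[vol n]_(x in D) (A^-1 * f x)%R%:E)%E.
  rewrite ge0_integralZl_real ?invr_ge0 ?(ltW A0)//; last exact: measurable_funTS.
  by rewrite wf -EFinM mulrC.
have -> : (vol n S = \int[vol n]_(x in D) (\1_S x)%:E)%E.
  by rewrite integral_indic//; congr (vol n _); apply/seteqP; split => x //= [].
have mAf : measurable_fun setT (fun x => A^-1 * f x) by exact: measurable_funM.
have Af0 x : 0 <= A^-1 * f x by apply: mulr_ge0 => //; rewrite invr_ge0 ltW.
rewrite -ge0_integralD_real//; last exact: measurable_funTS.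
rewrite -vD -[vol n D]mul1e -integral_cst//; apply: ge0_le_integral => //.
  by apply/measurable_EFinP; apply: measurable_funTS; apply: measurable_funD => //; exact: measurable_indic.
move=> x Dx; rewrite lee_fin indicE; have [xS|xS] := boolP (x \in S).
  by rewrite lerDl.
have fA : A < f x by rewrite ltNge; apply: contraNN xS => fA; rewrite inE.
by rewrite add0r -(ler_pM2l A0) mulVKf ?gt_eqF// mulr1 ltW.
Qed.

Lemma polar_body_sectionE n (al be s : R) : 0 < 1 + al * s ->
  [set x : 'rV[R]_n | polar_body n al be (snoc x s)] =
  eball n (((1 + al * s) / rad n) ^+ 2) `&` cross n (2 * (1 - be * s)).
Proof.
move=> A0; have r0 := @rad_gt0 R n; have Ar0 : 0 < (1 + al * s) / rad n by exact: divr_gt0.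
apply/seteqP; split => x; rewrite /= polar_bodyP /eball /cross/= ler_pdivrMr// (mulrC _ 2).
  move=> [h1 h2]; split => //.
  rewrite -(@sqr_sqrtr _ (dotv x x)) ?dotvv_ge0// lerXn2r ?nnegrE ?sqrtr_ge0 ?(ltW Ar0)//.
  by rewrite ler_pdivlMr// mulrC.
move=> [h1 h2]; split => //.
rewrite mulrC -ler_pdivlMr// -(ger0_norm (ltW Ar0)) -sqrtr_sqr.
exact: ler_wsqrtr.
Qed.

(** The cross-polytopes of radius 2 (1 - be s) form a cone with apex at height 1 / be. The last
    hypothesis bounds the mean in Markov's inequality at height sg, which leaves at least the
    fraction c of each of them inside the polar. *)
Lemma centroid_polar_le n (al be sg c : R) :
  0 < al -> 0 < be -> 0 < 1 + al * sg -> 0 < 1 - be * sg -> 0 < c ->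
  rad n ^+ 2 * (8 * n%:R / (n.+1%:R * n.+2%:R)) * ((1 - be * sg) / (1 + al * sg)) ^+ 2 <= 1 - c ->
  centroid (polar_body n al be) ord0 ord_max <= sg + (1 - be * sg) / (c * be * n.+2%:R).
Proof.
move=> al0 be0 A0 B0 c0 Xc; have r0 := @rad_gt0 R n.
have [M M0 PM] := @polar_body_bounded R n al be al0 be0.
apply: (@centroid_last_le _ n _ M sg be (2 ^+ n / n`!%:R * 2 ^+ n) c) => //.
- exact: measurable_polar_body.
- move=> x s /polar_body_last[_ s1].
  by rewrite -(ler_pM2l be0) mulfV ?gt_eqF//; lra.
move=> s /andP[s1 s2].
have {}s2 : 0 < 1 - be * s by rewrite subr_gt0 mulrC -ltr_pdivlMr// mul1r.
have s3 : al * sg < al * s by rewrite ltr_pM2l.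
have s4 : be * sg < be * s by rewrite ltr_pM2l.
set A := 1 + al * s; set B := 1 - be * s in s2 *.
have A1 : 0 < A by rewrite /A; lra.
have BB : 0 < 2 * B by exact: mulr_gt0.
have VB : 2 ^+ n / n`!%:R * 2 ^+ n * B ^+ n = 2 ^+ n / n`!%:R * (2 * B) ^+ n by rewrite exprMn mulrA.
rewrite polar_body_sectionE// VB -vol_cross//; split; last first.
  apply: le_measure; rewrite ?inE; [|exact: measurable_cross|exact: subIsetr].
  by apply: measurableI; [exact: measurable_eball|exact: measurable_cross].
have := @markov_section n (cross n (2 * B)) (fun x => dotv x x) ((A / rad n) ^+ 2) _ _
  (@measurable_cross R n _) (@measurable_dotvv R n) (@dotvv_ge0 R n) _ (vol_cross n BB)
  (integral_dotvv_cross n BB).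
rewrite setIC -/A; move=> h; apply: le_trans (h _); last by rewrite exprn_gt0// divr_gt0.
rewrite lee_fin !factS !natrM !exprS.
have F0 : 0 < n`!%:R :> R by rewrite ltr0n fact_gt0.
have N1 : 0 < n.+1%:R :> R by [].
have N2 : 0 < n.+2%:R :> R by [].
(* The ratio decreases with the height, so the hypothesis at sg serves at every s above it. *)
have BA : B / A <= (1 - be * sg) / (1 + al * sg).
  by rewrite ler_pdivrMr// mulrAC ler_pdivlMr// /A /B; nra.
have : rad n ^+ 2 * (8 * n%:R / (n.+1%:R * n.+2%:R)) * (B / A) ^+ 2 <= 1 - c.
  apply: le_trans Xc; apply: ler_wpM2l.
    by apply: mulr_ge0; [exact: sqr_ge0|apply: divr_ge0; exact: mulr_ge0].
  by rewrite lerXn2r ?nnegrE// ltW// divr_gt0.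
move=> Xc'.
have -> : 2 ^+ n / n`!%:R * (2 * B) ^+ n -
    n%:R * (2 * 2 ^+ n) / (n.+2%:R * (n.+1%:R * n`!%:R)) * (2 * B * (2 * B * (2 * B) ^+ n)) / (A / rad n * (A / rad n * 1)) =
    (2 ^+ n / n`!%:R * (2 * B) ^+ n) *
    (1 - rad n ^+ 2 * (8 * n%:R / (n.+1%:R * n.+2%:R)) * (B / A) ^+ 2).
  clear h Xc Xc'; move: F0 N1 N2 r0; move: (n`!%:R : R) (n.+1%:R : R) (n.+2%:R : R) (rad n) ((2 * B) ^+ n) (2 ^+ n : R) (n%:R : R).
  by move=> F m1 m2 r X Y k F0 N1 N2 r0; field; rewrite !gt_eqF.
rewrite mulrC; apply: ler_wpM2l; last by rewrite lerBrDr addrC -lerBrDr.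
by apply: mulr_ge0; [apply: divr_ge0; [exact: exprn_ge0|exact: ltW]|apply: exprn_ge0; exact: ltW].
Qed.

(** The mirror image: with the last axis reversed, the balls of radius (1 - al s) / r form the outer
    cone and Markov's inequality is applied to |x|_1. *)
Lemma centroid_polar_ge n (al be sg c : R) : (0 < n)%N ->
  0 < al -> 0 < be -> 0 < 1 + al * sg -> 0 < 1 - be * sg -> 0 < c ->
  n%:R / n.+1%:R * (rad n * wallis n.-1)^-1 * ((1 + al * sg) / (1 - be * sg)) <= 1 - c ->
  sg - (1 + al * sg) / (c * al * n.+2%:R) <= centroid (polar_body n al be) ord0 ord_max.
Proof.
move=> n0 al0 be0 A0 B0 c0 Xc; have r0 := @rad_gt0 R n.
have w0 := @wallis_gt0 R n.-1.
have o0 := @omega_gt0 R n.-1.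
have [M M0 PM] := @polar_body_bounded R n al be al0 be0.
have mP := @measurable_polar_body R n al be.
rewrite -lerN2 -(centroid_flip mP M0 PM).
rewrite (_ : - (sg - _) = - sg + (1 - al * - sg) / (c * al * n.+2%:R)); last first.
  by rewrite opprB addrC mulrN opprK.
have mP' : measurable (@flip R n @^-1` polar_body n al be).
  by rewrite -[X in measurable X]setTI; exact: measurable_flip.
apply: (@centroid_last_le _ n _ M (- sg) al (omega n * (rad n)^-1 ^+ n) c) => //.
- move=> z Pz i; rewrite -(_ : `|flip z ord0 i| = `|z ord0 i|); first exact: PM.
  rewrite (snocP z) flip_snoc; case: (unliftP ord_max i) => [j|] ->; rewrite ?snoc_lift ?snoc_max//.
  by rewrite normrN.
- by rewrite mulrN opprK.
- by apply: mulr_gt0; [exact: omega_gt0|rewrite exprn_gt0// invr_gt0].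
- move=> x s; rewrite /= flip_snoc => /polar_body_last[s1 _].
  by rewrite -(ler_pM2l al0) mulfV ?gt_eqF//; lra.
move=> s /andP[s1 s2].
have {}s2 : 0 < 1 - al * s by rewrite subr_gt0 mulrC -ltr_pdivlMr// mul1r.
have s3 : al * - sg < al * s by rewrite ltr_pM2l.
have s4 : be * - sg < be * s by rewrite ltr_pM2l.
rewrite (_ : [set x | _] = [set x : 'rV[R]_n | polar_body n al be (snoc x (- s))]); last first.
  by apply/seteqP; split => x; rewrite /= flip_snoc.
rewrite polar_body_sectionE ?mulrN// opprK.
set A := 1 - al * s in s2 *; set B := 1 + be * s.
have B1 : 0 < B by rewrite /B; lra.
have Ar : 0 < A / rad n by exact: divr_gt0.
have VA : omega n * (rad n)^-1 ^+ n * A ^+ n = omega n * (A / rad n) ^+ n.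
  by rewrite [in RHS]exprMn mulrA mulrAC.
rewrite VA -(vol_eball n Ar); split; last first.
  apply: le_measure; rewrite ?inE; [|exact: measurable_eball|exact: subIsetl].
  by apply: measurableI; [exact: measurable_eball|exact: measurable_cross].
have := @markov_section n (eball n ((A / rad n) ^+ 2)) (@norm1 R n) (2 * B) _ _
  (@measurable_eball R n _) (@measurable_norm1 R n) (@norm1_ge0 R n) _ (vol_eball n Ar)
  (integral_norm1_eball n Ar).
move=> h; apply: le_trans (h _); last exact: mulr_gt0.
rewrite lee_fin exprS.
have N1 : 0 < n.+1%:R :> R by [].
have omE : omega n = omega n.-1 * wallis n.-1 :> R by rewrite -{1}(prednK n0) omegaS.
have AB : A / B <= (1 + al * sg) / (1 - be * sg).
  by rewrite ler_pdivrMr// mulrAC ler_pdivlMr// /A /B; nra.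
have Xc' : n%:R / n.+1%:R * (rad n * wallis n.-1)^-1 * (A / B) <= 1 - c.
  apply: le_trans Xc; apply: ler_wpM2l => //.
  by apply: mulr_ge0; [exact: divr_ge0|rewrite invr_ge0 ltW// mulr_gt0].
have -> : omega n * (A / rad n) ^+ n -
    n%:R * 2 / n.+1%:R * omega n.-1 * (A / rad n * (A / rad n) ^+ n) / (2 * B) =
    (omega n * (A / rad n) ^+ n) *
    (1 - n%:R / n.+1%:R * (rad n * wallis n.-1)^-1 * (A / B)).
  rewrite omE; move: N1 w0 o0 r0 B1; move: (n.+1%:R : R) (wallis n.-1 : R) (omega n.-1 : R).
  clear h Xc Xc'; move: ((A / rad n) ^+ n) (rad n) (n%:R : R).
  by move=> X r k N w o N1 w0 o0 r0 B1; field; rewrite !gt_eqF.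
rewrite mulrC; apply: ler_wpM2l; last by rewrite lerBrDr addrC -lerBrDr.
by apply: mulr_ge0; [exact/ltW/omega_gt0|apply: exprn_ge0; exact: ltW].
Qed.

End centroid_polar.

(** * Limits of the centroid bounds, upper and lower limits *)

Section limits.
Context {R : realType}.
Implicit Types n : nat.
Local Notation b := (@height R).
Local Notation e := (expR 1 : R).

Lemma cvg_inv_natSS : (n.+2%:R^-1 : R) @[n --> \oo] --> (0 : R).
Proof. by have := @cvg_inv_nat R; rewrite -(cvg_shiftS (fun n => n.+1%:R^-1 : R)). Qed.

(** A strict inequality in the limit leaves a fixed margin c for all large n, and the error term of
    [centroid_polar_le] then tends to 0. *)
Lemma near_centroid_polar_le (tau : nat -> R) (sg eps : R) : tau @ \oo --> (0 : R) ->
  0 < 1 + sg -> 0 < 1 - b * sg ->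
  4 / (e * pi) * ((1 - b * sg) / (1 + sg)) ^+ 2 < 1 -> 0 < eps ->
  \forall n \near \oo, centroid (polar_body n (1 + tau n) (b - tau n)) ord0 ord_max <= sg + eps.
Proof.
move=> tau0 A0 B0 q1 eps0; have b0 := @height_gt0 R.
set q := 4 / _ * _ in q1.
(* 1 - c is the midpoint of q and 1, hence above the limit q of the means. *)
pose c := (1 - q) / 2.
have c0 : 0 < c by rewrite /c; lra.
have hal : (1 + tau n) @[n --> \oo] --> (1 : R).
  by rewrite -[X in _ --> X]addr0; apply: cvgD => //; exact: cvg_cst.
have hbe : (b - tau n) @[n --> \oo] --> b.
  by rewrite -[X in _ --> X]subr0; apply: cvgB => //; exact: cvg_cst.
have hA : (1 + (1 + tau n) * sg) @[n --> \oo] --> 1 + sg.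
  rewrite -[X in _ --> _ + X]mul1r; apply: cvgD; first exact: cvg_cst.
  by apply: cvgM => //; exact: cvg_cst.
have hB : (1 - (b - tau n) * sg) @[n --> \oo] --> 1 - b * sg.
  apply: cvgB; first exact: cvg_cst.
  by apply: cvgM => //; exact: cvg_cst.
have hX : (rad n ^+ 2 * (8 * n%:R / (n.+1%:R * n.+2%:R)) *
    ((1 - (b - tau n) * sg) / (1 + (1 + tau n) * sg)) ^+ 2) @[n --> \oo] --> q.
  apply: cvgM; first exact: cvg_mean_dotvv.
  rewrite expr2; under eq_fun do rewrite expr2.
  by apply: cvgM; apply: cvgM => //; apply: cvgV => //; rewrite gt_eqF.
have hE : ((1 - (b - tau n) * sg) / (c * (b - tau n) * n.+2%:R)) @[n --> \oo] --> (0 : R).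
  rewrite (_ : 0 = (1 - b * sg) * (c * b)^-1 * 0); last by rewrite mulr0.
  under eq_fun do rewrite (invfM (c * _)) mulrA.
  apply: cvgM; last exact: cvg_inv_natSS.
  apply: cvgM => //; apply: cvgV; first by rewrite gt_eqF// mulr_gt0.
  by apply: cvgM => //; exact: cvg_cst.
near=> n.
have al1 : 0 < 1 + tau n by near: n; exact: (cvgr_gt _ hal).
have be1 : 0 < b - tau n by near: n; exact: (cvgr_gt _ hbe).
have A1 : 0 < 1 + (1 + tau n) * sg by near: n; exact: (cvgr_gt _ hA).
have B1 : 0 < 1 - (b - tau n) * sg by near: n; exact: (cvgr_gt _ hB).
apply: (le_trans (centroid_polar_le al1 be1 A1 B1 c0 _)).
  near: n; apply: (cvgr_le _ hX); rewrite /c; lra.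
by rewrite lerD2l; near: n; exact: (cvgr_le _ hE).
Unshelve. all: by end_near. Qed.

Lemma near_centroid_polar_ge (tau : nat -> R) (sg eps : R) : tau @ \oo --> (0 : R) ->
  0 < 1 + sg -> 0 < 1 - b * sg ->
  Num.sqrt e * ((1 + sg) / (1 - b * sg)) < 1 -> 0 < eps ->
  \forall n \near \oo, sg - eps <= centroid (polar_body n (1 + tau n) (b - tau n)) ord0 ord_max.
Proof.
move=> tau0 A0 B0 q1 eps0; have b0 := @height_gt0 R.
set q := Num.sqrt _ * _ in q1.
pose c := (1 - q) / 2.
have c0 : 0 < c by rewrite /c; lra.
have hal : (1 + tau n) @[n --> \oo] --> (1 : R).
  by rewrite -[X in _ --> X]addr0; apply: cvgD => //; exact: cvg_cst.
have hbe : (b - tau n) @[n --> \oo] --> b.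
  by rewrite -[X in _ --> X]subr0; apply: cvgB => //; exact: cvg_cst.
have hA : (1 + (1 + tau n) * sg) @[n --> \oo] --> 1 + sg.
  rewrite -[X in _ --> _ + X]mul1r; apply: cvgD; first exact: cvg_cst.
  by apply: cvgM => //; exact: cvg_cst.
have hB : (1 - (b - tau n) * sg) @[n --> \oo] --> 1 - b * sg.
  apply: cvgB; first exact: cvg_cst.
  by apply: cvgM => //; exact: cvg_cst.
have hX : (n%:R / n.+1%:R * (rad n * wallis n.-1)^-1 *
    ((1 + (1 + tau n) * sg) / (1 - (b - tau n) * sg))) @[n --> \oo] --> q.
  apply: cvgM; first exact: cvg_mean_norm1.
  by apply: cvgM => //; apply: cvgV => //; rewrite gt_eqF.
have hE : ((1 + (1 + tau n) * sg) / (c * (1 + tau n) * n.+2%:R)) @[n --> \oo] --> (0 : R).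
  rewrite (_ : 0 = (1 + sg) * (c * 1)^-1 * 0); last by rewrite mulr0.
  under eq_fun do rewrite (invfM (c * _)) mulrA.
  apply: cvgM; last exact: cvg_inv_natSS.
  apply: cvgM => //; apply: cvgV; first by rewrite gt_eqF// mulr_gt0.
  by apply: cvgM => //; exact: cvg_cst.
near=> n.
have n0 : (0 < n)%N by near: n; exact: nbhs_infty_gt.
have al1 : 0 < 1 + tau n by near: n; exact: (cvgr_gt _ hal).
have be1 : 0 < b - tau n by near: n; exact: (cvgr_gt _ hbe).
have A1 : 0 < 1 + (1 + tau n) * sg by near: n; exact: (cvgr_gt _ hA).
have B1 : 0 < 1 - (b - tau n) * sg by near: n; exact: (cvgr_gt _ hB).
apply: (le_trans _ (centroid_polar_ge n0 al1 be1 A1 B1 c0 _)); last first.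
  near: n; apply: (cvgr_le _ hX); rewrite /c; lra.
by rewrite lerD2l lerN2; near: n; exact: (cvgr_le _ hE).
Unshelve. all: by end_near. Qed.

Lemma lt4epi : 4 < e * pi.
Proof.
have e2 : 2 < e by have := @expR_gt1Dx R 1; rewrite oner_eq0 => /(_ isT); lra.
by have := @pi_ge2 R; nra.
Qed.

Lemma sqrt_epi_gt2 : 2 < Num.sqrt (e * pi).
Proof.
have -> : 2 = Num.sqrt (2 ^+ 2) :> R by rewrite sqrtr_sqr ger0_norm.
by rewrite ltr_sqrt; have := lt4epi; lra.
Qed.

Lemma sqrt_e_gt1 : 1 < Num.sqrt e.
Proof.
by rewrite -[X in X < _]sqrtr1 ltr_sqrt; have := @expR1_gt2 R; lra.
Qed.

Local Notation s0 := (- ((Num.sqrt e - 1) / (Num.sqrt e + b))).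
Local Notation s1 := ((2 - Num.sqrt (e * pi)) / (Num.sqrt (e * pi) + 2 * b)).

Lemma s1_lt0 : s1 < 0.
Proof.
have b0 := @height_gt0 R; have w2 := sqrt_epi_gt2.
by rewrite ltr_pdivrMr ?mul0r; lra.
Qed.

(** The critical equations are linear: 2 (1 - b s) = sqrt (e pi) (1 + s) at s1 and sqrt e (1 + s) =
    1 - b s at s0. Moving slightly outwards makes them the strict inequalities required. *)
Lemma near_centroid_polar (tau : nat -> R) (eps : R) : tau @ \oo --> (0 : R) -> 0 < eps ->
  \forall n \near \oo, s0 - eps <= centroid (polar_body n (1 + tau n) (b - tau n)) ord0 ord_max <= s1 + eps.
Proof.
move=> tau0 eps0; have b0 := @height_gt0 R; have e2 := @expR1_gt2 R.
have w2 := sqrt_epi_gt2; have d1 := sqrt_e_gt1; have s10 := s1_lt0.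
set w := Num.sqrt (e * pi) in w2 s10 *; set d := Num.sqrt e in d1 *.
have w_2 : w ^+ 2 = e * pi by rewrite sqr_sqrtr//; have := lt4epi; lra.
have wb : 0 < w + 2 * b by lra.
have db : 0 < d + b by lra.
have s1E : (2 - w) / (w + 2 * b) * (w + 2 * b) = 2 - w by rewrite mulfVK// gt_eqF.
have s0E : - ((d - 1) / (d + b)) * (d + b) = 1 - d by rewrite mulNr mulfVK ?gt_eqF// opprB.
have s1m : -1 < (2 - w) / (w + 2 * b) by rewrite ltr_pdivlMr//; lra.
have s0m : -1 < - ((d - 1) / (d + b)) by rewrite ltrN2 ltr_pdivrMr//; lra.
have s0n : - ((d - 1) / (d + b)) < 0 by rewrite oppr_lt0 divr_gt0//; lra.
move: s10 s1E s0E s1m s0m s0n; set u1 := (2 - w) / _; set u0 := - ((d - 1) / (d + b)) => s10 s1E s0E s1m s0m s0n.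
(* Half of eps goes into passing strictly beyond u1, the other half into the limit. The second bound
   keeps u1 + h1 negative, hence 1 - b (u1 + h1) positive. *)
pose h1 := Num.min (eps / 2) (- u1 / 2).
have h1a : h1 <= eps / 2 by rewrite ge_min lexx.
have h1b : h1 <= - u1 / 2 by rewrite ge_min lexx orbT.
have h10 : 0 < h1 by rewrite lt_min; apply/andP; split; lra.
(* Here the second bound keeps u0 - h0 above -1. *)
pose h0 := Num.min (eps / 2) ((1 + u0) / 2).
have h0a : h0 <= eps / 2 by rewrite ge_min lexx.
have h0b : h0 <= (1 + u0) / 2 by rewrite ge_min lexx orbT.
have h00 : 0 < h0 by rewrite lt_min; apply/andP; split; lra.
have eps2 : 0 < eps / 2 by rewrite divr_gt0.
have A1 : 0 < 1 + (u1 + h1) by lra.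
have B1 : 0 < 1 - b * (u1 + h1) by nra.
have A0 : 0 < 1 + (u0 - h0) by lra.
have B0 : 0 < 1 - b * (u0 - h0) by nra.
have c1 : 4 / (e * pi) * ((1 - b * (u1 + h1)) / (1 + (u1 + h1))) ^+ 2 < 1.
  rewrite -w_2 (_ : 4 / w ^+ 2 * _ = ((2 * (1 - b * (u1 + h1))) / (w * (1 + (u1 + h1)))) ^+ 2); last first.
    by field; rewrite gt_eqF ?gt_eqF//; lra.
  have w0 : 0 < w by lra.
  rewrite expr_lt1//; last by apply: divr_ge0; apply: mulr_ge0; lra.
  rewrite ltr_pdivrMr ?mulr_gt0// mul1r; nra.
have c0 : d * ((1 + (u0 - h0)) / (1 - b * (u0 - h0))) < 1.
  by rewrite mulrA ltr_pdivrMr// mul1r; nra.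
have n1 := near_centroid_polar_le tau0 A1 B1 c1 eps2.
have n0 := near_centroid_polar_ge tau0 A0 B0 c0 eps2.
near=> n; apply/andP; split.
  apply: le_trans (_ : u0 - h0 - eps / 2 <= _); first by lra.
  by near: n.
apply: le_trans (_ : u1 + h1 + eps / 2 <= _); last by lra.
by near: n.
Unshelve. all: by end_near. Qed.

Lemma le_limn_esup_near (u v : nat -> \bar R) :
  (\forall n \near \oo, (u n <= v n)%E) -> (limn_esup u <= limn_esup v)%E.
Proof.
move=> uv; apply: le_ereal_inf_tmp => _ [V VF <-].
pose W := V `&` [set n | (u n <= v n)%E].
apply: (@le_trans _ _ (ereal_sup (u @` W))).
  by apply: ereal_inf_lbound; exists W => //; exact: filterI.
apply: ge_ereal_sup => _ [n [Vn uvn] <-]; apply: le_trans uvn _.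
by apply: ereal_sup_ubound; exists n.
Qed.

Lemma limn_esup_cst (l : \bar R) : limn_esup (fun=> l) = l.
Proof. by rewrite is_cvg_limn_esupE; [exact: lim_cst|exact: is_cvg_cst]. Qed.

Lemma limn_esup_le_near (u : nat -> \bar R) (l : R) :
  (forall eps : R, 0 < eps -> \forall n \near \oo, (u n <= (l + eps)%:E)%E) ->
  (limn_esup u <= l%:E)%E.
Proof.
move=> ul; apply/lee_addgt0Pr => eps /ul/le_limn_esup_near.
by rewrite limn_esup_cst EFinD.
Qed.

Lemma limn_einf_ge_near (u : nat -> \bar R) (l : R) :
  (forall eps : R, 0 < eps -> \forall n \near \oo, ((l - eps)%:E <= u n)%E) ->
  (l%:E <= limn_einf u)%E.
Proof.
move=> ul; rewrite /limn_einf leeNr -EFinN; apply: limn_esup_le_near => eps /ul.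
by apply: filterS => n; rewrite -[(- l + eps)%R]opprK opprD opprK EFinN leeN2.
Qed.

Lemma eq_limn_einf_near (u v : nat -> \bar R) :
  (\forall n \near \oo, u n = v n) -> limn_einf u = limn_einf v.
Proof.
move=> uv; rewrite /limn_einf; congr (- _)%E; apply/eqP; rewrite eq_le.
by apply/andP; split; apply: le_limn_esup_near; apply: filterS uv => n /= ->.
Qed.

End limits.

Section centroid_Mstar.
Context {R : realType}.
Implicit Types n : nat.
Local Notation b := (@height R).

Lemma polar_at_centroidM n : (0 < n)%N ->
  polar_at (bodyM R n) (centroid (bodyM R n)) = polar_body n (1 + ctr n) (b - ctr n).
Proof. by move=> n0; rewrite centroid_bodyM; apply: polar_atM; exact: ctr_itv. Qed.

Lemma polarM n : polar (bodyM R n) = polar_body n (1 + 0) (b - 0).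
Proof.
have b0 := @height_gt0 R; rewrite -polar_atM; last by lra.
by congr polar_at; apply/rowP => i; case: (unliftP ord_max i) => [j|] ->; rewrite ?snoc_lift ?snoc_max !mxE.
Qed.

Lemma centroid_polar_bodyE n (al be : R) :
  centroid (polar_body n al be) = snoc 0 (centroid (polar_body n al be) ord0 ord_max).
Proof.
apply: centroid_symmetric; [exact: measurable_polar_body|exact: polar_body_symmetric].
Qed.

End centroid_Mstar.

Theorem proposition3 (R : realType) :
  let e : R := expR 1 in
  let M := bodyM R in
  let s0 : R := - ((Num.sqrt e - 1) / (Num.sqrt e + 1 / (e - 1))) in
  let s1 : R :=
    (2 - Num.sqrt (e * pi)) / (Num.sqrt (e * pi) + 2 / (e - 1)) in
  let Mstar n := polar_at (M n) (centroid (M n)) in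
  let gstar n := centroid (Mstar n) in
  let sstar n := santalo_point (Mstar n) in
  [/\ (* (i) *)
      norm2 (centroid (M n)) @[n --> \oo] --> (0 : R),
      (* (ii) *)
      forall eps : R, 0 < eps -> exists n0 : nat, forall n : nat, (n0 <= n)%N ->
        s0 - eps <= centroid (polar (M n)) ord0 ord_max <= s1 + eps,
      forall n : nat, (0 < n)%N ->
        is_santalo_point (Mstar n) (sstar n) /\ sstar n = 0 &
      [/\ (limn_esup (fun n => (norm2 (gstar n - sstar n))%:E) <=
             ((Num.sqrt e - 1) / (Num.sqrt e + 1 / (e - 1)))%:E)%E,
          (limn_einf (fun n => (norm2 (gstar n - sstar n))%:E) <=
             limn_esup (fun n => (norm2 (gstar n - sstar n))%:E))%E,
          limn_einf (fun n => (norm2 (gstar n - sstar n))%:E) =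
            limn_einf (fun n => (norm2 (gstar n))%:E) &
          (((Num.sqrt (e * pi) - 2) / (Num.sqrt (e * pi) + 2 / (e - 1)))%:E <=
             limn_einf (fun n => (norm2 (gstar n))%:E))%E]].
Proof.
move=> e M s0 s1 Mstar gstar sstar.
have s1E : s1 = (2 - Num.sqrt (e * pi)) / (Num.sqrt (e * pi) + 2 * @height R).
  by rewrite /s1 /height mul1r.
have s1lt0 : s1 < 0 by rewrite s1E; exact: s1_lt0.
(* Applied with tau = 0 to the polar of M_n and with tau = [ctr] to the polar at the centroid. *)
have bounds (tau : nat -> R) (eps : R) : tau @ \oo --> (0 : R) -> 0 < eps ->
    \forall n \near \oo,
      s0 - eps <= centroid (polar_body n (1 + tau n) (height - tau n)) ord0 ord_max <= s1 + eps.
  by rewrite s1E; exact: near_centroid_polar.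
have sstarP n : (0 < n)%N -> is_santalo_point (Mstar n) (sstar n) /\ sstar n = 0.
  move=> n0; have [[M0 min0] uniq0] := @santalo_polar_atM R n n0.
  rewrite /sstar /santalo_point; case: xgetP => [s _ [smin _]|]; last by move=> /(_ 0) [].
  by have -> : s = 0 by exact: uniq0.
have gstarE n : (0 < n)%N -> norm2 (gstar n) =
    `|centroid (polar_body n (1 + ctr n) (height - ctr n)) ord0 ord_max|.
  by move=> n0; rewrite /gstar /Mstar polar_at_centroidM// centroid_polar_bodyE norm2_snoc0 snoc_max.
have gs n : (0 < n)%N -> gstar n - sstar n = gstar n.
  by move=> /sstarP[_ ->]; rewrite subr0.
have near0 : \forall n \near \oo, (0 < n)%N by exact: nbhs_infty_gt.
have ctr0 := @cvg_ctr R.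
split; [| |exact: sstarP|].
- rewrite (_ : (fun n => _) = (fun n => `|ctr n|)); last first.
    by apply/funext => n; rewrite /M centroid_bodyM norm2_snoc0.
  exact/norm_cvg0P.
- move=> eps eps0; have [n0 _ n0P] := bounds (fun=> 0) eps (cvg_cst 0) eps0.
  by exists n0 => n n0n; rewrite /M polarM; exact: n0P.
split.
- apply: limn_esup_le_near => eps eps0.
  near=> n; have n0 : (0 < n)%N by near: n.
  rewrite gs// gstarE// lee_fin.
  have /andP[h1 h2] : s0 - eps <= centroid (polar_body n (1 + ctr n) (height - ctr n)) ord0 ord_max <= s1 + eps.
    by near: n; exact: bounds.
  have s0E : (Num.sqrt e - 1) / (Num.sqrt e + 1 / (e - 1)) = - s0 by rewrite opprK.
  have s01 : s0 < 0.
    have b0 : 0 < 1 / (e - 1) := @height_gt0 R.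
    have d1 : 1 < Num.sqrt e := @sqrt_e_gt1 R.
    by rewrite /s0 oppr_lt0; apply: divr_gt0; lra.
  by rewrite s0E ler_norml; lra.
- exact: limn_einf_sup.
- by apply: eq_limn_einf_near; apply: filterS near0 => n n0; rewrite gs.
apply: limn_einf_ge_near => eps eps0.
near=> n; have n0 : (0 < n)%N by near: n.
rewrite gstarE// lee_fin.
have /andP[_ h2] : s0 - eps <= centroid (polar_body n (1 + ctr n) (height - ctr n)) ord0 ord_max <= s1 + eps.
  by near: n; exact: bounds.
have -> : (Num.sqrt (e * pi) - 2) / (Num.sqrt (e * pi) + 2 / (e - 1)) = - s1.
  by rewrite /s1 -mulNr opprB.
rewrite -normrN; apply: le_trans (ler_norm _); lra.
Unshelve. all: by end_near. Qed.
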